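(* Let $1\leq m\leq n-1$ be integers. If $E\subseteq\mathbb{R}^n$ is uniformly disconnected and $\dim_A E<m$, then there exists a bi-Lipschitz embedding $f:\mathbb{R}^m \to \mathbb{R}^n$ such that $E\subseteq f(\mathbb{R}^m)$.
   Context: Write $\operatorname{gap}(A,B):=\inf_{x\in A}\inf_{y\in B}|x-y|$ (with distance in place of $|x-y|$ in a general metric space; the gap is $+\infty$ if one set is empty). Uniform disconnectedness: a metric space $X$ is $c$-uniformly disconnected ($c\ge1$) if for all $x\in X$ and all (finite) $0<r\le\operatorname{diam}X$ there exists $E_{x,r}\subseteq X$ containing $x$ with $\operatorname{diam}E_{x,r}\le r$ and $\operatorname{gap}(E_{x,r},X\setminus E_{x,r})\ge r/c$. $X$ is uniformly disconnected if it is $c$-uniformly disconnected for some $c\ge 1$. Assouad dimension: for a metric space $X$, $\beta>0$ and $C>1$, $X$ is $(C,\beta)$-homogeneous if for every bounded set $A\subseteq X$ and every $\delta\in(0,1)$ there exist sets $A_1,\dots,A_N\subseteq X$ with $A\subseteq A_1\cup\dots\cup A_N$, $\operatorname{diam}A_i\le\delta\operatorname{diam}A$ for all $i$, and $\operatorname{card}\{A_1,\dots,A_N\}\le C\delta^{-\beta}$. $X$ is $\beta$-homogeneous if it is $(C,\beta)$-homogeneous for some $C>1$. Then $\dim_A X:=\inf\{\beta>0: X\text{ is }\beta\text{-homogeneous}\}\in[0,\infty]$. A bi-Lipschitz embedding is a map $f$ for which there is $1\le L<\infty$ with $L^{-1}|x-y|\le|f(x)-f(y)|\le L|x-y|$ for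 all $x,y$ in the domain. *)

(* Defs.v *)
From HB Require Import structures.
From mathcomp Require Import all_boot all_order all_algebra finmap.
From mathcomp Require Import all_classical all_reals all_analysis.
From mathcomp Require Import ring lra.
Set Implicit Arguments.
Unset Strict Implicit.
Unset Printing Implicit Defensive.
Import Order.TTheory GRing.Theory Num.Theory.
Local Open Scope classical_set_scope.
Local Open Scope ring_scope.

(* R^n with the Euclidean distance. An alias of 'rV[R]_n is needed because the
   canonical metric structure on matrices comes from the sup norm. *)
Definition euclidean (R : realType) (n : nat) : Type := 'rV[R]_n.

HB.instance Definition _ (R : realType) (n : nat) :=
  Choice.copy (euclidean R n) 'rV[R]_n.

Definition enorm (R : realType) (n : nat) (x : 'rV[R]_n) : R :=
  Num.sqrt (\sum_(i < n) x ord0 i ^+ 2).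

Definition edist (R : realType) (n : nat) (x y : euclidean R n) : R :=
  enorm ((x : 'rV[R]_n) - (y : 'rV[R]_n)).

Section EuclideanMetric.
Variables (R : realType) (n : nat).
Implicit Types x y z : 'rV[R]_n.

Lemma enorm_sqr x : enorm x ^+ 2 = \sum_(i < n) x ord0 i ^+ 2.
Proof. by rewrite /enorm sqr_sqrtr// sumr_ge0// => i _; exact: sqr_ge0. Qed.

Lemma enorm_eq0 x : enorm x = 0 -> x = 0.
Proof.
move=> x0; have /eqP := enorm_sqr x; rewrite x0 expr0n/= eq_sym.
rewrite psumr_eq0 => [/allP xi|i _]; last exact: sqr_ge0.
apply/rowP => i; rewrite mxE.
by have := xi i (mem_index_enum i); rewrite /= sqrf_eq0 => /eqP.
Qed.

Lemma enormN x : enorm (- x) = enorm x.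
Proof. by congr Num.sqrt; apply: eq_bigr => i _; rewrite mxE sqrrN. Qed.

Lemma enorm0 : enorm (0 : 'rV[R]_n) = 0.
Proof. by rewrite /enorm big1 ?sqrtr0// => i _; rewrite mxE expr0n. Qed.

Lemma enorm_cauchy_schwarz x y :
  \sum_(i < n) x ord0 i * y ord0 i <= enorm x * enorm y.
Proof.
have [x0|xn0] := eqVneq (enorm x) 0.
  by rewrite x0 mul0r (enorm_eq0 x0) big1// => i _; rewrite mxE mul0r.
have [y0|yn0] := eqVneq (enorm y) 0.
  by rewrite y0 mulr0 (enorm_eq0 y0) big1// => i _; rewrite mxE mulr0.
have xp : 0 < enorm x by rewrite lt_neqAle eq_sym xn0 sqrtr_ge0.
have yp : 0 < enorm y by rewrite lt_neqAle eq_sym yn0 sqrtr_ge0.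
have : 0 <= \sum_(i < n) (enorm y * x ord0 i - enorm x * y ord0 i) ^+ 2.
  by apply: sumr_ge0 => i _; exact: sqr_ge0.
rewrite (eq_bigr (fun i : 'I_n => enorm y ^+ 2 * x ord0 i ^+ 2
  + (enorm x ^+ 2 * y ord0 i ^+ 2
  + (- (2 * (enorm x * enorm y))) * (x ord0 i * y ord0 i)))); last first.
  by move=> i _; ring.
rewrite !big_split/= -!mulr_sumr -!enorm_sqr.
set s := \sum_(i < n) _.
have -> : enorm y ^+ 2 * enorm x ^+ 2 + (enorm x ^+ 2 * enorm y ^+ 2
    + - (2 * (enorm x * enorm y)) * s)
  = (2 * (enorm x * enorm y)) * (enorm x * enorm y - s) by ring.
by rewrite pmulr_rge0 ?subr_ge0// !mulr_gt0.
Qed.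

Lemma enormD x y : enorm (x + y) <= enorm x + enorm y.
Proof.
rewrite -(@ler_pXn2r _ 2)// ?nnegrE ?addr_ge0 ?sqrtr_ge0//.
rewrite enorm_sqr (eq_bigr (fun i : 'I_n => x ord0 i ^+ 2
  + (y ord0 i ^+ 2 + 2 * (x ord0 i * y ord0 i)))); last first.
  by move=> i _; rewrite mxE; ring.
rewrite !big_split/= -mulr_sumr -!enorm_sqr.
have := enorm_cauchy_schwarz x y; nra.
Qed.

Let edistxx (x : euclidean R n) : edist x x = 0.
Proof. by rewrite /edist subrr enorm0. Qed.

Let edist_positivity (x y : euclidean R n) : edist x y = 0 -> x = y.
Proof. by move/enorm_eq0/eqP; rewrite subr_eq0 => /eqP. Qed.

Let edist_sym (x y : euclidean R n) : edist x y = edist y x.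
Proof. by rewrite /edist -enormN opprB. Qed.

Let edist_triangle (y x z : euclidean R n) :
  edist x z <= edist x y + edist y z.
Proof.
rewrite /edist; apply: le_trans (enormD _ _).
by rewrite addrA subrK.
Qed.

HB.instance Definition _ := @isMetric.Build R (euclidean R n) (@edist R n)
  edistxx edist_positivity edist_sym edist_triangle.

End EuclideanMetric.

(* Below, a set X in a metric space stands for the metric space obtained by
   restricting the distance to X. *)

Section MetricNotions.
Variables (R : realType) (T : metricType R).
Implicit Types A B X : set T.
Local Open Scope ereal_scope.

(* The point 0 is added so that the empty set has diameter 0 (the supremum of
   the empty set in \bar R being -oo). *)
Definition diam A : \bar R :=
  ereal_sup (0 |` [set (mdist x y)%:E | x in A & y in A]).

Definition gap A B : \bar R :=
  ereal_inf [set ereal_inf [set (mdist x y)%:E | y in B] | x in A].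

Definition c_uniformly_disconnected (c : R) X : Prop :=
  forall (x : T) (r : R), X x -> (0 < r)%R -> r%:E <= diam X ->
  exists E : set T, [/\ E `<=` X, E x, diam E <= r%:E
                      & (r / c)%:E <= gap E (X `\` E)].

Definition uniformly_disconnected X : Prop :=
  exists c : R, (1 <= c)%R /\ c_uniformly_disconnected c X.

(* The finite set F of sets is {A_1, ..., A_N}. *)
Definition C_homogeneous (C beta : R) X : Prop :=
  forall (A : set T) (delta : R), A `<=` X -> diam A < +oo ->
  (0 < delta < 1)%R ->
  exists F : {fset set T},
    [/\ A `<=` \bigcup_(B in [set` F]) B,
        forall B, B \in F -> B `<=` X /\ diam B <= delta%:E * diam A
      & ((#|` F|)%:R <= C * delta `^ (- beta))%R].

Definition homogeneous (beta : R) X : Prop :=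
  exists C : R, (1 < C)%R /\ C_homogeneous C beta X.

Definition assouad_dim X : \bar R :=
  ereal_inf [set beta%:E | beta in [set b : R | (0 < b)%R /\ homogeneous b X]].

End MetricNotions.

Definition bilipschitz_embedding (R : realType) (T U : metricType R)
    (f : T -> U) : Prop :=
  exists L : R, 1 <= L /\
    forall x y : T, L^-1 * mdist x y <= mdist (f x) (f y) <= L * mdist x y.

(* Main.v *)
Require Import Defs.
From mathcomp Require Import all_boot all_order all_algebra.
From mathcomp Require Import all_classical all_reals all_analysis.
From mathcomp Require Import ring lra zify.
Set Implicit Arguments.
Unset Strict Implicit.
Unset Printing Implicit Defensive.
Import Order.TTheory GRing.Theory Num.Theory.
Local Open Scope classical_set_scope.
Local Open Scope ring_scope.

(* Idea. Work with the sup norm and call the last coordinate the height. A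
   thin tube around a rising path carries a bi-Lipschitz homeomorphism that
   moves a small cube rigidly from the start of the path to its end. Start from
   a horizontal m-plane below E, and push little cubes of it along disjoint
   tubes to points just below each cluster of E at a small scale; inside each
   moved cube the surface is again a horizontal plane, so the step can be
   repeated around every cluster. Because distinct children act in disjoint
   regions, comparable to their distances from everything else, the composed
   map keeps one and the same bi-Lipschitz constant at all depths
   (star_catches). An ultrafilter limit over the depth and over the radius of
   the part of E that is caught gives the embedding.

   The tubes have to avoid one another and the clusters. For n > 2 the clusters
   come from uniform disconnectedness, the routes are axis-parallel, and their
   corners are chosen greedily on a fine grid: dim_A E < n - 1 leaves enough
   positions whose coordinates are all far from those used by the routes
   nearby and whose lines miss E, while dim_A E < m leaves enough starting
   places in the m-plane. For n = 2 and m = 1, dim_A E < 1 already gives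
   gaps in both coordinate projections of E, which cut E into nested cells of a
   grid that are reached by comb-shaped routes. *)

(** * Pushing a ball along a path *)

(** Up to the tube width, every point of a route for n > 2 lies on an axis-parallel line whose fixed
    coordinates come from two consecutive corners. Two such lines share a fixed coordinate as soon
    as n >= 3, so it suffices to separate corners coordinate by coordinate; in the plane this breaks
    down, whence the other construction there. The threat is circular: corners are placed with a
    resolution [eta], and the smaller [eta] is, the more levels can interfere. Taking 1 / [eta] =
    [lam ^+ A] breaks the circle. Routes that branched at some level and both lie about [A] levels
    deeper stay near clusters that are far apart, and a route about [2 * A] levels deeper hugs a
    point of E that a shallower one avoids. Hence only O([A]) levels have to be compared, against
    [lam ^+ A] grid positions per coordinate. All constants are fixed before the radius, the
    precision and the depth, in the order [lam], [A], [eta], [b], [T]. *)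

Lemma row_norm_leP (R : realType) (n : nat) (x : 'rV[R]_n) (c : R) :
  0 <= c -> `|x| <= c <-> forall l, `|x ord0 l| <= c.
Proof.
move=> c0; rewrite [`|x|]mx_normrE; split => [|h].
  move=> /bigmax_leP[_ h] l; exact: (h (ord0, l)).
by apply/bigmax_leP; split => // -[i l] _ /=; rewrite (ord1 i).
Qed.

Lemma coord_le_norm (R : realType) (n : nat) (x : 'rV[R]_n) l :
  `|x ord0 l| <= `|x|.
Proof. by apply: (row_norm_leP x (normr_ge0 x)).1. Qed.

Lemma coordB (R : realType) (n : nat) (x y : 'rV[R]_n) l :
  (x - y) ord0 l = x ord0 l - y ord0 l.
Proof. by rewrite !mxE. Qed.

Lemma coordB_le_norm (R : realType) (n : nat) (x y : 'rV[R]_n) l :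
  `|x ord0 l - y ord0 l| <= `|x - y|.
Proof. by have := coord_le_norm (x - y) l; rewrite !mxE. Qed.

Lemma dist_triangle (R : realType) (n : nat) (y x z : 'rV[R]_n) :
  `|x - z| <= `|x - y| + `|y - z|.
Proof. by rewrite -[x - z](subrKA y) ler_normD. Qed.

Section Push.
Variables (R : realType) (n : nat).
Implicit Types (x y a v : 'rV[R]_n) (f g : 'rV[R]_n -> 'rV[R]_n).

Definition bilip (M : R) f := forall x y,
  `|x - y| <= M * `|f x - f y| /\ `|f x - f y| <= M * `|x - y|.

Lemma bilip_inj M f : bilip M f -> injective f.
Proof.
move=> fM x y fxy; have [] := fM x y; rewrite fxy subrr normr0 mulr0.
by rewrite normr_le0 subr_eq0 => /eqP.
Qed.

Lemma bilip_id M : 1 <= M -> bilip M id.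
Proof. by move=> M1 x y; have := normr_ge0 (x - y); split; nra. Qed.

Lemma bilip_comp M N f g : 0 <= M -> 0 <= N ->
  bilip M f -> bilip N g -> bilip (M * N) (g \o f).
Proof.
move=> M0 N0 fM gN x y /=; have [f1 f2] := fM x y.
have [g1 g2] := gN (f x) (f y); split.
  by apply: le_trans f1 _; rewrite -mulrA ler_wpM2l.
by apply: le_trans g2 _; rewrite (mulrC M) -mulrA ler_wpM2l.
Qed.

Lemma bilip_le M N f : M <= N -> bilip M f -> bilip N f.
Proof.
move=> MN fM x y; have [f1 f2] := fM x y; split.
  by apply: le_trans f1 _; rewrite ler_wpM2r.
by apply: le_trans f2 _; rewrite ler_wpM2r.
Qed.

Definition cutoff (r : R) (z : 'rV[R]_n) : R :=
  Num.max 0 (Num.min 1 (2 - `|z| / r)).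

Lemma cutoff_ge0 r z : 0 <= cutoff r z.
Proof. by rewrite /cutoff le_max lexx. Qed.

Lemma cutoff_le1 r z : cutoff r z <= 1.
Proof. by rewrite /cutoff ge_max ler01 ge_min lexx. Qed.

Lemma cutoff_core r z : 0 < r -> `|z| <= r -> cutoff r z = 1.
Proof.
move=> r0 zr; have : `|z| / r <= 1 by rewrite ler_pdivrMr// mul1r.
move=> h; rewrite /cutoff min_l; last lra.
by rewrite max_r// ler01.
Qed.

Lemma cutoff_far r z : 0 < r -> 2 * r <= `|z| -> cutoff r z = 0.
Proof.
move=> r0 zr; have : 2 <= `|z| / r by rewrite ler_pdivlMr.
move=> h; rewrite /cutoff max_l// ge_min; apply/orP; right; lra.
Qed.

Lemma clamp_lip (s t : R) :
  `|Num.max 0 (Num.min 1 s) - Num.max 0 (Num.min 1 t)| <= `|s - t|.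
Proof.
wlog st : s t / s <= t.
  move=> h; case: (leP s t) => [|/ltW] st; first exact: h.
  by rewrite distrC (distrC s); exact: h.
have m1 : Num.min 1 s <= Num.min 1 t by rewrite le_min !ge_min lexx st orbT.
rewrite !(distrC _ (Num.max 0 (Num.min 1 t))) (distrC s) !ger0_norm ?subr_ge0//.
  rewrite /Num.max /Num.min.
  by case: (ltP 1 s) => ?; case: (ltP 1 t) => ?; do 2 case: ltP => ?; lra.
by rewrite ge_max !le_max lexx m1 orbT.
Qed.

Lemma cutoff_lip r x y : 0 < r ->
  `|cutoff r x - cutoff r y| <= `|x - y| / r.
Proof.
move=> r0; apply: le_trans (clamp_lip _ _) _.
have -> : 2 - `|x| / r - (2 - `|y| / r) = (`|y| - `|x|) / r by field; lra.
rewrite normrM [`|r^-1|]gtr0_norm ?invr_gt0// ler_pM2r ?invr_gt0//.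
by rewrite (distrC x) ler_dist_dist.
Qed.

(** The displacement is 1/2-Lipschitz, because [cutoff] is 1/r-Lipschitz and [v] has norm at most
    r/2; such a perturbation of the identity distorts distances by a factor at most 2. *)
Lemma step_bilip a v r : 0 < r -> `|v| <= r / 2 ->
  bilip 2 (fun x => x + cutoff r (x - a) *: v).
Proof.
move=> r0 vr x y.
have -> : x + cutoff r (x - a) *: v - (y + cutoff r (y - a) *: v) =
    (x - y) + (cutoff r (x - a) - cutoff r (y - a)) *: v.
  by rewrite scalerBl opprD addrACA.
set c := cutoff r (x - a) - cutoff r (y - a).
have cv : `|c *: v| <= `|x - y| / 2.
  rewrite normrZ; have := cutoff_lip (x - a) (y - a) r0.
  rewrite -/c opprB addrA subrK => cr.
  apply: (@le_trans _ _ (`|x - y| / r * (r / 2))); first exact: ler_pM.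
  by rewrite le_eqVlt; apply/orP; left; apply/eqP; field; lra.
have h1 : `|x - y + c *: v| <= `|x - y| + `|c *: v| by exact: ler_normD.
have h2 : `|x - y| <= `|x - y + c *: v| + `|c *: v|.
  by rewrite -{1}[x - y](addrK (c *: v)) ler_normB.
by have := normr_ge0 (x - y); split; lra.
Qed.

End Push.

Section PushTrail.
Variables (R : realType) (n : nat) (top : 'I_n) (r : R).
Hypothesis r0 : 0 < r.
Implicit Types (x y a b v : 'rV[R]_n) (f g : 'rV[R]_n -> 'rV[R]_n).

Definition far (G : set 'rV[R]_n) x := forall y, G y -> 2 * r <= `|x - y|.

Definition segm a b : set 'rV[R]_n :=
  [set x | exists t : R, [/\ 0 <= t, t <= 1 & x = a + t *: (b - a)]].

Fixpoint trail a (l : seq 'rV[R]_n) : set 'rV[R]_n :=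
  if l is b :: l' then segm a b `|` trail b l' else [set a].

(* The last clause says that whatever lies below the moved cube stays below it. *)
Definition pushes (M : R) (G : set 'rV[R]_n) a b f :=
  [/\ bilip M f, forall x, far G x -> f x = x,
      forall x, `|x - a| <= r -> f x = x + (b - a)
    & forall x, x ord0 top <= a ord0 top -> f x ord0 top <= b ord0 top].

Lemma pushes_comp M N (G H : set 'rV[R]_n) a b c f g : 0 <= M -> 0 <= N ->
  pushes M G a b f -> pushes N H b c g -> pushes (M * N) (G `|` H) a c (g \o f).
Proof.
move=> M0 N0 [f1 f2 f3 f4] [g1 g2 g3 g4]; split => [|x xGH|x xa|x xa] /=.
- exact: bilip_comp.
- rewrite f2 ?g2// => y ?; apply: xGH; by [left|right].
- have fb : f x - b = x - a by rewrite f3//; apply/rowP => l; rewrite !mxE; ring.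
  rewrite g3 ?fb// f3//; apply/rowP => l; rewrite !mxE; ring.
- by rewrite g4// f4.
Qed.

Lemma step_pushes a v : `|v| <= r / 2 -> 0 <= v ord0 top ->
  pushes 2 [set a] a (a + v) (fun x => x + cutoff r (x - a) *: v).
Proof.
move=> vr v0; split => [|x xa|x xa|x xa].
- exact: step_bilip.
- by rewrite cutoff_far// ?scale0r ?addr0// xa.
- by rewrite cutoff_core// scale1r; apply/rowP => l; rewrite !mxE; ring.
- by rewrite !mxE; have := cutoff_ge0 r (x - a); have := cutoff_le1 r (x - a); nra.
Qed.

Lemma pushes_sub M (G H : set 'rV[R]_n) a b f : G `<=` H ->
  pushes M G a b f -> pushes M H a b f.
Proof.
by move=> GH [f1 f2 f3 f4]; split => // x xH; apply: f2 => y /GH; exact: xH.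
Qed.

Lemma steps_push (T : nat) a v : `|v| <= r / 2 -> 0 <= v ord0 top ->
  exists f, pushes (2 ^+ T) [set x | exists2 k : nat, (k < T)%N & x = a + k%:R *: v]
    a (a + T%:R *: v) f.
Proof.
move=> vr v0; elim: T => [|T [f fP]].
  exists id; rewrite expr0 scale0r addr0; split => //; first exact: bilip_id.
  by move=> x _; rewrite subrr addr0.
exists ((fun x => x + cutoff r (x - (a + T%:R *: v)) *: v) \o f).
have -> : a + T.+1%:R *: v = a + T%:R *: v + v.
  by rewrite -natr1 scalerDl scale1r addrA.
rewrite exprSr.
apply: (pushes_sub _ (pushes_comp _ _ fP (step_pushes _ vr v0))) => //.
  move=> x [[k kT ->]|->]; first by exists k => //; rewrite ltnW.
  by exists T.
Qed.

(** The segment is cut into [T] steps short enough for [step_pushes], so the constant depends only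
    on the ratio of its length to [r]. *)
Lemma segm_push (T : nat) a b : (0 < T)%N -> `|b - a| <= T%:R * (r / 2) ->
  a ord0 top <= b ord0 top -> exists f, pushes (2 ^+ T) (segm a b) a b f.
Proof.
move=> T0 abT ab; have TR : 0 < T%:R :> R by rewrite ltr0n.
have [] := @steps_push T a (T%:R^-1 *: (b - a)).
- rewrite normrZ gtr0_norm ?invr_gt0// mulrC ler_pdivrMr//.
  by rewrite mulrC.
- rewrite !mxE; apply: mulr_ge0; first by rewrite invr_ge0 ltW.
  by rewrite subr_ge0.
move=> f; rewrite scalerA divff ?gt_eqF// scale1r [a + (b - a)]addrC subrK => fP.
exists f; apply: pushes_sub fP => x [k kT ->].
exists (k%:R / T%:R); split.
- by rewrite divr_ge0.
- by rewrite ler_pdivrMr// mul1r ler_nat ltnW.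
- by rewrite scalerA.
Qed.

Lemma trail_push (T : nat) a l : (0 < T)%N ->
  path (fun a b => (`|b - a| <= T%:R * (r / 2)) && (a ord0 top <= b ord0 top)) a l ->
  exists f, pushes ((2 ^+ T) ^+ size l) (trail a l) a (last a l) f.
Proof.
move=> T0; elim: l a => [|b l ih] a /=.
  move=> _; exists id; split => //; first exact: bilip_id.
  by move=> x _; rewrite subrr addr0.
move=> /andP[/andP[ab1 ab2] /ih[g gP]].
have [f fP] := segm_push T0 ab1 ab2.
exists (g \o f); rewrite exprS; apply: pushes_comp fP gP;
  rewrite ?exprn_ge0//.
Qed.

End PushTrail.

(** By injectivity: if [f x] left [Z], it would be fixed, and then [x] and [f x] would have the same
    image. *)
Lemma bilip_supp (R : realType) (n : nat) (M : R) (f : 'rV[R]_n -> 'rV[R]_n)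
    (Z : set 'rV[R]_n) :
  bilip M f -> (forall x, ~ Z x -> f x = x) -> forall x, Z x -> Z (f x).
Proof.
move=> fM fZ x Zx; apply: contrapT => nZ.
by have /(bilip_inj fM) fx := fZ _ nZ; rewrite fx in nZ.
Qed.

(** The maps are composed one after the other. Each preserves its own [Z i] and fixes the others
    pointwise, so on [Z i] only [f i] is felt. *)
Lemma bilip_disjoint (R : realType) (n : nat) (I : eqType) (s : seq I)
    (Z : I -> set 'rV[R]_n) (f : I -> 'rV[R]_n -> 'rV[R]_n) (M : R) :
  1 <= M -> uniq s -> (forall i, i \in s -> bilip M (f i)) ->
  (forall i x, i \in s -> ~ Z i x -> f i x = x) ->
  (forall i j x, i \in s -> j \in s -> Z i x -> Z j x -> i = j) ->
  exists F, [/\ bilip (M ^+ size s) F,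
    forall i x, i \in s -> Z i x -> F x = f i x &
    forall x, (forall i, i \in s -> ~ Z i x) -> F x = x].
Proof.
move=> M1; elim: s => [|i s ih] /=.
  by move=> _ _ _ _; exists id; split => //; exact: bilip_id.
move=> /andP[iNs us] fM fZ ZZ.
have [//|j js|j x js|j k x js ks|F [F1 F2 F3]] := ih.
- by apply: fM; rewrite in_cons js orbT.
- by apply: fZ; rewrite in_cons js orbT.
- by apply: ZZ; rewrite in_cons ?js ?ks orbT.
have iis : i \in i :: s by rewrite in_cons eqxx.
exists (f i \o F); rewrite exprSr; split.
- apply: bilip_comp => //; rewrite ?exprn_ge0//; try lra.
  exact: fM.
- move=> j x; rewrite in_cons => /orP[/eqP ->|js] Zx /=.
    rewrite F3// => k ks Zk.
    have ik : i = k by apply: (ZZ i k x) => //; rewrite in_cons ks orbT.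
    by rewrite ik ks in iNs.
  have jis : j \in i :: s by rewrite in_cons js orbT.
  rewrite (F2 j)// fZ// => Zi.
  have Zj := bilip_supp (fM _ jis) (fun x => @fZ j x jis) Zx.
  have ij := ZZ i j _ iis jis Zi Zj; by rewrite ij js in iNs.
- move=> x nZ /=; rewrite F3 ?fZ//; first exact: nZ.
  by move=> j js; apply: nZ; rewrite in_cons js orbT.
Qed.

(** * Gluing disjoint deformations *)

Section Star.
Variables (R : realType) (n : nat) (J : pred 'I_n) (top : 'I_n).
Implicit Types (x y z a p : 'rV[R]_n) (V S : set 'rV[R]_n).

Definition plane p : set 'rV[R]_n :=
  [set x | forall l, ~~ J l -> x ord0 l = p ord0 l].

(* The plane through p can be deformed inside V into a bi-Lipschitz copy of
   itself that comes eps-close to each point of S. The bound K between points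
   of the deformed plane and points off V is what allows the deformations in
   disjoint regions to be glued without losing control of L. *)
Definition catcher (L K eps : R) V p S (g : 'rV[R]_n -> 'rV[R]_n) :=
  [/\ forall x, ~ V x -> g x = x,
      forall x, plane p x -> V x -> V (g x),
      forall x y, plane p x -> plane p y ->
        `|x - y| <= L * `|g x - g y| /\ `|g x - g y| <= L * `|x - y|,
      forall x z, plane p x -> ~ V z ->
        `|x - z| <= K * `|g x - z| /\ `|g x - z| <= K * `|x - z|
    & forall a, S a -> exists x, [/\ plane p x, V x & `|g x - a| <= eps]].

Definition catches (L K eps : R) V p S := exists g, catcher L K eps V p S g.

Lemma catches_leaf (L K eps : R) V p S : 1 <= L -> 1 <= K -> V p ->
  (forall a, S a -> `|p - a| <= eps) -> catches L K eps V p S.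
Proof.
move=> L1 K1 Vp Se; exists id; split => //.
- move=> x y _ _; exact: bilip_id.
- move=> x y _ _; exact: bilip_id.
- by move=> a /Se; exists p.
Qed.

Variables (r rho Delta M : R) (N : nat) (I : eqType) (s : seq I).
Variables (V S : set 'rV[R]_n) (p : 'rV[R]_n).
Variables (W T G : I -> set 'rV[R]_n) (q st : I -> 'rV[R]_n).
Variable f : I -> 'rV[R]_n -> 'rV[R]_n.
Let Z i : set 'rV[R]_n := [set x | exists2 y, G i y & `|x - y| < 2 * r].
(** [Delta] bounds the diameter of [V], and [rho] is the distance that a child's region keeps from
    the other children and from the outside of [V]. Their ratio is the price of moving a point
    within [V] when it starts and ends in children's regions; [M ^+ N] is the price of the tubes. *)
Let K := M ^+ N * (Delta / rho + 1).

Hypotheses (r0 : 0 < r) (rho0 : 0 < rho) (Delta0 : 0 <= Delta) (M1 : 1 <= M).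
Hypotheses (topJ : ~~ J top) (us : uniq s) (sN : (size s <= N)%N).
Hypothesis fP : forall i, i \in s -> pushes top r M (G i) (st i) (q i) (f i).
Hypothesis Gst : forall i, i \in s -> G i (st i).
Hypothesis pst : forall i, i \in s -> plane p (st i).
Hypothesis Wtop : forall i x, i \in s -> W i x -> p ord0 top < x ord0 top.
Hypothesis Wq : forall i x, i \in s -> W i x -> x ord0 top <= q i ord0 top ->
  `|x - q i| <= r.
Hypothesis ZZ : forall i j x, i \in s -> j \in s -> Z i x -> Z j x -> i = j.
Hypothesis WZ : forall i j x, i \in s -> j \in s -> W i x -> Z j x -> i = j.
Hypothesis ZV : forall i x, i \in s -> Z i x -> V x.
Hypothesis WV : forall i x z, i \in s -> W i x -> ~ V z -> rho <= `|x - z|.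
Hypothesis WW : forall i j x y, i \in s -> j \in s -> i != j -> W i x -> W j y ->
  rho <= `|x - y|.
Hypothesis VV : forall x y, V x -> V y -> `|x - y| <= Delta.
Hypothesis ST : forall a, S a -> exists2 i, i \in s & T i a.

(** The constant [L = M ^+ N * K] reproduces itself. Two points in one child's region come from one
    rigidly moved cube, so the child's bound passes on unchanged. Points in different children are
    at distances between [rho] and [Delta] before and after. For one point in a child and one
    outside all children, the child's [K] and the factor [M ^+ N] of the tubes multiply to exactly
    [L]. And [K] reproduces itself because children stay [rho] away from the outside of [V]. *)
Lemma star_catches (eps : R) :
  (forall i, i \in s -> catches (M ^+ N * K) K eps (W i) (q i) (T i)) ->
  catches (M ^+ N * K) K eps V p S.
Proof.
move: (r0) (rho0) (Delta0) (M1) => r0' rho0' Delta0' M1' hc.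
have M0 : 0 <= M by exact: le_trans ler01 M1.
have nZfar i x : ~ Z i x -> far r (G i) x.
  by move=> nZ y Gy; rewrite leNgt; apply/negP => xy; apply: nZ; exists y.
have [F [F1' F2 F3]] : exists F, [/\ bilip (M ^+ size s) F,
    forall i x, i \in s -> Z i x -> F x = f i x &
    forall x, (forall i, i \in s -> ~ Z i x) -> F x = x].
  apply: (@bilip_disjoint _ _ _ s Z f M) => //.
    by move=> i /fP[].
  by move=> i x /fP[_ h _ _] /nZfar /h.
pose MN := M ^+ N.
have MN1 : 1 <= MN by rewrite exprn_ege1.
have F1 : bilip MN F by apply: bilip_le F1'; exact: ler_weXn2l.
have FV x : ~ V x -> F x = x.
  by move=> nV; apply: F3 => i js Zi; apply: nV; exact: ZV Zi.
have FVV := bilip_supp F1 FV.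
have FVr x : V (F x) -> V x.
  by move=> VF; apply: contrapT => nV; rewrite (FV _ nV) in VF.
have WVs i x : i \in s -> W i x -> V x.
  move=> js Wx; apply: contrapT => nV.
  have := WV js Wx nV; rewrite subrr normr0; lra.
have cores i x : i \in s -> `|x - st i| <= r -> F x = x + (q i - st i).
  move=> js xr; have [_ _ h _] := fP js.
  rewrite (F2 i)//; first exact: h.
  exists (st i); [exact: Gst|lra].
(* A point of the plane that enters W i comes from the rigidly moved cube. *)
have Xc i x : i \in s -> plane p x -> W i (F x) -> F x = x + (q i - st i).
  move=> js px WF.
  have [k ks Zk] : exists2 k, k \in s & Z k x.
    apply: contrapT => nZ; have Fx : F x = x.
      by apply: F3 => k ks Zk; apply: nZ; exists k.
    by have := Wtop js WF; rewrite Fx (px _ topJ) ltxx.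
  have Fk := F2 _ _ ks Zk; have [k1 k2 k3 k4] := fP ks.
  have Zfk : Z k (f k x).
    by apply: (bilip_supp k1) => // y /nZfar; exact: k2.
  have ik : i = k by apply: WZ WF _ => //; rewrite Fk.
  (* A point of the plane starts no higher than [st i], so its image is no higher than [q i], and
     [Wq] puts all of [W i] that low inside the moved cube. *)
  subst k; have xs : x ord0 top <= st i ord0 top.
    by rewrite (px _ topJ) (pst js topJ).
  have h : `|F x - q i| <= r by apply: Wq => //; rewrite Fk; exact: k4.
  have h2 := cores _ (F x - (q i - st i)) js.
  (* The translate of [F x] back to the start is carried to [F x] as well, so by injectivity it is
     [x]. *)
  have e : F (F x - (q i - st i)) = F x.
    rewrite h2; first by apply/rowP => l; rewrite !mxE; ring.
    have -> // : F x - (q i - st i) - st i = F x - q i.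
    by apply/rowP => l; rewrite !mxE; ring.
  by have := bilip_inj F1 e => {}e; rewrite -{2}e subrK.
have planeF i x : i \in s -> plane p x -> W i (F x) -> plane (q i) (F x).
  move=> js px WF l lJ; rewrite (Xc i)// !mxE (px _ lJ) (pst js lJ); ring.
have Wuniq i j x : i \in s -> j \in s -> W i x -> W j x -> i = j.
  move=> js ks Wi Wj; apply: contrapT => /eqP ij.
  have := WW js ks ij Wi Wj; rewrite subrr normr0; lra.
have /choice[g gP] : forall i, exists h, i \in s ->
    catcher (MN * K) K eps (W i) (q i) (T i) h.
  move=> i; case: (boolP (i \in s)) => [/hc[h hP]|_]; first by exists h.
  by exists id.
have /choice[G' G'P] : forall x, exists y, (forall i, i \in s -> W i x -> y = g i x) /\
    ((forall i, i \in s -> ~ W i x) -> y = x).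
  move=> x; have [[i js Wi]|nW] := pselect (exists2 i, i \in s & W i x).
    exists (g i x); split; last by move=> /(_ i js).
    by move=> j ks Wj; rewrite (Wuniq i j x).
  exists x; split => // i js Wi; case: nW; by exists i.
have G'W i x : i \in s -> W i x -> G' x = g i x by have [h _] := G'P x; exact: h.
have G'N x : (forall i, i \in s -> ~ W i x) -> G' x = x by have [_] := G'P x.
have [/= D1 D2] : 0 < rho / MN /\ 0 <= Delta / rho.
  by split; rewrite ?divr_ge0 ?divr_gt0//; lra.
have K1 : 1 <= K by rewrite /K -/MN; nra.
have MND : MN * Delta <= K * rho.
  have -> : K * rho = MN * (Delta + rho).
    by rewrite /K -/MN; field; rewrite gt_eqF.
  nra.
have GV x : plane p x -> V x -> V (G' (F x)).
  move=> px Vx; have [[i js Wi]|nW] := pselect (exists2 i, i \in s & W i (F x)).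
    rewrite (G'W i)//; have [_ h _ _ _] := gP _ js.
    by apply: (WVs i) => //; apply: h => //; exact: planeF.
  rewrite G'N; first exact: FVV.
  by move=> i js Wi; apply: nW; exists i.
have inW x : (exists2 i, i \in s & W i x) \/ (forall i, i \in s -> ~ W i x).
  have [?|nW] := pselect (exists2 i, i \in s & W i x); first by left.
  by right => i js Wi; apply: nW; exists i.
have MNK1 (t u : R) : 0 <= t -> t <= MN * u -> t <= MN * K * u.
  have MNp : 0 < MN by exact: lt_le_trans MN1.
  move=> t0 tu; apply: (le_trans tu).
  have u0 : 0 <= u by rewrite -(pmulr_rge0 _ MNp); exact: le_trans t0 tu.
  by rewrite ler_wpM2r// ler_peMr// ltW.
exists (G' \o F); split => /=.
- move=> x nV; rewrite FV//; apply: G'N => i js Wi; exact/nV/(WVs i).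
- exact: GV.
- move=> x y px py; have [f1 f2] := F1 x y.
  have xy0 := normr_ge0 (x - y); have fxy0 := normr_ge0 (F x - F y).
  have [[i js Wi]|nW] := inW (F x); have [[j ks Wj]|nWj] := inW (F y).
  + rewrite (@G'W i (F x))// (@G'W j (F y))//.
    have [ij|ij] := eqVneq i j.
      subst j; have [_ _ h _ _] := gP _ js.
      have -> : x - y = F x - F y.
        rewrite (Xc i x)// (Xc i y)//; apply/rowP => l; rewrite !mxE; ring.
      by apply: h; exact: planeF.
    have [_ h1 _ _ _] := gP _ js; have [_ h2 _ _ _] := gP _ ks.
    have a1 := WW js ks ij (h1 _ (planeF _ _ js px Wi) Wi) (h2 _ (planeF _ _ ks py Wj) Wj).
    have a2 := WW js ks ij Wi Wj.
    have a3 := VV (WVs _ _ js (h1 _ (planeF _ _ js px Wi) Wi))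
                 (WVs _ _ ks (h2 _ (planeF _ _ ks py Wj) Wj)).
    have a4 := VV (WVs _ _ js Wi) (WVs _ _ ks Wj).
    have gg0 := normr_ge0 (g i (F x) - g j (F y)).
    split.
      apply: (le_trans f1); apply: (le_trans (_ : _ <= MN * Delta)).
        by rewrite ler_wpM2l//; lra.
      apply: (le_trans MND); rewrite -mulrA.
      apply: (le_trans (_ : _ <= K * `|g i (F x) - g j (F y)|)).
        by rewrite ler_wpM2l//; lra.
      by rewrite ler_peMl// mulr_ge0//; lra.
    apply: le_trans a3 _; rewrite -(@ler_pM2l _ MN) ?(lt_le_trans _ MN1)//.
    apply: le_trans MND _; apply: le_trans (_ : K * (MN * `|x - y|) <= _).
      by rewrite ler_wpM2l ?(le_trans a2)//; lra.
    have -> : MN * (MN * K * `|x - y|) = MN * (K * (MN * `|x - y|)) by ring.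
    by rewrite ler_peMl//; apply: mulr_ge0; [lra|apply: mulr_ge0 => //; lra].
  + rewrite (G'W i)// (G'N (F y))//.
    have [_ _ _ h _] := gP _ js.
    have [h1 h2] := h (F x) (F y) (planeF _ _ js px Wi) (nWj _ js).
    split; first by rewrite -mulrA (le_trans f1)// ler_wpM2l//; lra.
    apply: (le_trans h2); rewrite (mulrC MN K) -[K * MN * _]mulrA ler_wpM2l//; lra.
  + rewrite (@G'W j (F y))// (G'N (F x))//.
    have [_ _ _ h _] := gP _ ks.
    have [] := h (F y) (F x) (planeF _ _ ks py Wj) (nW _ ks).
    rewrite (distrC (F y)) (distrC _ (F x)) => h1 h2.
    split; first by rewrite -mulrA (le_trans f1)// ler_wpM2l//; lra.
    apply: (le_trans h2); rewrite (mulrC MN K) -[K * MN * _]mulrA ler_wpM2l//; lra.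
  + rewrite (G'N (F y))// (G'N (F x))//; split; exact: MNK1.
- move=> x z px nVz.
  have [f1 f2] := F1 x z; rewrite (FV z nVz) in f1 f2.
  have xz0 := normr_ge0 (x - z); have fz0 := normr_ge0 (F x - z).
  have MNK : MN <= K by rewrite /K -/MN; nra.
  have [[i js Wi]|nW] := inW (F x); last first.
    rewrite (G'N (F x))//; split.
      by apply: le_trans f1 _; rewrite ler_wpM2r.
    by apply: le_trans f2 _; rewrite ler_wpM2r.
  rewrite (G'W i)//; have [_ h1 _ _ _] := gP _ js.
  have Wg := h1 _ (planeF _ _ js px Wi) Wi.
  have Vx : V x by apply: FVr; exact: WVs Wi.
  have a1 := WV js Wg nVz; have a2 := WV js Wi nVz.
  have a3 := VV Vx (WVs _ _ js Wg).
  have a4 := dist_triangle (g i (F x)) x z.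
  have := dist_triangle x (g i (F x)) z; rewrite (distrC _ x) => a5.
  have KE : K = MN * (Delta / rho) + MN by rewrite /K -/MN; ring.
  have Dr : Delta = Delta / rho * rho by rewrite divfK// gt_eqF.
  have gz0 := normr_ge0 (g i (F x) - z).
  set D := Delta / rho in D2 KE Dr.
  have D' : Delta <= D * `|g i (F x) - z| by rewrite Dr ler_wpM2l.
  have D'' : Delta <= D * (MN * `|x - z|).
    by rewrite Dr ler_wpM2l//; exact: le_trans a2 f2.
  have MND0 : 0 <= MN * D by nra.
  rewrite KE; split; rewrite mulrDl.
    apply: (le_trans a4); rewrite lerD//; last by rewrite ler_peMl.
    apply: (le_trans a3); apply: (le_trans D').
    by rewrite -mulrA ler_peMl// mulr_ge0.
  apply: (le_trans a5); rewrite lerD//; last by rewrite ler_peMl.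
  by apply: (le_trans a3); apply: (le_trans D''); rewrite mulrA (mulrC D).
- move=> a /ST[i js Ta]; have [_ _ _ _ /(_ _ Ta)[z [pz Wz ge]]] := gP _ js.
  have zq : `|z - q i| <= r by apply: Wq => //; rewrite (pz _ topJ).
  have Fz : F (z - (q i - st i)) = z.
    rewrite (cores i)//; first by apply/rowP => l; rewrite !mxE; ring.
    have -> // : z - (q i - st i) - st i = z - q i.
    by apply/rowP => l; rewrite !mxE; ring.
  exists (z - (q i - st i)); split.
  + move=> l lJ; rewrite !mxE (pz _ lJ) (pst js lJ); ring.
  + by apply: FVr; rewrite Fz; exact: WVs Wz.
  + by rewrite Fz (G'W i).
Qed.

End Star.

(** * Axis-parallel routes *)

Section AxisPath.
Variables (R : realType) (n : nat).
Implicit Types (x y s t : 'rV[R]_n).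

Lemma segm_coord x y z l : segm x y z ->
  (x ord0 l <= y ord0 l -> x ord0 l <= z ord0 l <= y ord0 l) /\
  (x ord0 l = y ord0 l -> z ord0 l = x ord0 l) /\
  `|z ord0 l - x ord0 l| <= `|y ord0 l - x ord0 l|.
Proof.
move=> [t [t0 t1 ->]]; rewrite !mxE; split => [xy|]; first by apply/andP; nra.
split => [->|]; first by ring.
have -> : x ord0 l + t * (y ord0 l - x ord0 l) - x ord0 l =
  t * (y ord0 l - x ord0 l) by ring.
by rewrite normrM ger0_norm// ler_piMl.
Qed.

Definition mixed s t (j : nat) : 'rV[R]_n :=
  \row_l (if (l < j)%N then t ord0 l else s ord0 l).

Lemma mixed_seq_trail s t (j k : nat) y : (j + k <= n)%N ->
  trail (mixed s t j) [seq mixed s t i | i <- iota j.+1 k] y ->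
  y = mixed s t (j + k) \/ exists i : 'I_n,
  [/\ (j <= i)%N, forall l, l != i -> y ord0 l = mixed s t i ord0 l &
      `|y ord0 i - s ord0 i| <= `|t ord0 i - s ord0 i|].
Proof.
elim: k j => [|k ih] j jkn /=; first by rewrite addn0 => ->; left.
case=> [syz|]; last first.
  rewrite addnS -addSn in jkn *; move=> /ih[//|->|[i [ji h1 h2]]]; first by left.
  by right; exists i; split => //; exact: ltnW.
have jn : (j < n)%N by apply: leq_trans jkn; rewrite addnS ltnS leq_addr.
right; exists (Ordinal jn); split => //= [l lj|].
  have [_ [-> //]] := segm_coord l syz.
  by rewrite !mxE ltnS (leq_eqVlt l) (_ : (l == j :> nat) = false)//;
    apply/negbTE.
by have [_ [_]] := segm_coord (Ordinal jn) syz; rewrite !mxE /= ltnn ltnSn.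
Qed.

Variables (e1 e2 top : 'I_n).

(* Rise to the height of t, sidestep by d along e2, then correct the
   coordinates one after the other. *)
Definition route (d : R) s t : seq 'rV[R]_n :=
  let u := s + (t ord0 top - s ord0 top) *: delta_mx ord0 top in
  let v := u + d *: delta_mx ord0 e2 in
  [:: u, v & [seq mixed v t i | i <- iota 1 n]].

Hypotheses (e10 : e1 = 0%N :> nat) (e12 : e1 != e2) (e1t : e1 != top) (e2t : e2 != top).

Lemma mixed0 s t : mixed s t 0 = s.
Proof. by apply/rowP => l; rewrite !mxE. Qed.

Lemma mixedn s t : mixed s t n = t.
Proof. by apply/rowP => l; rewrite !mxE ltn_ord. Qed.

Lemma last_mixed s t j k :
  last (mixed s t j) [seq mixed s t i | i <- iota j.+1 k] = mixed s t (j + k).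
Proof. by elim: k j => [|k ih] j /=; rewrite ?addn0// ih addnS. Qed.

Lemma route_last d s t : last s (route d s t) = t.
Proof.
rewrite /route /=; set v := (X in last X _).
by rewrite -{1}(mixed0 v t) last_mixed add0n mixedn.
Qed.

Lemma size_route d s t : size (route d s t) = n.+2.
Proof. by rewrite /= size_map size_iota. Qed.

Lemma route_cases d s t y : 0 <= d -> s ord0 top <= t ord0 top ->
  trail s (route d s t) y ->
  [\/ (forall l, l != top -> y ord0 l = s ord0 l) /\
      s ord0 top <= y ord0 top <= t ord0 top,
      [/\ y ord0 top = t ord0 top,
          forall l, l != top -> l != e2 -> y ord0 l = s ord0 l
        & s ord0 e2 <= y ord0 e2 <= s ord0 e2 + d]
    | y ord0 top = t ord0 top /\ exists i : 'I_n,
      (forall l, l != i -> l != top ->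
        y ord0 l = if (l < i)%N then t ord0 l else s ord0 l + (l == e2)%:R * d)
      /\ `|y ord0 i - s ord0 i| <= `|t ord0 i - s ord0 i| + 2 * d].
Proof.
move=> d0 st; rewrite /route; set u := s + _; set v := u + _.
have uE l : u ord0 l = if l == top then t ord0 top else s ord0 l.
  by rewrite !mxE eqxx /=; case: eqP => [->|_]; rewrite ?mulr1 ?mulr0; ring.
have vE l : v ord0 l =
    if l == top then t ord0 top else s ord0 l + (l == e2)%:R * d.
  rewrite mxE uE !mxE eqxx /=; case: eqP => [->|_].
    by rewrite eq_sym (negbTE e2t) mulr0 addr0.
  by rewrite mulrC.
clearbody u v; rewrite [trail _ _]/=; case=> [yu|[yv|]].
- constructor 1; split => [l lt|].
    by have [_ [-> //]] := segm_coord l yu; rewrite uE (negbTE lt).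
  by have [/(_ _)] := segm_coord top yu; rewrite uE eqxx => /(_ st).
- constructor 2; split => [|l lt le|].
  + by have [_ [-> //]] := segm_coord top yv; rewrite uE ?vE eqxx.
  + have [_ [-> //]] := segm_coord l yv.
      by rewrite uE (negbTE lt).
    by rewrite uE vE (negbTE lt) (negbTE le) mul0r addr0.
  + have [+ _] := segm_coord e2 yv.
    by rewrite uE vE (negbTE e2t) eqxx mul1r; apply; rewrite lerDl.
- rewrite -{1}(mixed0 v t) => yt; constructor 3.
  have n0 : (0 < n)%N by rewrite (leq_ltn_trans _ (ltn_ord e1)).
  have [->|[i [_ h1 h2]]] := mixed_seq_trail (leqnn _ : (0 + n <= n)%N) yt.
    rewrite add0n mixedn; split => //.
    have nn : (n.-1 < n)%N by rewrite prednK.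
    exists (Ordinal nn); split => [l /= li _|]; last by rewrite lerDl; lra.
    rewrite ifT// ltn_neqAle -ltnS prednK// ltn_ord andbT.
    by apply: contra li => /eqP li; apply/eqP/val_inj.
  have yt' : y ord0 top = t ord0 top.
    have [it|it] := eqVneq i top.
      move: h2; rewrite it vE eqxx subrr normr0 normr_le0 subr_eq0 => /eqP//.
    by rewrite h1 1?eq_sym// mxE vE eqxx; case: ifP.
  split => //; exists i; split => [l li lt|].
    by rewrite h1// mxE vE (negbTE lt).
  have [it|it] := eqVneq i top; first by rewrite it yt' lerDl; lra.
  move: h2; rewrite vE (negbTE it).
  have : 0 <= (i == e2)%:R * d <= d.
    by case: (i == e2); rewrite ?mul1r ?mul0r ?lexx d0.
  set D := _ * d => D0 h2.
  have /andP[D1 D2] := D0.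
  move: h2; have := ler_norm (t ord0 i - (s ord0 i + D)).
  case: (ler0P (t ord0 i - (s ord0 i + D))); case: (ler0P (y ord0 i - (s ord0 i + D)));
  case: (ler0P (t ord0 i - s ord0 i)); case: (ler0P (y ord0 i - s ord0 i)); lra.
Qed.

Lemma mixed_path s t j k (B : R) : s ord0 top = t ord0 top -> `|t - s| <= B ->
  path (fun a b : 'rV[R]_n => (`|b - a| <= B) && (a ord0 top <= b ord0 top))
    (mixed s t j) [seq mixed s t i | i <- iota j.+1 k].
Proof.
move=> st tB; elim: k j => [//|k ih] j /=; rewrite ih andbT.
apply/andP; split; last first.
  by rewrite !mxE st; do 2 case: ifP => _.
have B0 : 0 <= B by exact: le_trans tB.
apply/row_norm_leP => // l; rewrite !mxE ltnS leq_eqVlt.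
case: ltngtP => _; rewrite ?subrr ?normr0//.
by apply: le_trans tB; have := coord_le_norm (t - s) l; rewrite !mxE.
Qed.

Lemma route_path d s t (B : R) : 0 <= d -> s ord0 top <= t ord0 top ->
  `|t - s| + d <= B ->
  path (fun a b : 'rV[R]_n => (`|b - a| <= B) && (a ord0 top <= b ord0 top)) s (route d s t).
Proof.
move=> d0 st tsB; rewrite /route; set u := s + _; set v := u + _.
have ts := normr_ge0 (t - s); have B0 : 0 <= B by lra.
have h l := coordB_le_norm t s l.
have uE l : u ord0 l = if l == top then t ord0 top else s ord0 l.
  by rewrite !mxE eqxx /=; case: eqP => [->|_]; rewrite ?mulr1 ?mulr0; ring.
have vE l : v ord0 l =
    if l == top then t ord0 top else s ord0 l + (l == e2)%:R * d.
  rewrite mxE uE !mxE eqxx /=; case: eqP => [->|_].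
    by rewrite eq_sym (negbTE e2t) mulr0 addr0.
  by rewrite mulrC.
clearbody u v; rewrite /= -[X in path _ X _](mixed0 v t) mixed_path ?andbT.
- rewrite !uE vE eqxx st lexx !andbT; apply/andP; split.
    apply/row_norm_leP => // l; rewrite !mxE uE.
    case: eqP => [->|_]; last by rewrite subrr normr0.
    by have := h top; lra.
  apply/row_norm_leP => // l; rewrite !mxE uE vE.
  have [_|_] := eqVneq l top; first by rewrite subrr normr0.
  rewrite addrC addKr; case: (l == e2); rewrite ?mul0r ?normr0//.
  by rewrite mul1r ger0_norm//; lra.
- by rewrite vE eqxx.
- apply/row_norm_leP => // l; rewrite !mxE vE.
  have [->|_] := eqVneq l top; first by rewrite subrr normr0.
  rewrite opprD addrA; apply: le_trans (ler_normB _ _) _.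
  apply: le_trans tsB; rewrite lerD//.
  by case: (l == e2); rewrite ?mul0r ?normr0// mul1r ger0_norm.
Qed.

End AxisPath.

(** * Routes along the tree of clusters *)

Lemma level_gap (A k i i' j' : nat) :
  (k <= i)%N -> (i' <= j'.+1)%N -> (j' < k + 2 * A)%N -> (i' <= i + (2 * A).+2)%N.
Proof. lia. Qed.

Section Tree.
Variables (R : realType) (n : nat) (J : pred 'I_n) (e1 e2 top : 'I_n).
Variables (lam b eta c1 : R) (A H : nat) (h : nat -> R) (E : set 'rV[R]_n).
Variables (cl X : nat -> 'rV[R]_n -> 'rV[R]_n) (slot : nat -> 'rV[R]_n -> 'I_n -> nat).
Implicit Types (x y a e : 'rV[R]_n) (k j : nat).

(** [cl k a] represents the cluster of [a] at scale [h k], [X k a] is the corner given to that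
    cluster, [slot k a] its place in the lattice of starting points, [b * h k] the unit for tube
    widths, and [H] the last level. [rt_X_sep] separates corners in every coordinate across a window
    of levels; [rt_X_avoid] keeps every axis-parallel line through a mix of two consecutive corners
    away from the nearby part of [E]. *)
Record routing : Prop := Routing {
  rt_n3 : (2 < n)%N;
  rt_e10 : e1 = 0%N :> nat;
  rt_e12 : e1 != e2;
  rt_e1t : e1 != top;
  rt_e2t : e2 != top;
  rt_topJ : ~~ J top;
  rt_h_gt0 : forall k, 0 < h k;
  rt_hS : forall k, h k = lam * h k.+1;
  rt_lam40 : 40 <= lam;
  rt_b_gt0 : 0 < b;
  rt_eta_gt0 : 0 < eta;
  rt_eta_le1 : eta <= 1;
  rt_c1_ge1 : 1 <= c1;
  rt_hA1 : forall k, 40 * c1 * h (k + A) <= h k.+1;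
  rt_hA2 : forall k, 40 * h (k + A) <= eta * h k;
  rt_hb : forall k, 100 * (b * h k) <= eta * h (k + (2 * A).+2);
  rt_bc1 : 100 * b * c1 <= 1;
  rt_cl_in : forall k a, E a -> E (cl k a);
  rt_cl_dist : forall k a, E a -> `|a - cl k a| <= h k;
  rt_cl_idem : forall k a, E a -> cl k (cl k a) = cl k a;
  rt_cl_refine : forall k a a', E a -> E a' ->
    cl k.+1 a = cl k.+1 a' -> cl k a = cl k a';
  rt_cl_sep : forall k a a', E a -> E a' ->
    cl k a != cl k a' -> h k <= c1 * `|a - a'|;
  rt_X_cl : forall k a a', cl k a = cl k a' -> X k a = X k a';
  rt_X_box : forall k a (l : 'I_n), (k <= H)%N -> E a ->
    cl k a ord0 l - 3 * h k <= X k a ord0 l <= cl k a ord0 l - 2 * h k;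
  rt_X_sep : forall i i' a a' (l : 'I_n), E a -> E a' -> (i <= i')%N -> (i' <= H)%N ->
    (i' <= i + (2 * A).+2)%N -> (i < i')%N \/ cl i a != cl i a' ->
    `|a - a'| <= 20 * lam * h i -> eta * h i' <= `|X i a ord0 l - X i' a' ord0 l|;
  rt_X_avoid : forall k a e (f : 'I_n) (sg : 'I_n -> bool), (k < H)%N ->
    E a -> E e -> `|a - e| <= 10 * h k -> exists l, l != f /\
    eta * h k.+1 <= `|e ord0 l - (if sg l then X k.+1 a ord0 l else X k a ord0 l)|;
  rt_slot_cl : forall k a a', cl k a = cl k a' -> slot k a = slot k a';
  rt_slotJ : forall k a l, ~~ J l -> slot k a l = 0%N;
  rt_slot_le : forall k a l, 40 * (b * h k.+1) * (slot k.+1 a l)%:R <= b * h k;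
  rt_slot_inj : forall k a a', E a -> E a' -> cl k a = cl k a' ->
    cl k.+1 a != cl k.+1 a' -> exists l, slot k.+1 a l != slot k.+1 a' l
}.

Hypothesis D : routing.
Let n3 := rt_n3 D.
Let e10 := rt_e10 D.
Let e12 := rt_e12 D.
Let e1t := rt_e1t D.
Let e2t := rt_e2t D.
Let topJ := rt_topJ D.
Let h_gt0 := rt_h_gt0 D.
Let hS := rt_hS D.
Let lam40 := rt_lam40 D.
Let b_gt0 := rt_b_gt0 D.
Let eta_gt0 := rt_eta_gt0 D.
Let eta_le1 := rt_eta_le1 D.
Let c1_ge1 := rt_c1_ge1 D.
Let hA1 := rt_hA1 D.
Let hA2 := rt_hA2 D.
Let hb := rt_hb D.
Let bc1 := rt_bc1 D.
Let cl_in := rt_cl_in D.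
Let cl_dist := rt_cl_dist D.
Let cl_idem := rt_cl_idem D.
Let cl_refine := rt_cl_refine D.
Let cl_sep := rt_cl_sep D.
Let X_cl := rt_X_cl D.
Let X_box := rt_X_box D.
Let X_sep := rt_X_sep D.
Let X_avoid := rt_X_avoid D.
Let slot_cl := rt_slot_cl D.
Let slotJ := rt_slotJ D.
Let slot_le := rt_slot_le D.
Let slot_inj := rt_slot_inj D.

Definition off k a : 'rV[R]_n := \row_l (40 * (b * h k) * (slot k a l)%:R).
Definition start k a := X k a + off k.+1 a.
(** Half the spacing of the slots in [off]: a sidestepped route is midway between the places where
    its siblings may rise. *)
Definition jog k := 20 * (b * h k).
Definition gam k a := trail (start k a)
  (route e2 top (jog k.+1) (start k a) (X k.+1 a)).

Lemma tube_gt0 k : 0 < b * h k. Proof. by rewrite mulr_gt0. Qed.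

Lemma scale_step k : 40 * h k.+1 <= h k.
Proof. by rewrite (hS k) ler_wpM2r// ltW. Qed.

Lemma tube_step k : 40 * (b * h k.+1) <= b * h k.
Proof. by rewrite mulrCA ler_wpM2l ?scale_step// ltW. Qed.

Lemma scale_le k j : (k <= j)%N -> h j <= h k.
Proof.
move=> /subnK <-; elim: (j - k)%N => [|i ih]; first by rewrite add0n.
by rewrite addSn; have := scale_step (i + k); have := h_gt0 (i + k).+1; lra.
Qed.

Lemma tube_le k j : (k <= j)%N -> b * h j <= b * h k.
Proof. by move=> kj; rewrite ler_wpM2l ?scale_le// ltW. Qed.

Lemma tube_eta k j : (j <= k + (2 * A).+2)%N -> 100 * (b * h k) <= eta * h j.
Proof.
by move=> jk; apply: le_trans (hb k) _; rewrite ler_wpM2l ?scale_le// ltW.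
Qed.

Lemma tube_small k : 100 * (b * h k) <= h k.
Proof.
apply: (le_trans (tube_eta (leq_addr _ k))).
by rewrite ler_piMl// ltW.
Qed.

Lemma cl_refine_le k j a a' : (k <= j)%N -> E a -> E a' -> cl j a = cl j a' -> cl k a = cl k a'.
Proof.
move=> /subnK <-; elim: (j - k)%N => [|i ih] Ea Ea'; first by rewrite add0n.
by rewrite addSn => /cl_refine; auto.
Qed.

Lemma X_cl_dist k a : (k <= H)%N -> E a -> `|X k a - cl k a| <= 3 * h k.
Proof.
move=> kH Ea; have h0 := h_gt0 k.
apply/row_norm_leP => [|l]; first lra.
by have /andP[? ?] := X_box l kH Ea; rewrite !mxE ler_norml; apply/andP; split; lra.
Qed.

Lemma X_dist k a : (k <= H)%N -> E a -> `|X k a - a| <= 4 * h k.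
Proof.
move=> kH Ea; have := dist_triangle (cl k a) (X k a) a.
by have := X_cl_dist kH Ea; have := cl_dist k Ea; rewrite (distrC a); lra.
Qed.

(** A corner is between two and three times [h k] below its representative, and the next
    representative is at most [h k] away, so corners rise from level to level. *)
Lemma X_top k a : (k < H)%N -> E a ->
  X k a ord0 top + h k / 2 <= X k.+1 a ord0 top.
Proof.
move=> kH Ea; have /andP[_ t1] := X_box top (ltnW kH) Ea.
have /andP[t2 _] := X_box top kH Ea.
have cc : cl k (cl k.+1 a) = cl k a.
  by apply: cl_refine; [exact: cl_in| |exact: cl_idem].
have := cl_dist k (cl_in k.+1 Ea); rewrite cc => t3.
have := coordB_le_norm (cl k.+1 a) (cl k a) top.
have := ler_norm (cl k a ord0 top - cl k.+1 a ord0 top).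
by rewrite distrC; have := scale_step k; have := h_gt0 k.+1; lra.
Qed.

Lemma off_ge0 k a l : 0 <= off k a ord0 l.
Proof. by rewrite mxE mulr_ge0// mulr_ge0// ltW// tube_gt0. Qed.

Lemma off_le k a l : off k.+1 a ord0 l <= b * h k.
Proof. by rewrite mxE slot_le. Qed.

Lemma off_top k a : off k a ord0 top = 0.
Proof. by rewrite mxE slotJ// mulr0. Qed.

Lemma startE k a l : start k a ord0 l = X k a ord0 l + off k.+1 a ord0 l.
Proof. by rewrite mxE. Qed.

Lemma start_top k a : start k a ord0 top = X k a ord0 top.
Proof. by rewrite startE off_top addr0. Qed.

Lemma start_X k a : `|start k a - X k a| <= b * h k.
Proof.
apply/row_norm_leP => [|l]; first by have := tube_gt0 k; lra.
by rewrite coordB startE addrAC subrr add0r ger0_norm ?off_ge0 ?off_le.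
Qed.

Lemma jog_ge0 k : 0 <= jog k.
Proof. by rewrite /jog; have := tube_gt0 k; lra. Qed.

Lemma start_le k a : (k < H)%N -> E a -> start k a ord0 top <= X k.+1 a ord0 top.
Proof. by move=> kH Ea; rewrite start_top; have := X_top kH Ea; have := h_gt0 k; lra. Qed.

Lemma gam_cases k a y : (k < H)%N -> E a -> gam k a y ->
  [\/ (forall l, l != top -> y ord0 l = start k a ord0 l) /\
      X k a ord0 top <= y ord0 top <= X k.+1 a ord0 top,
      [/\ y ord0 top = X k.+1 a ord0 top,
          forall l, l != top -> l != e2 -> y ord0 l = start k a ord0 l
        & start k a ord0 e2 <= y ord0 e2 <= start k a ord0 e2 + jog k.+1]
    | y ord0 top = X k.+1 a ord0 top /\ exists i : 'I_n,
      (forall l, l != i -> l != top -> y ord0 l =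
        if (l < i)%N then X k.+1 a ord0 l else start k a ord0 l + (l == e2)%:R * jog k.+1)
      /\ `|y ord0 i - start k a ord0 i| <=
         `|X k.+1 a ord0 i - start k a ord0 i| + 2 * jog k.+1].
Proof.
move=> kH Ea; rewrite -start_top; apply: route_cases => //; [exact: jog_ge0|exact: start_le].
Qed.

Lemma gam_top k a y : (k < H)%N -> E a -> gam k a y ->
  X k a ord0 top <= y ord0 top <= X k.+1 a ord0 top.
Proof.
move=> kH Ea; have Xt := X_top kH Ea; have h0 := h_gt0 k.
move=> /(gam_cases kH Ea)[[]//|[-> _ _]|[-> _]]; apply/andP; split; lra.
Qed.

Lemma gam_near k a y : (k < H)%N -> E a -> gam k a y -> `|y - a| <= 9 * h k.
Proof.
move=> kH Ea ya; have h0 := h_gt0 k; have h40 := scale_step k; have hh := h_gt0 k.+1.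
have b1 := tube_small k; have b40 := tube_step k; have b0 := tube_gt0 k; have b01 := tube_gt0 k.+1.
have jE : jog k.+1 = 20 * (b * h k.+1) by [].
apply/row_norm_leP => [|l]; first lra.
have D1 l' : `|start k a ord0 l' - a ord0 l'| <= 4 * h k + b * h k.
  apply: le_trans (coordB_le_norm _ _ _) _.
  have := dist_triangle (X k a) (start k a) a.
  by have := start_X k a; have := X_dist (ltnW kH) Ea; lra.
have D2 l' : `|X k.+1 a ord0 l' - a ord0 l'| <= 4 * h k.+1.
  by apply: le_trans (coordB_le_norm _ _ _) _; exact: X_dist.
have D3 l' : `|X k a ord0 l' - a ord0 l'| <= 4 * h k.
  by apply: le_trans (coordB_le_norm _ _ _) _; apply: X_dist => //; exact: ltnW.
rewrite coordB.
have tl : `|y ord0 top - a ord0 top| <= 9 * h k.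
  have := D2 top; have := D3 top; have := gam_top kH Ea ya => /andP[y1 y2].
  by rewrite !ler_norml => /andP[? ?] /andP[? ?]; apply/andP; split; lra.
have [->|lt] := eqVneq l top; first exact: tl.
have {}D1 := D1 l; have {}D2 := D2 l.
case: (gam_cases kH Ea ya) => [[y1 _]|[_ y1 y2]|[_ [i [y1 y2]]]].
- by rewrite y1//; lra.
- have [le|le] := eqVneq l e2; last by rewrite y1//; lra.
  move: D1; rewrite le !ler_norml => /andP[? ?].
  by move: y2 => /andP[? ?]; apply/andP; split; lra.
- have [li|li] := eqVneq l i; last first.
    rewrite y1//; case: ifP => _; first lra.
    move: D1; rewrite !ler_norml => /andP[? ?].
    case: (l == e2); rewrite ?mul0r ?mul1r; apply/andP; split; lra.
  rewrite -li in y2; have := ler_normD (y ord0 l - start k a ord0 l) (start k a ord0 l - a ord0 l).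
  rewrite addrA subrK => y3.
  have := ler_normD (X k.+1 a ord0 l - a ord0 l) (a ord0 l - start k a ord0 l).
  by rewrite addrA subrK (distrC (a ord0 l)); lra.
Qed.

(** [f] is the direction in which the route is currently moving, and [sg] tells which of the two
    corners supplies each of the other coordinates. *)
Lemma gam_free k a y : (k < H)%N -> E a -> gam k a y ->
  exists (f : 'I_n) (sg : 'I_n -> bool), forall l, l != f ->
  `|y ord0 l - (if sg l then X k.+1 a ord0 l else X k a ord0 l)| <= 2 * (b * h k).
Proof.
move=> kH Ea ya; have b40 := tube_step k; have b0 := tube_gt0 k; have b01 := tube_gt0 k.+1.
have jE : jog k.+1 = 20 * (b * h k.+1) by [].
suff [f hf] : exists f, forall l, l != f ->
    `|y ord0 l - X k.+1 a ord0 l| <= 2 * (b * h k) \/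
    `|y ord0 l - X k a ord0 l| <= 2 * (b * h k).
  exists f, (fun l => `|y ord0 l - X k.+1 a ord0 l| <= 2 * (b * h k)) => l lf.
  by case: ifP => // hl; case: (hf l lf) => //; rewrite hl.
have st l t : 0 <= t -> t <= jog k.+1 -> y ord0 l = start k a ord0 l + t ->
    `|y ord0 l - X k a ord0 l| <= 2 * (b * h k).
  move=> t0 tj ->; rewrite startE; have := off_ge0 k.+1 a l; have := off_le k a l.
  by rewrite ler_norml => *; apply/andP; split; lra.
have zz : `|0 : R| <= 2 * (b * h k) by rewrite normr0; lra.
case: (gam_cases kH Ea ya) => [[y1 y2]|[y0 y1 y2]|[y0 [i [y1 y2]]]].
- exists top => l lt; right; apply: (st l 0); rewrite ?addr0 ?y1 ?jog_ge0//.
- exists e2 => l le; have [->|lt] := eqVneq l top.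
    by left; rewrite y0 subrr.
  by right; apply: (st l 0); rewrite ?addr0 ?y1 ?jog_ge0.
- exists i => l li; have [->|lt] := eqVneq l top.
    by left; rewrite y0 subrr.
  have := y1 l li lt; case: ifP => _ yl; first by left; rewrite yl subrr.
  right; apply: (st _ _ _ _ yl); first by rewrite mulr_ge0// jog_ge0.
  by case: (l == e2); rewrite ?mul1r ?mul0r ?jog_ge0.
Qed.

(** A point [e] farther than [10 * h k] from [a] is out of reach of the route. For a nearer one,
    [rt_X_avoid] applies to the line of [gam_free], and the tube width is negligible against
    [eta * h k.+1]. *)
Lemma gam_avoid k a e y : (k < H)%N -> E a -> E e -> gam k a y ->
  eta / 2 * h k.+1 <= `|y - e|.
Proof.
move=> kH Ea Ee ya; have h0 := h_gt0 k; have h01 := h_gt0 k.+1; have h40 := scale_step k.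
have et1 : eta * h k.+1 <= h k.+1 by rewrite ler_piMl// ltW.
have et0 : 0 < eta * h k.+1 by rewrite mulr_gt0.
have := gam_near kH Ea ya; have [ae|ae] := leP `|a - e| (10 * h k); last first.
  by have := dist_triangle y a e; rewrite (distrC a y); lra.
move=> _; have [f [sg fsg]] := gam_free kH Ea ya.
have [l [lf]] := X_avoid f sg kH Ea Ee ae.
have := fsg l lf; set m := (X in y ord0 l - X).
have be : 100 * (b * h k) <= eta * h k.+1 by apply: tube_eta; rewrite addnS ltnS leq_addr.
have := coordB_le_norm y e l.
have := ler_normD (e ord0 l - y ord0 l) (y ord0 l - m).
rewrite addrA subrK (distrC (e ord0 l) (y ord0 l)).
by have := tube_gt0 k; lra.
Qed.

Lemma exists_common_fixed (f f' : 'I_n) : exists l : 'I_n, l != f /\ l != f'.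
Proof.
apply: contrapT => hn; have := n3; rewrite ltnNge => /negP; apply.
have ns l : l \in [set f; f']%SET.
  by rewrite in_set2; apply: contrapT => /negP; rewrite negb_or => /andP[? ?]; apply: hn; exists l.
rewrite -[n]card_ord -cardsT; apply: (@leq_trans #|[set f; f']%SET|).
  by apply: subset_leq_card; apply/fintype.subsetP => l _.
by rewrite cards2; case: (f != f').
Qed.

(** Take [j <= j']. If both levels are at least [k + A], each route stays near its point of [E], and
    the two clusters are far apart. If [j < k + A] but [j'] is at least [k + 2 * A], the deep route
    is close to [a'], which the shallow one avoids. Otherwise, for nearby [a] and [a'], some
    coordinate is fixed on both lines of [gam_free], and [rt_X_sep] separates it. The condition
    [k < maxn j j'] excludes two routes that leave the same corner [X k a]. *)
Lemma gam_sep k j j' a a' y y' : E a -> E a' -> cl k a = cl k a' ->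
  cl k.+1 a != cl k.+1 a' -> (k <= j < H)%N -> (k <= j' < H)%N -> (k < maxn j j')%N ->
  gam j a y -> gam j' a' y' -> 16 * (b * h k.+1) <= `|y - y'|.
Proof.
wlog jj : j j' a a' y y' / (j <= j')%N.
  move=> hw Ea Ea' ca ca1 kj kj' km ya ya'.
  have [jj|/ltnW jj] := leqP j j'.
    exact: (hw j j' a a' y y' jj Ea Ea' ca ca1 kj kj' km ya ya').
  rewrite maxnC in km; rewrite eq_sym in ca1; rewrite distrC.
  exact: (hw j' j a' a y' y jj Ea' Ea (esym ca) ca1 kj' kj km ya' ya).
move=> Ea Ea' ca ca1 /andP[kj jH] /andP[kj' jH']; rewrite (maxn_idPr jj) => kj'' ya ya'.
have n1 := gam_near jH Ea ya; have n2 := gam_near jH' Ea' ya'.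
have hk1 := h_gt0 k.+1; have bk1 := tube_gt0 k.+1; have bk := tube_gt0 k.
have b40 := tube_step k.
have := dist_triangle y' y a'; have := dist_triangle y a a'.
rewrite (distrC a y) => tr1 tr2.
have [jA|jA] := leqP (k + A) j.
  have s1 := cl_sep Ea Ea' ca1; have s2 := hA1 k.
  have s3 := scale_le jA; have s4 := scale_le (leq_trans jA jj).
  rewrite -(ler_pM2l (lt_le_trans ltr01 c1_ge1)).
  have bc : 100 * (c1 * (b * h k.+1)) <= h k.+1.
    have -> : 100 * (c1 * (b * h k.+1)) = 100 * b * c1 * h k.+1 by ring.
    by rewrite ler_piMl// ltW.
  have : c1 * `|a - a'| <= c1 * (9 * h (k + A) + 9 * h (k + A) + `|y - y'|).
    by rewrite ler_wpM2l//; [exact: le_trans ler01 c1_ge1|lra].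
  have : c1 * (9 * h (k + A) + 9 * h (k + A) + `|y - y'|) =
      18 * (c1 * h (k + A)) + c1 * `|y - y'| by ring.
  have : 40 * c1 * h (k + A) = 40 * (c1 * h (k + A)) by ring.
  have : c1 * (16 * (b * h k.+1)) = 16 * (c1 * (b * h k.+1)) by ring.
  by lra.
have [j'A|j'A] := leqP (k + 2 * A) j'.
  have s1 := gam_avoid jH Ea Ea' ya; have s2 := hA2 (k + A).
  have s3 := scale_le j'A; rewrite mul2n -addnn addnA in s3.
  have s4 : eta * h (k + A) <= eta * h j.+1 by rewrite ler_wpM2l ?scale_le// ltW.
  have s5 : 100 * (b * h k) <= eta * h (k + A).
    by apply: tube_eta; rewrite leq_add2l -addn2 mul2n -addnn -addnA leq_addr.
  by lra.
have [aa|aa] := leP `|a - a'| (19 * h j); last first.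
  have s3 := scale_le jj; have s4 : h (k + A) <= h j by apply/scale_le/ltnW.
  have s5 : 100 * (b * h k) <= eta * h (k + A).
    by apply: tube_eta; rewrite leq_add2l -addn2 mul2n -addnn -addnA leq_addr.
  have : eta * h (k + A) <= h (k + A) by rewrite ler_piMl// ltW.
  lra.
have [f [sg fsg]] := gam_free jH Ea ya.
have [f' [sg' fsg']] := gam_free jH' Ea' ya'.
have [l [lf lf']] := exists_common_fixed f f'.
have {}fsg := fsg l lf; have {}fsg' := fsg' l lf'.
have bj := tube_le kj; have bj' := tube_le kj'.
have clne i : (k < i)%N -> cl i a != cl i a'.
  move=> ki; apply: contra ca1 => /eqP /(cl_refine_le ki Ea Ea')/eqP//.
have key i i' : (j <= i <= j.+1)%N -> (j' <= i' <= j'.+1)%N ->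
    100 * (b * h k) <= `|X i a ord0 l - X i' a' ord0 l|.
  move=> /andP[ji ij] /andP[ji' ij'].
  have hj20 : 20 * h j = 20 * lam * h j.+1 by rewrite hS mulrA.
  have hj20' i0 : (i0 <= j.+1)%N -> 19 * h j <= 20 * lam * h i0.
    move=> i0j; have h1 := scale_le i0j; have h2 := h_gt0 j.+1; have h3 := h_gt0 j.
    apply: (le_trans (_ : _ <= 20 * h j)); first lra.
    by rewrite hj20 ler_wpM2l// mulr_ge0//; have := lam40; lra.
  have [ii|ii] := leqP i i'.
    apply: (le_trans (_ : _ <= eta * h i')).
      by apply: tube_eta; exact: (level_gap (leqnn k) ij').
    apply: X_sep => //.
    - exact: leq_trans ij' _.
    - exact: (level_gap (leq_trans kj ji) ij').
    - have [ie|ne] := eqVneq i i'; last by left; rewrite ltn_neqAle ne.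
      by right; apply: clne; rewrite ie; exact: leq_trans kj'' ji'.
    - by apply: (le_trans aa); exact: hj20'.
  have i'j : (i <= j'.+1)%N by apply: leq_trans ij _; rewrite ltnS.
  rewrite distrC.
  apply: (le_trans (_ : _ <= eta * h i)).
    by apply: tube_eta; exact: (level_gap (leqnn k) i'j).
  apply: X_sep => //; [exact: ltnW|exact: leq_trans ij _| |by left|].
    exact: (level_gap (leq_trans kj' ji') i'j).
  by rewrite distrC; apply: (le_trans aa); apply: hj20'; exact: leq_trans (ltnW ii) ij.
have kk : 100 * (b * h k) <= `|(if sg l then X j.+1 a ord0 l else X j a ord0 l) -
    (if sg' l then X j'.+1 a' ord0 l else X j' a' ord0 l)|.
  by case: (sg l); case: (sg' l); apply: key; rewrite ?leqnSn ?leqnn.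
move: fsg fsg' kk; set m := (if sg l then _ else _); set m' := (if sg' l then _ else _).
move=> fsg fsg' kk; have := coordB_le_norm y y' l.
have := ler_normD (m - y ord0 l) (y ord0 l - y' ord0 l); rewrite addrA subrK.
have := ler_normD (m - y' ord0 l) (y' ord0 l - m'); rewrite addrA subrK.
rewrite (distrC m (y ord0 l)); lra.
Qed.

(** Both routes leave the common corner [X k a], so only the slots tell their vertical pieces apart.
    When neither point is on a vertical piece, the heights are those of distinct corners of level
    [k.+1], which [rt_X_sep] separates. *)
Lemma gam_sib k a a' y y' : E a -> E a' -> cl k a = cl k a' ->
  cl k.+1 a != cl k.+1 a' -> (k < H)%N -> gam k a y -> gam k a' y' ->
  16 * (b * h k.+1) <= `|y - y'|.
Proof.
move=> Ea Ea' ca ca1 kH ya ya'.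
have hk1 := h_gt0 k.+1; have bk1 := tube_gt0 k.+1; have bk := tube_gt0 k.
have b40 := tube_step k.
have be : 100 * (b * h k) <= eta * h k.+1 by apply: tube_eta; rewrite addnS ltnS leq_addr.
have h40 := scale_step k; have hk := h_gt0 k.
have aa x x' : E x -> E x' -> cl k x = cl k x' -> `|x - x'| <= 2 * h k.
  move=> Ex Ex' cx; have := cl_dist k Ex; have := cl_dist k Ex'; rewrite -cx => d1 d2.
  by have := dist_triangle (cl k x) x x'; rewrite (distrC (cl k x)); lra.
have lam20 i : (i <= k.+1)%N -> 2 * h k <= 20 * lam * h i.
  move=> ik; apply: (le_trans (_ : _ <= 20 * h k)); first lra.
  rewrite (hS k) mulrA ler_wpM2l ?scale_le// mulr_ge0//; have := lam40; lra.
have Xs1 l : eta * h k.+1 <= `|X k.+1 a ord0 l - X k.+1 a' ord0 l|.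
  apply: X_sep => //; [exact: leq_addr|by right|exact: le_trans (aa _ _ Ea Ea' ca) (lam20 _ _)].
have jE : jog k.+1 = 20 * (b * h k.+1) by [].
(* Distinct slots differ by multiples of 40 b h, sidesteps have length 20 b h. *)
have lattice (t t' : nat) (u w : R) : t != t' -> - 20 * (b * h k.+1) <= u <= 20 * (b * h k.+1) ->
    w = 40 * (b * h k.+1) * t%:R - 40 * (b * h k.+1) * t'%:R + u ->
    20 * (b * h k.+1) <= `|w|.
  move=> tt /andP[u1 u2] ->; rewrite ler_normr.
  set B := b * h k.+1 in bk1 u1 u2 *.
  move: tt; rewrite neq_ltn => /orP[tt|tt]; apply/orP; [right|left].
    have : t%:R + 1 <= t'%:R :> R by rewrite natr1 ler_nat.
    by rewrite -subr_ge0 => /(mulr_ge0 (ltW bk1)); lra.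
  have : t'%:R + 1 <= t%:R :> R by rewrite natr1 ler_nat.
  by rewrite -subr_ge0 => /(mulr_ge0 (ltW bk1)); lra.
have XX : X k a = X k a' by exact: X_cl.
have vert x x' (z z' : 'rV[R]_n) : E x -> E x' -> cl k x = cl k x' -> cl k.+1 x != cl k.+1 x' ->
    (forall l, l != top -> z ord0 l = start k x ord0 l) -> gam k x' z' ->
    16 * (b * h k.+1) <= `|z - z'|.
  move=> Ex Ex' cx cx1 zE z'G.
  have [l sl] := slot_inj Ex Ex' cx cx1.
  have Jl : J l by apply: contraNT sl => lJ; rewrite !slotJ.
  have lt : l != top by apply: contraNneq topJ => <-.
  have Xx : X k x = X k x' by exact: X_cl.
  have h1 i := coordB_le_norm z z' i.
  have sE i : start k x ord0 i = X k x' ord0 i + 40 * (b * h k.+1) * (slot k.+1 x i)%:R.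
    by rewrite startE Xx [off _ _ _ _]mxE.
  have s'E i : start k x' ord0 i = X k x' ord0 i + 40 * (b * h k.+1) * (slot k.+1 x' i)%:R.
    by rewrite startE [off _ _ _ _]mxE.
  have fin i : 20 * (b * h k.+1) <= `|z ord0 i - z' ord0 i| ->
      16 * (b * h k.+1) <= `|z - z'| by have := h1 i; lra.
  case: (gam_cases kH Ex' z'G) => [[y1 y2]|[y0 y1 y2]|[y0 [i [y1 y2]]]].
  - apply: (fin l); apply: (lattice _ _ 0 _ sl); first by apply/andP; split; lra.
    by rewrite zE// y1// sE s'E; ring.
  - have [le|le] := eqVneq l e2; last first.
      apply: (fin l); apply: (lattice _ _ 0 _ sl); first by apply/andP; split; lra.
      by rewrite zE// y1// sE s'E; ring.
    move: y2; rewrite -le jE => /andP[y2 y3]; apply: (fin l).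
    apply: (lattice _ _ (start k x' ord0 l - z' ord0 l) _ sl).
      by apply/andP; split; lra.
    by rewrite zE// sE s'E; ring.
  (* While the first coordinate [e1] is being corrected, coordinate [e2] still carries the sidestep,
     so it is off the slot lattice by half a spacing. Afterwards coordinate [e1] has left the value
     of [X k] for that of [X k.+1], which is far from it. *)
  - have [ie|ie] := eqVneq i e1.
      apply: (fin e2); rewrite zE// y1//; last by rewrite ie eq_sym.
      rewrite ie e10 ltn0 eqxx mul1r jE sE s'E.
      have [->|ss] := eqVneq (slot k.+1 x e2) (slot k.+1 x' e2).
        by rewrite ler_normr; apply/orP; right; lra.
      apply: (lattice _ _ (- (20 * (b * h k.+1))) _ ss); last by ring.
      by apply/andP; split; lra.
    have i0 : (e1 < i)%N by rewrite e10 lt0n -e10; apply: contra ie => /eqP ?; apply/eqP/val_inj.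
    have ei : e1 != i by rewrite eq_sym.
    have := h1 e1; rewrite zE// (y1 e1 ei e1t) i0.
    have xs : eta * h k.+1 <= `|X k x ord0 e1 - X k.+1 x' ord0 e1|.
      apply: X_sep => //; [by rewrite addnS ltnS leq_addr|by left|].
      exact: le_trans (aa _ _ Ex Ex' cx) (lam20 _ (leqnSn k)).
    have := off_le k x e1; have := off_ge0 k.+1 x e1; rewrite startE => o1 o2.
    move: xs; set u := X k.+1 x' ord0 e1; set v := X k x ord0 e1; set w := off _ _ _ _ in o1 o2 *.
    have := ler_normD (v + w - u) (- w); rewrite normrN (ger0_norm o1).
    by rewrite (_ : v + w - u - w = v - u); [lra|ring].
case: (gam_cases kH Ea ya) => [[y1 _]|[y1 _ _]|[y1 _]]; first exact: (vert a a').
  case: (gam_cases kH Ea' ya') => [[z1 _]|[z1 _ _]|[z1 _]].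
  - rewrite distrC; apply: (vert a' a) => //; by rewrite eq_sym.
  - by have := Xs1 top; have := coordB_le_norm y y' top; rewrite y1 z1; lra.
  - by have := Xs1 top; have := coordB_le_norm y y' top; rewrite y1 z1; lra.
case: (gam_cases kH Ea' ya') => [[z1 _]|[z1 _ _]|[z1 _]].
- rewrite distrC; apply: (vert a' a) => //; by rewrite eq_sym.
- by have := Xs1 top; have := coordB_le_norm y y' top; rewrite y1 z1; lra.
- by have := Xs1 top; have := coordB_le_norm y y' top; rewrite y1 z1; lra.
Qed.

End Tree.

(** * The recursion over the tree of clusters *)

Lemma trail_start (R : realType) (n : nat) (a : 'rV[R]_n) l : trail a l a.
Proof.
case: l => //= b l; left; exists 0.
by rewrite ler01 lexx scale0r addr0; split.
Qed.

Lemma trail_last (R : realType) (n : nat) (a : 'rV[R]_n) l : trail a l (last a l).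
Proof. by elim: l a => //= b l ih a; right. Qed.

Section RoutedCatch.
Variables (R : realType) (n : nat) (J : pred 'I_n) (e1 e2 top : 'I_n).
Variables (lam b eta c1 : R) (A H : nat) (h : nat -> R) (E : set 'rV[R]_n).
Variables (cl X : nat -> 'rV[R]_n -> 'rV[R]_n) (slot : nat -> 'rV[R]_n -> 'I_n -> nat).
Implicit Types (x y z a e : 'rV[R]_n) (k j : nat).
Hypothesis D : routing J e1 e2 top lam b eta c1 A H h E cl X slot.

Variables (N T : nat).
Hypothesis T0 : (0 < T)%N.
Hypothesis Tb : 5 * lam <= T%:R * b.
Hypothesis children : forall k a, E a -> (k < H)%N -> exists s : seq 'rV[R]_n,
  [/\ uniq s, (size s <= N)%N &
      forall x, x \in s <-> [/\ E x, cl k.+1 x = x & cl k x = cl k a]].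

Let gm := gam e2 top b h X slot.
(** Twelve widths of level [k.+1] contain the tubes used at level [k], whose radius is four such
    widths; and twelve widths of level [k.+2] are negligible against the sixteen of level [k.+1]
    that separate siblings. *)
Let mar k := 12 * (b * h k.+1).

(** The skeleton of all that happens below a node; its neighbourhood [hull] serves as the region [V]
    of the node and as the region [W] of a child. *)
Definition net k a : set 'rV[R]_n := [set y | y = X k a \/
  exists j a', [/\ (k <= j < H)%N, E a', cl k a' = cl k a & gm j a' y]].

Definition hull k a : set 'rV[R]_n := [set x | exists2 y, net k a y & `|x - y| < mar k].

Let mar_gt0 k : 0 < mar k.
Proof. by rewrite /mar; have := tube_gt0 D k.+1; lra. Qed.

Let mar_le k : mar k <= b * h k.
Proof. by rewrite /mar; have := tube_gt0 D k.+1; have := tube_step D k; lra. Qed.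

Let mar_step k : 40 * mar k.+1 <= mar k.
Proof. by rewrite /mar; have := tube_gt0 D k.+1; have := tube_step D k.+1; lra. Qed.

Let cl_near k a a' : E a -> E a' -> cl k a = cl k a' -> `|a - a'| <= 2 * h k.
Proof.
move=> Ea Ea' c; have := rt_cl_dist D k Ea; have := rt_cl_dist D k Ea'.
rewrite -c => d1 d2.
by have := dist_triangle (cl k a) a a'; rewrite (distrC (cl k a)); lra.
Qed.

Let cl_up k a : E a -> cl k (cl k.+1 a) = cl k a.
Proof.
move=> Ea; apply: (rt_cl_refine D) => //; first exact: rt_cl_in D _ _ Ea.
exact: rt_cl_idem D _ _ Ea.
Qed.

Lemma gam_start k a : gm k a (start b h X slot k a).
Proof. exact: trail_start. Qed.

Lemma gam_end k a : gm k a (X k.+1 a).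
Proof.
have := trail_last (start b h X slot k a)
  (route e2 top (jog b h k.+1) (start b h X slot k a) (X k.+1 a)).
by rewrite route_last.
Qed.

Lemma X_top_le k j a : (k <= j)%N -> (j <= H)%N -> E a ->
  X k a ord0 top <= X j a ord0 top.
Proof.
move=> kj; rewrite -(subnKC kj); elim: (j - k)%N => [|i ih]; first by rewrite addn0.
rewrite addnS => iH Ea; have := ih (ltnW iH) Ea.
by have := X_top D iH Ea; have := rt_h_gt0 D (k + i); lra.
Qed.

Lemma net_top k a y : E a -> net k a y -> X k a ord0 top <= y ord0 top.
Proof.
move=> Ea [->//|[j [a' [/andP[kj jH] Ea' ca]]]] /(gam_top D jH Ea')/andP[+ _].
rewrite -(rt_X_cl D ca); have := X_top_le kj (ltnW jH) Ea'; lra.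
Qed.

(** Routes of deeper levels start at least [h k / 2] higher, so a point this low is on the vertical
    piece of a route of level [k], within the slot lattice around [X k a]. This puts the bottom of a
    hull inside the rigidly moved cube. *)
Lemma net_low k a y : E a -> net k a y ->
  y ord0 top <= X k a ord0 top + mar k -> `|y - X k a| <= b * h k.
Proof.
have t0 := tube_gt0 D k; have h0 := rt_h_gt0 D k.
have ts := tube_small D k; have mt := mar_le k; have m0 := mar_gt0 k.
have m40 : 40 * mar k <= 12 * (b * h k) by rewrite /mar; have := tube_step D k; lra.
move=> Ea [->|[j [a' [/andP[kj jH] Ea' ca yG]]]]; first by rewrite subrr normr0; lra.
have Xa := rt_X_cl D ca; move=> yt.
have low : y ord0 top < X k.+1 a' ord0 top.
  have := X_top D (leq_ltn_trans kj jH) Ea'; rewrite Xa; lra.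
have jk : j = k.
  apply/eqP; rewrite eqn_leq kj andbT leqNgt; apply/negP => kj'.
  have := X_top_le kj' (ltnW jH) Ea'; have /andP[] := gam_top D jH Ea' yG; lra.
subst j; case: (gam_cases D jH Ea' yG) => [[y1 /andP[y2 _]]|[y1 _ _]|[y1 _]].
- apply/row_norm_leP => [|l]; first lra.
  rewrite coordB -Xa; have [->|lt] := eqVneq l top.
    by rewrite Xa in y2 *; rewrite ger0_norm; lra.
  rewrite y1// -coordB; apply: le_trans (coord_le_norm _ _) _; exact: (start_X D).
- by rewrite y1 ltxx in low.
- by rewrite y1 ltxx in low.
Qed.

Lemma net_near k a y : (k <= H)%N -> E a -> net k a y -> `|y - a| <= 11 * h k.
Proof.
move=> kH Ea; have h0 := rt_h_gt0 D k.
case=> [->|[j [a' [/andP[kj jH] Ea' ca yG]]]]; first by have := X_dist D kH Ea; lra.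
have := gam_near D jH Ea' yG; have := scale_le D kj; have := cl_near Ea' Ea ca.
by have := dist_triangle a' y a; lra.
Qed.

Lemma net_sep k a a' z z' : E a -> E a' -> cl k a = cl k a' ->
  cl k.+1 a != cl k.+1 a' -> (k < H)%N ->
  net k.+1 a z \/ gm k a z -> net k.+1 a' z' \/ gm k a' z' ->
  16 * (b * h k.+1) <= `|z - z'|.
Proof.
move=> Ea Ea' ca ca1 kH.
have gen x w : E x -> net k.+1 x w \/ gm k x w -> exists j x',
    [/\ E x', cl k x' = cl k x, cl k.+1 x' = cl k.+1 x, (k <= j < H)%N & gm j x' w].
  move=> Ex [[->|[j [x' [/andP[kj jH] Ex' cx wG]]]]|wG].
  - by exists k, x; rewrite leqnn kH; split => //; exact: gam_end.
  - exists j, x'; rewrite jH (ltnW kj); split => //.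
    by apply: (rt_cl_refine D).
  - by exists k, x; rewrite leqnn kH.
move=> /(gen _ _ Ea)[j [x [Ex cx cx1 kj zG]]] /(gen _ _ Ea')[j' [x' [Ex' cx' cx1' kj' zG']]].
have c0 : cl k x = cl k x' by rewrite cx ca cx'.
have c1' : cl k.+1 x != cl k.+1 x' by rewrite cx1 cx1'.
have [km|] := ltnP k (maxn j j').
  exact: (gam_sep D Ex Ex' c0 c1' kj kj' km zG zG').
rewrite geq_max => /andP[jk j'k].
have jk' : j = k by apply/eqP; rewrite eqn_leq jk; case/andP: kj.
have jk'' : j' = k by apply/eqP; rewrite eqn_leq j'k; case/andP: kj'.
subst j j'; exact: (gam_sib D Ex Ex' c0 c1' kH zG zG').
Qed.

Lemma net_up k a x y : E a -> E x -> cl k x = cl k a -> (k < H)%N ->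
  net k.+1 x y \/ gm k x y -> net k a y.
Proof.
move=> Ea Ex cx kH [[->|[j [x' [/andP[kj jH] Ex' cx' yG]]]]|yG]; right.
- by exists k, x; rewrite leqnn kH; split => //; exact: gam_end.
- exists j, x'; rewrite jH (ltnW kj); split => //.
  by rewrite -cx; by apply: (rt_cl_refine D).
- by exists k, x; rewrite leqnn kH.
Qed.

Let M : R := (2 ^+ T) ^+ n.+2.
(** The quotient of the diameter bound [24 * h k] by the margin [mar k.+1], which is the same at
    every level. *)
Let K : R := M ^+ N * (2 * (lam * lam) / b + 1).

Lemma routed_catches (eps : R) k a : 4 * h H <= eps -> (k <= H)%N -> E a ->
  catches J (M ^+ N * K) K eps (hull k a) (X k a) [set e | E e /\ cl k e = cl k a].
Proof.
move=> heps; have lam1 := rt_lam40 D; have b0 := rt_b_gt0 D.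
have M1 : 1 <= M by rewrite exprn_ege1// exprn_ege1// ler1n.
have K1 : 1 <= K.
  rewrite /K; have : 0 <= 2 * (lam * lam) / b.
    by rewrite divr_ge0 ?mulr_ge0//; lra.
  have : 1 <= M ^+ N by rewrite exprn_ege1.
  by set u := M ^+ N; set v := 2 * _ / b; nra.
(* Induction from the last level [H] upwards; there the corner itself is close enough to its whole
   cluster. *)
move=> kH; rewrite -(subKn kH); elim: (H - k)%N a => [|i ih] a.
  rewrite subn0 => Ea; apply: catches_leaf => //.
  - by rewrite mulr_ege1// exprn_ege1.
  - by exists (X H a); [left|rewrite subrr normr0 mar_gt0].
  - move=> e [Ee ce]; rewrite -(rt_X_cl D ce).
    by apply: le_trans heps; exact: (X_dist D).
have [iH|iH] := leqP H i.
  by rewrite (_ : (H - i.+1 = H - i)%N); [exact: ih|lia].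
have kS : (H - i = (H - i.+1).+1)%N by lia.
have {kH}kH : (H - i.+1 < H)%N by lia.
rewrite kS in ih; move: (H - i.+1)%N ih kH => {k kS i iH} k ih kH Ea.
have [s [us sN sP]] := children Ea kH.
have h0 := rt_h_gt0 D k; have h1 := rt_h_gt0 D k.+1.
have t0 := tube_gt0 D k; have t1 := tube_gt0 D k.+1; have ts := tube_step D k.
have hs := scale_step D k; have tsm := tube_small D k; have tsm1 := tube_small D k.+1.
have m0 := mar_gt0 k; have m1 := mar_gt0 k.+1; have ms := mar_step k.
have mE : mar k = 12 * (b * h k.+1) by [].
have m1E : mar k.+1 <= b * h k.+1 by exact: mar_le.
have ms1 : 40 * mar k.+1 <= 12 * (b * h k.+1) by rewrite -mE.
have sE x : x \in s -> [/\ E x, cl k x = cl k a & X k x = X k a].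
  by move=> /sP[Ex _ cx]; rewrite (rt_X_cl D cx).
have sne x x' : x \in s -> x' \in s -> x != x' -> cl k.+1 x != cl k.+1 x'.
  by move=> /sP[_ c _] /sP[_ c' _]; rewrite c c'.
have sc x x' : x \in s -> x' \in s -> cl k x = cl k x'.
  by move=> /sP[_ _ ->] /sP[_ _ ->].
have /choice[f fP] x : exists g, x \in s -> pushes top (2 * (b * h k.+1)) M
    (gm k x) (start b h X slot k x) (X k.+1 x) g.
  have [xs|_] := boolP (x \in s); last by exists id.
  have [Ex cx XE] := sE x xs.
  have j0 := jog_ge0 D k.+1; have sl := start_le D kH Ex.
  have := @trail_push _ n top (2 * (b * h k.+1)) _ T (start b h X slot k x)
    (route e2 top (jog b h k.+1) (start b h X slot k x) (X k.+1 x)) T0.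
  rewrite route_last size_route; case; first by lra.
  - apply: (route_path (rt_e2t D)) => //.
    have := dist_triangle x (X k.+1 x) (start b h X slot k x).
    have := dist_triangle (X k x) x (start b h X slot k x).
    have := start_X D k x; have := X_dist D kH Ex; have := X_dist D (ltnW kH) Ex.
    rewrite !(distrC x) (distrC (X k x) (start _ _ _ _ _ _)).
    have jE : jog b h k.+1 = 20 * (b * h k.+1) by [].
    (* The cube has radius [2 * (b * h k.+1)], so one step may move it by half of that, and no leg
       of a route is longer than [5 * h k]. *)
    have : 5 * h k <= T%:R * (b * h k.+1).
      by rewrite (rt_hS D) !mulrA ler_wpM2r// ltW.
    by lra.
  - by move=> g gP; exists g.
have KE : K = M ^+ N * (24 * h k / mar k.+1 + 1).
  have bn : b != 0 by rewrite gt_eqF.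
  have hn : h k.+2 != 0 by rewrite gt_eqF// (rt_h_gt0 D).
  rewrite /K /mar (rt_hS D k) (rt_hS D k.+1); congr (_ * (_ + _)).
  by field; rewrite bn hn.
rewrite KE.
apply: (@star_catches _ n J top (2 * (b * h k.+1)) (mar k.+1) (24 * h k) M N _ s
  (hull k a) _ _ (hull k.+1) (fun x => [set e | E e /\ cl k.+1 e = cl k.+1 x])
  (gm k) (X k.+1) (start b h X slot k) f) => //.
- by lra.
- by lra.
- exact: rt_topJ D.
- by move=> x _; exact: gam_start.
- move=> x xs l lJ; have [_ _ XE] := sE x xs.
  by rewrite startE XE [X in _ + X]mxE (rt_slotJ D)// mulr0 addr0.
- move=> x y xs [z zn yz]; have [Ex _ XE] := sE x xs.
  have zt := net_top Ex zn; have Xt := X_top D kH Ex; rewrite XE in Xt.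
  have := coordB_le_norm y z top; have := ler_norm (z ord0 top - y ord0 top).
  by rewrite distrC; lra.
- move=> x y xs [z zn yz] yt; have [Ex _ XE] := sE x xs.
  have := coordB_le_norm y z top; have := ler_norm (z ord0 top - y ord0 top).
  rewrite distrC => q1 q2.
  have zl : z ord0 top <= X k.+1 x ord0 top + mar k.+1 by lra.
  by have := net_low Ex zn zl; have := dist_triangle z y (X k.+1 x); lra.
- move=> x x' y xs xs' [z zG yz] [z' zG' yz']; apply: contrapT => /eqP xx.
  have [Ex _ _] := sE x xs; have [Ex' _ _] := sE x' xs'.
  have := net_sep Ex Ex' (sc x x' xs xs') (sne x x' xs xs' xx) kH (or_intror zG) (or_intror zG').
  by have := dist_triangle y z z'; rewrite (distrC z y); lra.
- move=> x x' y xs xs' [z zn yz] [z' zG' yz']; apply: contrapT => /eqP xx.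
  have [Ex _ _] := sE x xs; have [Ex' _ _] := sE x' xs'.
  have := net_sep Ex Ex' (sc x x' xs xs') (sne x x' xs xs' xx) kH (or_introl zn) (or_intror zG').
  by have := dist_triangle y z z'; rewrite (distrC z y); lra.
- move=> x y xs [z zG yz]; have [Ex cx _] := sE x xs.
  exists z; last by lra.
  exact: net_up Ea Ex cx kH (or_intror zG).
- move=> x y z xs [w wn yw] nz; have [Ex cx _] := sE x xs.
  rewrite leNgt; apply/negP => yz; apply: nz; exists w.
    exact: net_up Ea Ex cx kH (or_introl wn).
  by have := dist_triangle y z w; rewrite (distrC z y); lra.
- move=> x x' y y' xs xs' xx [z zn yz] [z' zn' yz'].
  have [Ex _ _] := sE x xs; have [Ex' _ _] := sE x' xs'.
  have := net_sep Ex Ex' (sc x x' xs xs') (sne x x' xs xs' xx) kH (or_introl zn) (or_introl zn').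
  have := dist_triangle y z z'; have := dist_triangle y' y z'.
  by rewrite (distrC z y); lra.
- move=> x y [z zn xz] [z' zn' yz'].
  have := net_near (ltnW kH) Ea zn; have := net_near (ltnW kH) Ea zn'.
  have := dist_triangle z x a; have := dist_triangle z' y a.
  by have := dist_triangle a x y; rewrite (distrC a); lra.
- move=> e [Ee ce]; exists (cl k.+1 e).
    apply/sP; split; [exact: rt_cl_in D _ _ Ee|exact: rt_cl_idem D _ _ Ee|].
    by rewrite cl_up.
  by split => //; rewrite (rt_cl_idem D).
- by move=> x xs; rewrite -KE; apply: ih => //; have [] := sE x xs.
Qed.

End RoutedCatch.

(** * Clusters of a uniformly disconnected set *)

Section Clusters.
Variables (R : realType) (n : nat).
Implicit Types (x y a b e : 'rV[R]_n) (E X : set 'rV[R]_n).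

Definition udisc (c : R) E := forall x r, E x -> 0 < r -> exists X,
  [/\ X `<=` E, X x, forall y, X y -> `|x - y| <= r &
      forall y z, X y -> E z -> ~ X z -> r <= c * `|y - z|].

(** Homogeneity in the form used for counting: sup-norm balls are covered by balls whose centres
    need not lie in [E]. *)
Definition covers (C beta : R) E := forall a (r Q : R), 0 < r -> 1 <= Q ->
  exists P : seq 'rV[R]_n, (size P)%:R <= C * Q `^ beta /\
  forall e, E e -> `|e - a| <= r -> exists2 p, p \in P & `|e - p| <= r / Q.

Lemma udisc_sub c E F : F `<=` E -> udisc c E -> udisc c F.
Proof.
move=> FE ud x r Fx r0; have [X [XE Xx Xr Xg]] := ud x r (FE _ Fx) r0.
exists (X `&` F); split=> [y []|||] //.
- by move=> y [Xy _]; exact: Xr.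
- move=> y z [Xy Fy] Fz nz; apply: Xg => //; first exact: FE.
  by move=> Xz; apply: nz.
Qed.

Lemma covers_sub C beta E F : F `<=` E -> covers C beta E -> covers C beta F.
Proof.
move=> FE cE a r Q r0 Q1; have [P [sP hP]] := cE a r Q r0 Q1.
by exists P; split => // e /FE; exact: hP.
Qed.

(* Points that no partition of E into two parts at distance r/c separates. *)
Definition linked (c r : R) E a b := forall X, X `<=` E ->
  (forall y z, X y -> E z -> ~ X z -> r <= c * `|y - z|) -> X a <-> X b.

Lemma linked_near c r E a b : udisc c E -> 0 < r -> E a -> linked c r E a b ->
  `|a - b| <= r.
Proof.
move=> ud r0 Ea ab; have [X [XE Xa Xr Xg]] := ud a r Ea r0.
by apply: Xr; apply/(ab X).
Qed.

Lemma linked_sep c r E a b : E a -> E b -> ~ linked c r E a b ->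
  r <= c * `|a - b|.
Proof.
move=> Ea Eb; apply: contra_notP => nr X XE Xg; split => Xx; apply: contrapT => nX.
  by apply: nr; exact: Xg.
by apply: nr; rewrite distrC; exact: Xg.
Qed.

Lemma linked_le c r s E a b : r <= s -> linked c r E a b -> linked c s E a b.
Proof.
by move=> rs ab X XE Xg; apply: ab => // y z Xy Ez nz; apply: le_trans rs _; exact: Xg.
Qed.

(** The sets given by [udisc] at different points and scales need not be disjoint or nested. The
    classes of [linked] are: it is an equivalence relation that becomes finer as the scale
    decreases, with small classes by [linked_near] and gaps by [linked_sep]. *)
Lemma clusters_exist c E a0 (h : nat -> R) : udisc c E -> E a0 ->
  (forall k, 0 < h k) -> (forall k, h k.+1 <= h k) ->
  (forall a, E a -> `|a - a0| <= h 0) ->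
  exists cl : nat -> 'rV[R]_n -> 'rV[R]_n, (forall a, cl 0 a = a0) /\ [/\
    forall k a, E a -> E (cl k a),
    forall k a, E a -> `|a - cl k a| <= h k,
    forall k a, E a -> cl k (cl k a) = cl k a,
    forall k a a', E a -> E a' -> cl k.+1 a = cl k.+1 a' -> cl k a = cl k a' &
    forall k a a', E a -> E a' -> cl k a != cl k a' -> h k <= c * `|a - a'|].
Proof.
move=> ud Ea0 h0 hS ha.
pose S k a := [set b | E b /\ linked c (h k) E a b].
(* The representative is chosen from the class as a set, so that equal classes get the same one.
   Level 0 is a single cluster represented by [a0]. *)
pose cl k a := if k is 0 then a0 else xget a0 (S k a).
have linkC k a b : linked c (h k) E a b -> linked c (h k) E b a.
  by move=> ab X XE Xg; split=> /(ab X XE Xg).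
have linkT k a b d : linked c (h k) E a b -> linked c (h k) E b d -> linked c (h k) E a d.
  move=> ab bd X XE Xg; split; first by move=> /(ab X XE Xg)/(bd X XE Xg).
  by move=> /(bd X XE Xg)/(ab X XE Xg).
have clP k a : E a -> S k.+1 a (cl k.+1 a).
  by move=> Ea; rewrite /cl; case: xgetP => // /(_ a); case; split => // X.
have clE k a a' : E a -> E a' ->
    cl k.+1 a = cl k.+1 a' <-> linked c (h k.+1) E a a'.
  move=> Ea Ea'; split => [aa|aa].
    have [_ l1] := clP k a Ea; have [_ l2] := clP k a' Ea'.
    by apply: linkT l1 _; rewrite aa; exact: linkC.
  congr xget; apply/seteqP; split => b [Eb lb]; split => //.
    exact: linkT (linkC _ _ _ aa) lb.
  exact: linkT aa lb.
have cE k a : E a -> E (cl k a) by case: k => // k /(clP k)[].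
exists cl; split => //; split => //.
- by case=> [|k] a Ea; [exact: ha|have [_] := clP k a Ea; exact: linked_near].
- case=> [//|k] a Ea; apply/(clE k) => //; first exact: cE.
  by apply: linkC; have [] := clP k a Ea.
- move=> [//|k] a a' Ea Ea' /(clE k.+1 _ _ Ea Ea') aa; apply/(clE k) => //.
  exact: linked_le aa.
- move=> [|k] a a' Ea Ea'; first by rewrite eqxx.
  move=> /eqP aa; apply: (linked_sep Ea Ea') => l; apply: aa.
  exact: (clE k a a' Ea Ea').2 l.
Qed.

(** A point of [P] is within [t] of at most one point of [S], so choosing that point, if any,
    enumerates [S]. *)
Lemma separated_finite (S : set 'rV[R]_n) (P : seq 'rV[R]_n) (t : R) :
  (forall e, S e -> exists2 p, p \in P & `|e - p| <= t) ->
  (forall e e', S e -> S e' -> `|e - e'| <= 2 * t -> e = e') ->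
  exists s : seq 'rV[R]_n,
    [/\ uniq s, (size s <= size P)%N & forall x, x \in s <-> S x].
Proof.
move=> hP hS.
pose pk p := if pselect (exists e, S e /\ `|e - p| <= t) is left ex
  then Some (projT1 (cid ex)) else None.
exists (undup (pmap pk P)); split.
- exact: undup_uniq.
- by rewrite (leq_trans (size_undup _))// size_pmap count_size.
- move=> x; rewrite mem_undup mem_pmap; split.
    move=> /mapP[p pP]; rewrite /pk; case: pselect => // ex [->].
    by case: (cid ex) => /= e [Se _].
  move=> Sx; have [p pP xp] := hP x Sx; apply/mapP; exists p => //.
  rewrite /pk; case: pselect => [ex|[]]; last by exists x.
  case: (cid ex) => /= e [Se ep]; congr Some; apply: hS => //.
  by have := dist_triangle p x e; rewrite (distrC p); lra.
Qed.

End Clusters.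

(** [P] relates each choice to every earlier one; [T] is what a choice must satisfy on its own so
    that later choices remain possible. *)
Lemma greedy_choice (V : eqType) (W : Type) (w0 : W) (s : seq V)
    (T : V -> W -> Prop) (P : V -> V -> W -> W -> Prop) :
  uniq s ->
  (forall s1 v s2 f, s = s1 ++ v :: s2 -> (forall u, u \in s1 -> T u (f u)) ->
    exists w, T v w /\ forall u, u \in s1 -> P u v (f u) w) ->
  exists f, (forall v, v \in s -> T v (f v)) /\
    forall s1 v s2 u, s = s1 ++ v :: s2 -> u \in s1 -> P u v (f u) (f v).
Proof.
elim/last_ind: s => [|s v ih].
  by move=> _ _; exists (fun=> w0); split => // s1 v s2 u; case: s1.
rewrite rcons_uniq => /andP[vs us] ext.
have [|f [fT fP]] := ih us.
  move=> s1 u s2 f e fT; have := ext s1 u (rcons s2 v) f.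
  by rewrite e rcons_cat; apply.
have [|w [wT wP]] := ext s v [::] f _ fT; first by rewrite cats1.
exists (fun u => if u == v then w else f u); split.
  move=> u; rewrite mem_rcons in_cons; case: eqP => [-> //|_] /= us'; exact: fT.
move=> s1 u s2 x; case/lastP: s2 => [|s2 y].
  rewrite cats1 => /rcons_inj[<- <-] xs; rewrite eqxx ifN; first exact: wP.
  by apply: contraNneq vs => <-.
rewrite -rcons_cons -rcons_cat => /rcons_inj[e _] xs1.
have us1 : u \in s by rewrite e mem_cat in_cons eqxx orbT.
have xs : x \in s by rewrite e mem_cat xs1.
rewrite !ifN; [exact: fP e xs1|by apply: contraNneq vs => <-|by apply: contraNneq vs => <-].
Qed.

(** * Counting grid positions *)

Section Counting.
Local Open Scope nat_scope.

Lemma card_bigcup_le (T I : finType) (S : {set T}) (F : I -> {set T}) (c : nat) :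
  (forall x, x \in S -> exists i, x \in F i) -> (forall i, #|F i| <= c) ->
  #|S| <= #|I| * c.
Proof.
move=> SF Fc; apply: (@leq_trans #|(\bigcup_i F i)%SET|).
  apply: subset_leq_card; apply/fintype.subsetP => x /SF[i xi].
  by apply/finset.bigcupP; exists i.
apply: (@leq_trans (\sum_(i : I) #|F i|)).
  elim/big_rec2: _ => [|i A B _ h]; first by rewrite cards0.
  by apply: leq_trans (leq_card_setU _ _) _; rewrite leq_add2l.
by rewrite -sum_nat_const; apply: leq_sum => i _.
Qed.

Lemma card_box_le (n Q c : nat) (f : 'I_n) (B : 'I_n -> {set 'I_Q}) :
  (forall l, l != f -> #|B l| <= c) ->
  #|[set w : {ffun 'I_n -> 'I_Q} | [forall (l | l != f), w l \in B l]]%SET|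
    <= Q * c ^ n.-1.
Proof.
move=> Bc; pose F l : {set 'I_Q} := if l == f then [set: 'I_Q]%SET else B l.
apply: (@leq_trans #|[set w : {ffun 'I_n -> 'I_Q} | w \in family F]%SET|).
  apply: subset_leq_card; apply/fintype.subsetP => w; rewrite !inE => /forallP h.
  apply/familyP => l; rewrite /F; case: eqP => [_|/eqP lf]; first by rewrite finset.in_setT.
  by have := h l; rewrite lf.
rewrite cardsE card_family foldrE big_map big_enum /= (bigD1 f)//=.
rewrite /F eqxx cardsT card_ord leq_mul2l; apply/orP; right.
apply: (@leq_trans (\prod_(l < n | l != f) c)).
  by apply: leq_prod => l lf; rewrite (negbTE lf) Bc.
by rewrite prod_nat_const cardC1 card_ord.
Qed.

(** Exchanging the two components in the coordinates where [sg] holds is injective on pairs; the mix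
    becomes the first component, and the second one is arbitrary. *)
Lemma card_mix_le (n Q b : nat) (sg : 'I_n -> bool)
    (B : {set {ffun 'I_n -> 'I_Q}}) :
  #|B| <= b -> #|[set ww : {ffun 'I_n -> 'I_Q} * {ffun 'I_n -> 'I_Q} |
    [ffun l => if sg l then ww.2 l else ww.1 l] \in B]%SET| <= b * Q ^ n.
Proof.
move=> Bb; pose phi (ww : {ffun 'I_n -> 'I_Q} * {ffun 'I_n -> 'I_Q}) :=
  ([ffun l => if sg l then ww.2 l else ww.1 l],
   [ffun l => if sg l then ww.1 l else ww.2 l]).
have phi_inj : injective phi.
  move=> [u v] [u' v'] [/ffunP e1 /ffunP e2]; congr pair; apply/ffunP => l.
    by have := e1 l; have := e2 l; rewrite !ffunE /=; case: (sg l).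
  by have := e1 l; have := e2 l; rewrite !ffunE /=; case: (sg l).
rewrite -(card_imset (mem (finset _)) phi_inj).
apply: (@leq_trans #|finset.setX B [set: {ffun 'I_n -> 'I_Q}]%SET|).
  apply: subset_leq_card; apply/fintype.subsetP => x /imsetP[ww].
  by rewrite inE => h ->; rewrite /phi finset.in_setX h finset.in_setT.
by rewrite cardsX cardsT card_ffun !card_ord leq_mul2r Bb orbT.
Qed.

(** Markov's inequality for the sizes of the fibres of [S], with the threshold z/c cleared of
    denominators. *)
Lemma card_fibers_le (W : finType) (S : {set W * W}) (z c : nat) :
  #|[set w | z < c * #|[set w' | (w, w') \in S]%SET|]%SET| * z <= c * #|S|.
Proof.
have -> : #|S| = \sum_(w : W) #|[set w' | (w, w') \in S]%SET|.
  rewrite -sum1_card (eq_bigr (fun w => \sum_(w' | (w, w') \in S) 1)); last first.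
    by move=> w _; rewrite -sum1_card; apply: eq_bigl => w'; rewrite inE.
  by rewrite (pair_big_dep predT (fun w w' => (w, w') \in S)) /=; apply: eq_bigl => -[].
rewrite big_distrr -sum_nat_const [X in _ <= X](bigID (mem [set w |
  z < c * #|[set w' | (w, w') \in S]%SET|]%SET)) /=.
apply: leq_trans (leq_addr _ _); apply: leq_sum => w.
by rewrite inE => /ltnW.
Qed.

End Counting.

Lemma card_window_le (R : realType) (Q K : nat) (u : R) :
  (#|[set j : 'I_Q | ((u < j%:R) && (j%:R < u + K%:R))%R]%SET| <= K)%N.
Proof.
set S : {set 'I_Q} := (X in #|pred_of_set X|).
have [->|[j0 j0S]] := set_0Vmem S; first by rewrite cards0.
case: (@arg_minnP _ j0 (mem S) (fun j => j : nat)) => // i iS imin.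
rewrite cardE -(size_map val) -(size_iota i K).
apply: uniq_leq_size; first by rewrite (map_inj_uniq val_inj) enum_uniq.
move=> x /mapP[j]; rewrite mem_enum => jS ->; rewrite mem_iota imin//=.
move: iS jS; rewrite !inE => /andP[iu _] /andP[_ ju].
by rewrite -(ltr_nat R) natrD; lra.
Qed.

Lemma card_close_le (R : realType) (Q : nat) (x t c : R) : 0 < t ->
  (#|[set j : 'I_Q | (`|x + t * j%:R - c| < 2 * t)%R]%SET| <= 4)%N.
Proof.
move=> t0; apply: leq_trans (card_window_le Q 4 ((c - x) / t - 2)).
apply: subset_leq_card; apply/fintype.subsetP => j; rewrite !inE ltr_norml.
move=> /andP[h1 h2]; apply/andP; split.
  by rewrite ltrBlDr ltr_pdivrMr// mulrDl; lra.
have : j%:R - 2 < (c - x) / t by rewrite ltr_pdivlMr// mulrBl; lra.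
by lra.
Qed.

Section Grid.
Variables (R : realType) (n : nat).
Implicit Types (x y a e : 'rV[R]_n) (E : set 'rV[R]_n) (Q : nat).

(** The candidates for a corner fill a cube of side about [h] that is, in every coordinate, below
    all points within [h] of [a]. *)
Definition gridpt (h : R) Q a (w : {ffun 'I_n -> 'I_Q}) : 'rV[R]_n :=
  \row_l (a ord0 l - 3 * h + h / Q%:R * (w l)%:R).

Lemma gridpt_box h Q a (w : {ffun 'I_n -> 'I_Q}) l : 0 < h ->
  a ord0 l - 3 * h <= gridpt h a w ord0 l <= a ord0 l - 2 * h.
Proof.
move=> h0; rewrite mxE; have wQ : (w l < Q)%N by [].
have Q0 : 0 < Q%:R :> R by rewrite ltr0n (leq_ltn_trans _ wQ).
have h1 : 0 <= h / Q%:R * (w l)%:R by rewrite mulr_ge0// divr_ge0// ltW.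
have h2 : h / Q%:R * (w l)%:R <= h.
  by rewrite mulrAC ler_pdivrMr// ler_wpM2l//; [exact: ltW|rewrite ler_nat ltnW].
by apply/andP; split; lra.
Qed.

(** The pair of corners is bad: some axis-parallel line, in direction [f], through one of their
    mixes passes too close to [E]. *)
Definition blocked E (h h' : R) Q a a' (w w' : {ffun 'I_n -> 'I_Q}) : Prop :=
  exists e (f : 'I_n) (sg : 'I_n -> bool), [/\ E e, `|e - a| <= 12 * h &
    forall l, l != f -> `|e ord0 l -
      (if sg l then gridpt h' a' w' ord0 l else gridpt h a w ord0 l)| < h' / Q%:R].

(** The nearby part of [E] is covered by [B] balls of radius h'/Q. For each ball, direction and
    mixing pattern, all coordinates of the mix but one are confined to four grid values. This leaves
    about Q^(beta + n + 1) of the Q^(2n) pairs, a small fraction when beta < n - 1. *)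
Lemma blocked_card C beta E h h' Q a a' : covers C beta E ->
  0 < h' -> h' <= h -> (0 < Q)%N ->
  exists B : nat, B%:R <= C * (12 * (h / h') * Q%:R) `^ beta /\
  (#|[set ww : {ffun 'I_n -> 'I_Q} * {ffun 'I_n -> 'I_Q} |
     `[< blocked E h h' a a' ww.1 ww.2 >] ]%SET| <=
   B * (n * 2 ^ n) * (Q * 4 ^ n.-1 * Q ^ n))%N.
Proof.
move=> cE h'0 hh Q0; have h0 : 0 < h by lra.
have QR : 1 <= Q%:R :> R by rewrite ler1n.
have hh1 : 1 <= h / h' by rewrite ler_pdivlMr// mul1r.
have [||P [sP PP]] := cE a (12 * h) (12 * (h / h') * Q%:R); first by lra.
  by rewrite -[1]mulr1 ler_pM//; lra.
have rE : 12 * h / (12 * (h / h') * Q%:R) = h' / Q%:R.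
  by field; rewrite !gt_eqF//; lra.
exists (size P); split => //.
pose I := ('I_(size P) * ('I_n * {ffun 'I_n -> bool}))%type.
pose org l (s : bool) := if s then a' ord0 l - 3 * h' else a ord0 l - 3 * h.
pose spc (s : bool) := if s then h' / Q%:R else h / Q%:R.
pose Bx (i : I) l := [set j : 'I_Q | `|org l (i.2.2 l) + spc (i.2.2 l) * j%:R -
  (P`_(i.1)) ord0 l| < 2 * spc (i.2.2 l)]%SET.
pose F (i : I) := [set ww : {ffun 'I_n -> 'I_Q} * {ffun 'I_n -> 'I_Q} |
  [ffun l => if i.2.2 l then ww.2 l else ww.1 l] \in
  [set w : {ffun 'I_n -> 'I_Q} | [forall (l | l != i.2.1), w l \in Bx i l]]]%SET.
have spc0 s : 0 < spc s by rewrite /spc; case: s; rewrite divr_gt0//; lra.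
have cI : #|{: I}| = (size P * (n * 2 ^ n))%N.
  by rewrite !card_prod card_ffun !card_ord card_bool.
rewrite -cI; apply: (@card_bigcup_le _ _ _ F).
  move=> [w w']; rewrite inE => /asboolP[e [f [sg [Ee ea /= hl]]]].
  have [p pP] := PP e Ee ea; rewrite rE => ep.
  have ip : (index p P < size P)%N by rewrite index_mem.
  exists (Ordinal ip, (f, [ffun l => sg l])).
  rewrite !inE; apply/forallP => l; apply/implyP => /= lf; rewrite !inE /=.
  rewrite nth_index// !ffunE; have := hl l lf; have := coordB_le_norm e p l.
  have hs : h' / Q%:R <= spc (sg l).
    by rewrite /spc; case: (sg l) => //; rewrite ler_wpM2r// invr_ge0; lra.
  have -> : org l (sg l) + spc (sg l) * (if sg l then w' l else w l)%:R =
      (if sg l then gridpt h' a' w' ord0 l else gridpt h a w ord0 l).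
    by rewrite /org /spc; case: (sg l); rewrite mxE.
  set g := if sg l then _ else _ => k1 k2.
  have := ler_normD (g - e ord0 l) (e ord0 l - p ord0 l); rewrite addrA subrK.
  by rewrite (distrC g (e ord0 l)); lra.
move=> i; apply: card_mix_le; apply: card_box_le => l _.
exact: card_close_le.
Qed.

Lemma card_coord_le (Q : nat) (l : 'I_n) (S : {set 'I_Q}) :
  (#|[set w : {ffun 'I_n -> 'I_Q} | w l \in S]%SET| <= #|S| * Q ^ n.-1)%N.
Proof.
pose F l' : {set 'I_Q} := if l' == l then S else [set: 'I_Q]%SET.
apply: (@leq_trans #|[set w : {ffun 'I_n -> 'I_Q} | w \in family F]%SET|).
  apply: subset_leq_card; apply/fintype.subsetP => w; rewrite !inE => h.
  by apply/familyP => l'; rewrite /F; case: eqP => [->//|_]; rewrite finset.in_setT.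
rewrite cardsE card_family foldrE big_map big_enum /= (bigD1 l)//=.
rewrite /F eqxx leq_mul2l; apply/orP; right.
rewrite (eq_bigr (fun=> Q)) => [|l' /negbTE ->]; last by rewrite cardsT card_ord.
by rewrite prod_nat_const cardC1 card_ord.
Qed.

Lemma close_card h Q a (c : 'rV[R]_n) : 0 < h -> (0 < Q)%N ->
  (#|[set w : {ffun 'I_n -> 'I_Q} |
     [exists l, (`|gridpt h a w ord0 l - c ord0 l| < h / Q%:R)%R] ]%SET| <=
   n * (4 * Q ^ n.-1))%N.
Proof.
move=> h0 Q0; have hQ : 0 < h / Q%:R by rewrite divr_gt0 ?ltr0n.
pose S l := [set j : 'I_Q | `|a ord0 l - 3 * h + h / Q%:R * j%:R - c ord0 l| <
   2 * (h / Q%:R)]%SET.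
rewrite -[X in (_ <= X * _)%N]card_ord; apply: (@card_bigcup_le _ _ _
  (fun l => [set w : {ffun 'I_n -> 'I_Q} | w l \in S l]%SET)) => [w|l].
  rewrite inE => /existsP[l]; rewrite mxE => wl; exists l; rewrite !inE; lra.
apply: leq_trans (card_coord_le _ _) _; rewrite leq_mul2r; apply/orP; right.
exact: card_close_le.
Qed.

End Grid.

(** * Choosing the corners *)

Lemma three_quarters (a b c q : nat) :
  (q <= a + b + c -> 4 * a <= q -> 4 * b <= q -> 4 * c <= q -> 0 < q -> False)%N.
Proof. lia. Qed.

Section Placement.
Variables (R : realType) (n : nat) (E : set 'rV[R]_n) (C beta c1 lam : R).
Variables (A H Q N N1 : nat) (h : nat -> R) (cl : nat -> 'rV[R]_n -> 'rV[R]_n).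
Variable a0 : 'rV[R]_n.
Implicit Types (x y a e : 'rV[R]_n) (k : nat).

Hypothesis cE : covers C beta E.
Hypotheses (lam1 : 1 <= lam) (c1_ge1 : 1 <= c1) (Q0 : (0 < Q)%N).
Hypotheses (h_gt0 : forall k, 0 < h k) (hS : forall k, h k = lam * h k.+1).
Hypothesis Ea0 : forall a, E a -> `|a - a0| <= h 0.
Hypothesis cl_in : forall k a, E a -> E (cl k a).
Hypothesis cl_dist : forall k a, E a -> `|a - cl k a| <= h k.
Hypothesis cl_idem : forall k a, E a -> cl k (cl k a) = cl k a.
Hypothesis cl_refine : forall k a a', E a -> E a' ->
  cl k.+1 a = cl k.+1 a' -> cl k a = cl k a'.
Hypothesis cl_sep : forall k a a', E a -> E a' ->
  cl k a != cl k a' -> h k <= c1 * `|a - a'|.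

(** Distinct representatives are at least [h k / c1] apart, so a covering at scale [h k / (3 * c1)]
    tells them apart. *)
Lemma node_list k a r : h k <= 3 * c1 * r -> exists s : seq 'rV[R]_n,
  [/\ uniq s, (size s)%:R <= C * (3 * c1 * (r / h k)) `^ beta &
      forall x, x \in s <-> [/\ E x, cl k x = x & `|x - a| <= r]].
Proof.
move=> hr; have h0 := h_gt0 k; have c0 : 0 < c1 by exact: lt_le_trans c1_ge1.
have r0 : 0 < r by nra.
have [|P [sP PP]] := @cE a r (3 * c1 * (r / h k)) r0.
  by rewrite mulrA ler_pdivlMr// mul1r.
have rE : r / (3 * c1 * (r / h k)) = h k / (3 * c1).
  by field; rewrite !gt_eqF.
have [||s [us sPs sE]] := @separated_finite R n
  [set x | [/\ E x, cl k x = x & `|x - a| <= r]] P (h k / (3 * c1)).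
- by move=> e [Ee _ ea]; rewrite -rE; exact: PP.
- move=> e e' [Ee ce _] [Ee' ce' _] ee; apply: contrapT => /eqP ne.
  have : cl k e != cl k e' by rewrite ce ce'.
  move=> /(cl_sep Ee Ee'); have : c1 * `|e - e'| <= c1 * (2 * (h k / (3 * c1))).
    by rewrite ler_wpM2l// ltW.
  have -> : c1 * (2 * (h k / (3 * c1))) = 2 / 3 * h k by field; rewrite gt_eqF.
  lra.
- exists s; split => //; apply: le_trans sP; by rewrite ler_nat.
Qed.

Hypothesis NP : forall s : seq 'rV[R]_n, (size s)%:R <= C * (3 * c1 * (2 * lam)) `^ beta ->
  (size s <= N)%N.
Hypothesis N1P : forall s : seq 'rV[R]_n, (size s)%:R <= C * (3 * c1 * (22 * lam)) `^ beta ->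
  (size s <= N1)%N.
Hypothesis BP : forall B : nat, B%:R <= C * (12 * lam * Q%:R) `^ beta ->
  (16 * N * (B * (n * 2 ^ n) * (Q * 4 ^ n.-1 * Q ^ n)) <= Q ^ n * Q ^ n)%N.
Hypothesis QP : (16 * n * (2 * A).+3 * N1 * Q ^ n.-1 <= Q ^ n)%N.

Let h_step k : h k.+1 <= h k.
Proof. by rewrite (hS k) ler_peMl// ltW. Qed.

Let ratio k : h k / h k.+1 = lam.
Proof. by rewrite (hS k) mulfK// gt_eqF. Qed.

Let scale_le k j : (k <= j)%N -> h j <= h k.
Proof.
move=> /subnK <-; elim: (j - k)%N => [|i ih]; first by rewrite add0n.
by rewrite addSn; exact: le_trans (h_step _) ih.
Qed.

Lemma child_list k a : E a -> exists s : seq 'rV[R]_n,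
  [/\ uniq s, (size s <= N)%N &
      forall x, x \in s <-> [/\ E x, cl k.+1 x = x & cl k x = cl k a]].
Proof.
move=> Ea; have h0 := h_gt0 k; have h1 := h_gt0 k.+1; have hs := h_step k.
have [|s [us sP sE]] := @node_list k.+1 a (2 * h k); first by have := c1_ge1; nra.
exists [seq x <- s | cl k x == cl k a]; split; first exact: filter_uniq.
  rewrite size_filter (leq_trans (count_size _ _))// NP//.
  by rewrite -(ratio k) [2 * (_ / _)]mulrA.
move=> x; rewrite mem_filter; split => [/andP[/eqP cx /sE[Ex cxx _]]|[Ex cxx cx]].
  by [].
rewrite cx eqxx; apply/sE; split => //.
have := cl_dist k Ex; have := cl_dist k Ea; rewrite cx => d1 d2.
by have := dist_triangle (cl k a) x a; rewrite (distrC (cl k a)); lra.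
Qed.

Let W := {ffun 'I_n -> 'I_Q}.
Let w0 : W := [ffun=> Ordinal Q0].

Let bset k a a' (w : W) : {set W} :=
  [set w' | `[< blocked E (h k) (h k.+1) a a' w w' >] ]%SET.

(** A corner is chosen before those of its children, and a bound on the number of bad pairs does not
    prevent one position from being bad with all positions of a child. Positions satisfying [T]
    leave most positions of every child open. *)
Let T (v : nat * 'rV[R]_n) (w : W) := forall a', E a' -> cl v.1.+1 a' = a' ->
  cl v.1 a' = v.2 -> (4 * #|bset v.1 v.2 a' w| <= Q ^ n)%N.

Let P (u v : nat * 'rV[R]_n) (w w' : W) :=
  (v.1 = u.1.+1 -> cl u.1 v.2 = u.2 -> w' \notin bset u.1 u.2 v.2 w) /\
  ((u.1 <= v.1)%N -> (v.1 <= u.1 + (2 * A).+2)%N -> `|u.2 - v.2| <= 22 * lam * h u.1 ->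
    forall l, h v.1 / Q%:R <= `|gridpt (h v.1) v.2 w' ord0 l - gridpt (h u.1) u.2 w ord0 l|).

(** For one child, [card_fibers_le] turns the bound on blocked pairs into a bound on the positions
    with many blocked partners; the factor [16 * N] in [BP] allows for the sum over at most [N]
    children. *)
Lemma typical_card k a : E a -> cl k a = a ->
  (4 * #|[set w | ~~ `[< T (k, a) w >] ]%SET| <= Q ^ n)%N.
Proof.
move=> Ea ca; have [s [us sN sE]] := child_list k Ea.
have h0 := h_gt0 k; have h1 := h_gt0 k.+1; have hs := h_step k.
have QW : (0 < Q ^ n)%N by rewrite expn_gt0 Q0.
pose S a' := [set w | (Q ^ n < 4 * #|bset k a a' w|)%N]%SET.
have SP a' : (4 * N * #|S a'| <= Q ^ n)%N.
  have [B [B1 B2]] := blocked_card a a' cE h1 hs Q0.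
  rewrite ratio in B1; have {B1} := BP B1; set Z := (_ * (Q * _ * _))%N in B2 *.
  set X := [set ww | _]%SET in B2; move=> h2.
  rewrite -(leq_pmul2r QW); apply: leq_trans h2.
  have -> : (4 * N * #|S a'| * Q ^ n = 4 * N * (#|S a'| * Q ^ n))%N by rewrite !mulnA.
  have -> : (16 * N * Z = 4 * N * (4 * Z))%N by lia.
  rewrite leq_mul2l; apply/orP; right.
  apply: (@leq_trans (4 * #|X|)); last by rewrite leq_mul2l B2.
  apply: leq_trans (card_fibers_le X (Q ^ n) 4).
  rewrite leq_mul2r; apply/orP; right; apply: subset_leq_card.
  apply/fintype.subsetP => w; rewrite !inE => hw; apply: (leq_trans hw).
  rewrite leq_mul2l; apply: subset_leq_card; apply/fintype.subsetP => w'.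
  by rewrite !inE.
(* The division by [4 * N] below needs [N] positive; with [N = 0] there are no children and every
   position is typical. *)
have [N0|N0] := posnP N.
  have s0 : s = [::] by move: sN; rewrite N0 leqn0 size_eq0 => /eqP.
  rewrite (_ : [set w | _]%SET = finset.set0) ?cards0//; apply/setP => w.
  rewrite !inE; apply/negbTE/negPn/asboolP => a' Ea' ca' caa /=.
  by have := (sE a').2 (And3 Ea' ca' (etrans caa (esym ca))); rewrite s0.
apply: (@leq_trans (4 * (N * (Q ^ n %/ (4 * N))))); last first.
  by rewrite mulnA mulnC leq_divM.
rewrite leq_mul2l; apply: leq_trans (leq_mul sN (leqnn _)).
rewrite -[size s]card_ord.
apply: (@card_bigcup_le _ _ _ (fun i : 'I_(size s) => S (nth a s i))) => [w|i].
  rewrite inE => /asboolPn; apply: contra_notP => hn a' Ea' ca' caa.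
  have a's : a' \in s by apply/sE; split => //; rewrite caa.
  rewrite leqNgt; apply/negP => lt; apply: hn.
  have ia : (index a' s < size s)%N by rewrite index_mem.
  by exists (Ordinal ia); rewrite inE /= nth_index.
by rewrite leq_divRL ?muln_gt0// mulnC SP.
Qed.

Let crowded (s1 : seq (nat * 'rV[R]_n)) (f : nat * 'rV[R]_n -> W) k b (w : W) :=
  exists u (l : 'I_n), [/\ u \in s1, (u.1 <= k)%N, (k <= u.1 + (2 * A).+2)%N,
    `|u.2 - b| <= 22 * lam * h u.1 &
    `|gridpt (h k) b w ord0 l - gridpt (h u.1) u.2 (f u) ord0 l| < h k / Q%:R].

(** The window has [(2 * A).+3] levels with at most [N1] nearby nodes each, and a node excludes at
    most four grid values in each coordinate. *)
Lemma crowded_card k b s1 f :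
  (forall u, u \in s1 -> E u.2 /\ cl u.1 u.2 = u.2) ->
  (4 * #|[set w | `[< crowded s1 f k b w >] ]%SET| <= Q ^ n)%N.
Proof.
move=> s1P.
have /choice[nl nlP] i : exists s : seq 'rV[R]_n, [/\ uniq s, (size s <= N1)%N &
    forall x, x \in s <-> [/\ E x, cl i x = x & `|x - b| <= 22 * lam * h i]].
  have [|s [us sP sE]] := @node_list i b (22 * lam * h i).
    have := h_gt0 i; have : 1 <= c1 * lam by rewrite -[1]mulr1 ler_pM.
    by move=> c1l hi; rewrite (_ : 3 * c1 * _ = 66 * (c1 * lam) * h i); [nra|ring].
  exists s; split => //; apply: N1P; move: sP.
  by have -> : 22 * lam * h i / h i = 22 * lam by rewrite mulfK// gt_eqF.
pose I := ('I_(2 * A).+3 * 'I_N1)%type.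
pose F (i : I) := [set w : W | [exists l, `|gridpt (h k) b w ord0 l -
   gridpt (h (k - i.1)) (nth 0 (nl (k - i.1)%N) i.2)
     (f ((k - i.1)%N, nth 0 (nl (k - i.1)%N) i.2)) ord0 l| < h k / Q%:R] ]%SET.
apply: leq_trans QP.
have -> : (16 * n * (2 * A).+3 * N1 * Q ^ n.-1 = 4 * (#|{: I}| * (n * (4 * Q ^ n.-1))))%N.
  by rewrite card_prod !card_ord; lia.
rewrite leq_mul2l; apply: (@card_bigcup_le _ _ _ F) => [w|i]; last exact: close_card.
rewrite inE => /asboolP[[i a] [l [/s1P[/= Ea ca] ik ki ab wl]]].
have i1 : (k - i < (2 * A).+3)%N by rewrite ltnS leq_subLR.
have [_ ns nE] := nlP i; have an : a \in nl i by apply/nE.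
have ia : (index a (nl i) < N1)%N by apply: leq_trans ns; rewrite index_mem.
exists (Ordinal i1, Ordinal ia); rewrite inE; apply/existsP; exists l => /=.
by rewrite subKn// nth_index.
Qed.

(** Atypical positions, those blocked by the parent's choice and those crowded by earlier corners
    each make up at most a quarter of the grid, so some position remains. *)
Lemma free_choice k b (s1 : seq (nat * 'rV[R]_n)) (f : nat * 'rV[R]_n -> W) :
  E b -> cl k b = b ->
  (forall u, u \in s1 -> E u.2 /\ cl u.1 u.2 = u.2) ->
  (forall u, u \in s1 -> T u (f u)) ->
  (forall k', k = k'.+1 -> (k', cl k' b) \in s1) ->
  exists w, T (k, b) w /\ forall u, u \in s1 -> P u (k, b) (f u) w.
Proof.
move=> Eb cb s1P fT par.
pose B1 := [set w | ~~ `[< T (k, b) w >] ]%SET.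
pose B2 := if k is k'.+1 then bset k' (cl k' b) b (f (k', cl k' b)) else finset.set0.
pose B3 := [set w | `[< crowded s1 f k b w >] ]%SET.
have QW : (0 < Q ^ n)%N by rewrite expn_gt0 Q0.
have c1B : (4 * #|B1| <= Q ^ n)%N by exact: typical_card.
have c2B : (4 * #|B2| <= Q ^ n)%N.
  rewrite /B2; clear B1 B2 B3 c1B; case: k par cb => [|k'] par cb.
    by rewrite cards0 muln0.
  exact: (fT _ (par k' erefl) b Eb cb erefl).
have c3B : (4 * #|B3| <= Q ^ n)%N by exact: crowded_card.
have cW : #|{: W}| = (Q ^ n)%N by rewrite card_ffun !card_ord.
have [w wB] : exists w, w \notin (B1 :|: B2 :|: B3)%SET.
  apply: contrapT => nw.
  have full : (#|{: W}| <= #|(B1 :|: B2 :|: B3)%SET|)%N.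
    apply: subset_leq_card; apply/fintype.subsetP => w _.
    by apply: contrapT => /negP wB; apply: nw; exists w.
  have u12 := leq_trans (leq_card_setU (B1 :|: B2)%SET B3)
    (leq_add (leq_card_setU B1 B2) (leqnn #|B3|)).
  rewrite cW in full; exact: three_quarters (leq_trans full u12) c1B c2B c3B QW.
move: wB; rewrite !finset.in_setU !negb_or => /andP[/andP[w1 w2] w3].
exists w; split; first by move: w1; rewrite inE negbK => /asboolP.
move=> [i a] us; split => [/= ki ia|/= ik ki ab l].
  by move: w2; rewrite /B2 ki ia.
rewrite leNgt; apply/negP => wl; move: w3; rewrite inE => /asboolPn; apply.
by exists (i, a), l.
Qed.

Lemma placement : exists X : nat -> 'rV[R]_n -> 'rV[R]_n, [/\
  forall k a a', cl k a = cl k a' -> X k a = X k a',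
  forall k a (l : 'I_n), cl k a ord0 l - 3 * h k <= X k a ord0 l <= cl k a ord0 l - 2 * h k,
  forall i i' a a' (l : 'I_n), E a -> E a' -> (i <= i')%N -> (i' <= H)%N ->
    (i' <= i + (2 * A).+2)%N -> (i < i')%N \/ cl i a != cl i a' ->
    `|a - a'| <= 20 * lam * h i ->
    Q%:R^-1 * h i' <= `|X i a ord0 l - X i' a' ord0 l| &
  forall k a e (f : 'I_n) (sg : 'I_n -> bool), (k < H)%N ->
    E a -> E e -> `|a - e| <= 10 * h k -> exists l, l != f /\
    Q%:R^-1 * h k.+1 <= `|e ord0 l - (if sg l then X k.+1 a ord0 l else X k a ord0 l)|].
Proof.
have /choice[nd ndP] k : exists s : seq 'rV[R]_n,
    uniq s /\ forall x, x \in s <-> E x /\ cl k x = x.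
  have hk0 : h k <= h 0 by exact: scale_le.
  have h0 := h_gt0 0; have c11 := c1_ge1.
  have [|s [us _ sE]] := @node_list k a0 (h 0); first by nra.
  exists s; split => // x; split => [/sE[]//|[Ex cx]].
  by apply/sE; split => //; exact: Ea0.
pose lev (u v : nat * 'rV[R]_n) := (u.1 <= v.1)%N.
(* Corners are chosen by increasing level: a parent precedes its children, and two corners are
   compared at the finer of their scales, that of the later one. *)
pose all := sort lev [seq (k, a) | k <- iota 0 H.+1, a <- nd k].
have nodeP k a : (k, a) \in all <-> [/\ (k <= H)%N, E a & cl k a = a].
  rewrite mem_sort; split.
    move=> /allpairsPdep[i [x [+ + [-> ->]]]].
    by rewrite mem_iota /= => iH; have [_ e] := ndP i; move=> /e[].
  move=> [kH Ea ca]; apply/allpairsPdep; exists k, a; split => //.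
    by rewrite mem_iota.
  by have [_ e] := ndP k; apply/e.
have all_uniq : uniq all.
  rewrite sort_uniq; apply: allpairs_uniq_dep => [|i _|[i x] [j y] _ _ [-> ->]//].
    exact: iota_uniq.
  by have [] := ndP i.
have all_sorted : pairwise lev all.
  rewrite -sorted_pairwise; last by move=> x y z; exact: leq_trans.
  by apply: sort_sorted => x y; exact: leq_total.
have before u v s1 s2 : all = s1 ++ v :: s2 -> u \in all -> (u.1 < v.1)%N -> u \in s1.
  move=> e uall uv; move: uall all_sorted; rewrite e mem_cat pairwise_cat => /orP[//|us2].
  move=> /and3P[_ _]; rewrite pairwise_cons => /andP[/allP vs2 _].
  move: us2; rewrite in_cons => /orP[/eqP uE|/vs2]; first by rewrite uE ltnn in uv.
  by rewrite /lev leqNgt uv.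
have [|f [fT fP]] := @greedy_choice _ W w0 all T P all_uniq.
  move=> s1 [k b] s2 f e fT.
  have /nodeP[kH Eb cb] : (k, b) \in all by rewrite e mem_cat in_cons eqxx orbT.
  have s1P u : u \in s1 -> E u.2 /\ cl u.1 u.2 = u.2.
    case: u => i x us; suff /nodeP[] : (i, x) \in all by [].
    by rewrite e mem_cat us.
  apply: free_choice => // k' kk; apply: (before _ _ _ _ e); last by rewrite /= kk.
  apply/nodeP; split; [by rewrite ltnW// -kk|exact: cl_in|exact: cl_idem].
pose X k a := gridpt (h k) (cl k a) (f (k, cl k a)).
have node k a : (k <= H)%N -> E a -> (k, cl k a) \in all.
  by move=> kH Ea; apply/nodeP; split; [|exact: cl_in|exact: cl_idem].
have up k a : E a -> cl k (cl k.+1 a) = cl k a.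
  by move=> Ea; apply: cl_refine; [exact: cl_in| |exact: cl_idem].
have pick_before u v : u \in all -> v \in all -> (u.1 < v.1)%N -> P u v (f u) (f v).
  move=> uall vall uv.
  have [s1 [s2 e]] : exists s1 s2, all = s1 ++ v :: s2.
    by case/splitPr: vall => s1 s2; exists s1, s2.
  by apply: (fP _ _ _ _ e); exact: before e uall uv.
have pick_any u v : u \in all -> v \in all -> u != v ->
    P u v (f u) (f v) \/ P v u (f v) (f u).
  move=> uall vall uv.
  have [s1 [s2 e]] : exists s1 s2, all = s1 ++ v :: s2.
    by case/splitPr: vall => s1 s2; exists s1, s2.
  move: uall; rewrite e mem_cat in_cons (negbTE uv) /= => /orP[us1|us2].
    by left; exact: (fP _ _ _ _ e).
  have [s3 [s4 e2]] : exists s3 s4, s2 = s3 ++ u :: s4.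
    by case/splitPr: us2 => s3 s4; exists s3, s4.
  right; apply: (fP (s1 ++ v :: s3) _ s4); first by rewrite e e2 -catA.
  by rewrite mem_cat in_cons eqxx orbT.
have QE k : h k / Q%:R = Q%:R^-1 * h k by rewrite mulrC.
exists X; split.
- by move=> k a a' e; rewrite /X e.
- by move=> k a l; exact: gridpt_box.
- move=> i i' a a' l Ea Ea' ii i'H iA ne aa.
  have iH := leq_trans ii i'H.
  have near : `|cl i a - cl i' a'| <= 22 * lam * h i.
    have := cl_dist i Ea; have := cl_dist i' Ea'; have := scale_le ii => d1 d2 d3.
    have := dist_triangle a (cl i a) (cl i' a'); have := dist_triangle a' a (cl i' a').
    have : h i <= lam * h i by rewrite ler_peMl// ltW.
    by rewrite (distrC (cl i a) a); lra.
  have u := node i a iH Ea; have v := node i' a' i'H Ea'.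
  rewrite -QE; case: ne => [lt|ne].
    have [_ /(_ ii iA near l)] := pick_before _ _ u v lt.
    by rewrite distrC.
  have [lt|] := ltnP i i'.
    have [_ /(_ ii iA near l)] := pick_before _ _ u v lt.
    by rewrite distrC.
  move=> i'i; have ie : i' = i by apply/eqP; rewrite eqn_leq i'i.
  subst i'.
  have uv : (i, cl i a) != (i, cl i a').
    by apply: contra ne => /eqP[->].
  case: (pick_any _ _ u v uv) => -[_] /(_ ii iA).
    by move=> /(_ near l); rewrite distrC.
  by rewrite distrC => /(_ near l).
- move=> k a e f' sg kH Ea Ee ae; apply: contrapT => nl.
  have u := node k a (ltnW kH) Ea; have v := node k.+1 a kH Ea.
  have [/(_ erefl (up k a Ea)) + _] := pick_before _ _ u v (ltnSn k).
  rewrite inE => /asboolPn; apply; exists e, f', sg; split => //.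
    have := cl_dist k Ea; have := dist_triangle a e (cl k a); rewrite (distrC e a).
    by have := h_gt0 k; lra.
  move=> l lf; rewrite ltNge; apply/negP => le; apply: nl; exists l; split => //.
  by rewrite -QE.
Qed.

End Placement.

Lemma digits_inj (P m i j : nat) : (i < P ^ m)%N -> (j < P ^ m)%N ->
  (forall l, (l < m)%N -> (i %/ P ^ l) %% P = (j %/ P ^ l) %% P)%N -> i = j.
Proof.
elim: m i j => [|m ih] i j; first by rewrite expn0 !ltnS !leqn0 => /eqP -> /eqP ->.
rewrite expnS => iP jP d.
have P0 : (0 < P)%N by case: P iP {jP d ih} => //; rewrite mul0n.
rewrite (divn_eq i P) (divn_eq j P); congr (_ * _ + _)%N; last first.
  by have := d 0%N (ltn0Sn m); rewrite expn0 !divn1.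
apply: ih; rewrite ?ltn_divLR// 1?mulnC// => l lm.
by have := d l.+1 lm; rewrite expnS !divnMA.
Qed.

(** * Growth estimates for the constants *)

Section Constants.
Variable R : realType.

Lemma exists_nat_ge (x : R) : exists k : nat, x <= k%:R.
Proof.
exists (Num.bound `|x|); apply: (le_trans (ler_norm x)); apply: ltW.
exact: archi_boundP.
Qed.

(** Bernoulli's inequality is only linear in the exponent; squared, at [A = 2 * B.+1], it gives
    quadratic growth. *)
Lemma linear_le_exp (x K : R) : 1 < x -> exists A : nat, K * (A%:R + 1) <= x ^+ A.
Proof.
move=> x1; pose d := x - 1; have d0 : 0 < d by rewrite subr_gt0.
have bern (B : nat) : B%:R * d <= x ^+ B.
  elim: B => [|B ih]; first by rewrite mul0r expr0.
  have : 1 <= x ^+ B by rewrite exprn_ege1// ltW.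
  rewrite exprS -natr1; have -> : x = 1 + d by rewrite /d addrC subrK.
  move: ih; rewrite (_ : x = 1 + d); last by rewrite /d addrC subrK.
  by nra.
have [B Bx] := exists_nat_ge (3 * `|K| / d ^+ 2).
exists (2 * B.+1)%N; have B0 : 0 <= B%:R :> R by [].
apply: (@le_trans _ _ (`|K| * (3 * B.+1%:R))).
  have := ler_norm K; have := normr_ge0 K; rewrite natrM -natr1.
  by nra.
rewrite mulnC exprM.
have h : B.+1%:R * d <= x ^+ B.+1 by exact: bern.
apply: (@le_trans _ _ ((B.+1%:R * d) ^+ 2)); last first.
  by rewrite lerXn2r ?nnegrE// ?exprn_ge0// ?mulr_ge0//; lra.
have : 3 * `|K| <= B.+1%:R * d ^+ 2.
  rewrite -ler_pdivrMr ?exprn_gt0//; apply: (le_trans Bx).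
  by rewrite ler_nat.
rewrite exprMn expr2 mulrA => h2.
have B1 : 0 <= B.+1%:R :> R by [].
by have := ler_wpM2l B1 h2; rewrite [B.+1%:R * (_ * d)]mulrA; lra.
Qed.

(** The gap m - beta is positive, so its power of a large [P] exceeds any constant. *)
Lemma powR_le_exp (K beta : R) (m : nat) : 0 <= K -> beta < m%:R ->
  exists2 P : nat, (0 < P)%N & K * P%:R `^ beta <= P%:R ^+ m.
Proof.
move=> K0 bm; have g0 : 0 < m%:R - beta by rewrite subr_gt0.
have [P PK] := exists_nat_ge (K `^ (m%:R - beta)^-1).
exists P.+1 => //; have P0 : 0 < P.+1%:R :> R by [].
have -> : P.+1%:R ^+ m = P.+1%:R `^ (m%:R - beta) * P.+1%:R `^ beta.
  by rewrite -powRD; [rewrite subrK powR_mulrn|rewrite pnatr_eq0 implybT].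
rewrite ler_wpM2r ?powR_ge0//.
apply: (@le_trans _ _ ((K `^ (m%:R - beta)^-1) `^ (m%:R - beta))).
  by rewrite -powRrM mulVf ?gt_eqF// powRr1.
apply: ge0_ler_powR; rewrite ?nnegrE ?powR_ge0//; first exact: ltW.
by apply: (le_trans PK); rewrite ler_nat.
Qed.

End Constants.

(** * The case n > 2 *)

Section Slots.
Variables (R : realType) (n m P H : nat) (E : set 'rV[R]_n).
Variable cl : nat -> 'rV[R]_n -> 'rV[R]_n.
Implicit Types (a x : 'rV[R]_n).
Hypotheses (P0 : (0 < P)%N) (mn : (m <= n)%N).
Hypothesis cl_in : forall k a, E a -> E (cl k a).
Hypothesis cl_idem : forall k a, E a -> cl k (cl k a) = cl k a.
Hypothesis cl_refine : forall k a a', E a -> E a' ->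
  cl k.+1 a = cl k.+1 a' -> cl k a = cl k a'.
Hypothesis child_list : forall k a, E a -> exists s : seq 'rV[R]_n,
  [/\ uniq s, (size s <= P ^ m)%N &
      forall x, x \in s <-> [/\ E x, cl k.+1 x = x & cl k x = cl k a]].

(** The rank of a child among its siblings is written with [m] digits in base [P], one digit for
    each direction of the plane. *)
Lemma slots_exist : exists slot : nat -> 'rV[R]_n -> 'I_n -> nat,
  [/\ forall k a a', cl k a = cl k a' -> slot k a = slot k a',
      forall k a (l : 'I_n), ~~ (l < m)%N -> slot k a l = 0%N,
      forall k a (l : 'I_n), (slot k a l < P)%N &
      forall k a a', E a -> E a' -> cl k a = cl k a' ->
        cl k.+1 a != cl k.+1 a' -> exists l, slot k.+1 a l != slot k.+1 a' l].
Proof.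
have /choice[ch chP] (v : nat * 'rV[R]_n) : exists s : seq 'rV[R]_n, E v.2 ->
    [/\ uniq s, (size s <= P ^ m)%N &
    forall x, x \in s <-> [/\ E x, cl v.1.+1 x = x & cl v.1 x = cl v.1 v.2]].
  have [Ev|nE] := pselect (E v.2); last by exists [::].
  by have [s sP] := child_list v.1 Ev; exists s.
pose idx k a := index a (ch (k, cl k a)).
pose slot k a (l : 'I_n) := if k is k'.+1 then
  if (l < m)%N then (idx k' (cl k a) %/ P ^ l %% P)%N else 0%N else 0%N.
have up k a : E a -> cl k (cl k.+1 a) = cl k a.
  by move=> Ea; apply: cl_refine; [exact: cl_in| |exact: cl_idem].
exists slot; split.
- by move=> [|k] a a' e; apply/funext => l //; rewrite /slot e.
- by move=> [|k] a l // /negbTE lm; rewrite /slot lm.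
- by move=> [|k] a l //; rewrite /slot; case: ifP => // _; rewrite ltn_mod.
- move=> k a a' Ea Ea' ca ca1; apply: contrapT => ns.
  have Ec := cl_in k Ea; have [us sP sE] := chP (k, cl k a) Ec.
  have mem x : E x -> cl k x = cl k a -> cl k.+1 x \in ch (k, cl k a).
    move=> Ex cx; apply/sE; split; [exact: cl_in|exact: cl_idem|].
    by rewrite /= up// cx cl_idem.
  have m1 := mem a Ea erefl; have m2 := mem a' Ea' (esym ca).
  move/eqP: ca1; apply; rewrite -(nth_index a m1) -(nth_index a m2); congr nth.
  have lt x : x \in ch (k, cl k a) -> (index x (ch (k, cl k a)) < P ^ m)%N.
    by move=> xs; apply: leq_trans sP; rewrite index_mem.
  apply: digits_inj (lt _ m1) (lt _ m2) _ => l lm; apply: contrapT => /eqP ne.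
  apply: ns; exists (Ordinal (leq_trans lm mn)); rewrite /slot /= lm /idx.
  by rewrite !up// -ca.
Qed.

End Slots.

Lemma leq_near_count (n A N : nat) :
  (16 * n * (2 * A.+1).+3 * N <= 16 * n * 5 * N * A.+1)%N.
Proof.
have h : ((2 * A.+1).+3 <= 5 * A.+1)%N by lia.
have -> : (16 * n * 5 * N * A.+1 = 16 * n * (5 * A.+1) * N)%N by ring.
by rewrite leq_mul2r leq_mul2l h !orbT.
Qed.

(** [L] comes before the radius and the precision; this uniformity is what a limit needs. *)
Definition catchable (R : realType) (n : nat) (J : pred 'I_n) (E : set 'rV[R]_n) :=
  exists L : R, 1 <= L /\ forall a0 (rho eps : R), E a0 -> 0 < rho -> 0 < eps ->
  exists (p : 'rV[R]_n) (g : 'rV[R]_n -> 'rV[R]_n),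
    (forall x y, plane J p x -> plane J p y ->
      `|x - y| <= L * `|g x - g y| /\ `|g x - g y| <= L * `|x - y|) /\
    forall a, E a -> `|a - a0| <= rho ->
      exists x, plane J p x /\ `|g x - a| <= eps.

Lemma geometric_small (R : realType) (lam rho eps : R) : 2 <= lam -> 0 < rho -> 0 < eps ->
  exists H : nat, rho / lam ^+ H <= eps.
Proof.
move=> lam2 r0 e0; have [|H HP] := @linear_le_exp R lam (rho / eps); first lra.
exists H; have l0 : 0 < lam ^+ H by rewrite exprn_gt0//; lra.
rewrite ler_pdivrMr// mulrC -ler_pdivrMr//; apply: le_trans HP.
have : 0 < rho / eps by rewrite divr_gt0.
have : 0 <= H%:R :> R by [].
by nra.
Qed.

Lemma catchable_high (R : realType) (m n : nat) (E : set 'rV[R]_n) (c1 C beta : R) :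
  (2 < n)%N -> (m < n)%N -> 1 <= c1 -> 0 <= C -> 0 < beta -> beta < m%:R ->
  udisc c1 E -> covers C beta E -> catchable (fun l : 'I_n => (l < m)%N) E.
Proof.
move=> n3 mn c11 C0 b0 bm ud cE.
have K00 : 0 <= C * (240 * c1) `^ beta := mulr_ge0 C0 (powR_ge0 _ _).
(* The factor 240 is 3 * 2 * 40: with [lam] = 40 [P], a cluster has at most [P ^ m] children,
   exactly as many as there are slots. *)
have [P P0 PP] := powR_le_exp K00 bm.
pose N := (P ^ m)%N; pose lamN := (40 * P)%N; pose lam : R := lamN%:R.
have PR : 1 <= P%:R :> R by rewrite ler1n.
have lamE : lam = 40 * P%:R by rewrite /lam /lamN natrM.
have lam40 : 40 <= lam by rewrite lamE; lra.
have lam0 : 0 < lam by lra.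
have lam1 : 1 <= lam by lra.
have lam2 : 2 <= lam by lra.
have c10 : 0 < c1 by lra.
have NP (s : seq 'rV[R]_n) : (size s)%:R <= C * (3 * c1 * (2 * lam)) `^ beta -> (size s <= N)%N.
  move=> sP; rewrite -(ler_nat R) /N natrX; apply: (le_trans sP).
  apply: le_trans PP; rewrite -[C * _ * _]mulrA -powRM//; last by lra.
  by rewrite lamE (_ : 3 * c1 * (2 * (40 * P%:R)) = 240 * c1 * P%:R)//; ring.
have [N1 N1P'] := exists_nat_ge (C * (3 * c1 * (22 * lam)) `^ beta).
have N1P (s : seq 'rV[R]_n) : (size s)%:R <= C * (3 * c1 * (22 * lam)) `^ beta -> (size s <= N1)%N.
  by move=> sP; rewrite -(ler_nat R); exact: le_trans N1P'.
pose gam := n.-1%:R - beta.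
have mn1 : m%:R <= n.-1%:R :> R by rewrite ler_nat; move: mn; case: (n).
have gam0 : 0 < gam by rewrite /gam; lra.
pose K1 := (16 * N * (n * 2 ^ n) * 4 ^ n.-1)%:R * (C * (12 * lam) `^ beta).
have K10 : 0 <= K1 by rewrite mulr_ge0// mulr_ge0// powR_ge0.
pose K2 : R := (16 * n * 5 * N1)%:R.
pose K := K1 + K2 + 40 * c1.
(* With this minimum a single [A] makes both [Q = lam ^+ A] and its power of exponent [gam] large.
   The former takes care of crowding, linear in [A], the latter of the blocked pairs. *)
pose x := Num.min lam (lam `^ gam).
have lg1 : 1 < lam `^ gam.
  rewrite -[ltLHS](congr1 (@^~ gam) (@powR1 R)) /=; apply: gt0_ltr_powR; rewrite ?nnegrE//; lra.
have x1 : 1 < x by rewrite lt_min lg1 andbT; lra.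
have [A AK] := linear_le_exp K x1.
have xl : x ^+ A <= lam ^+ A.
  by apply: lerXn2r; rewrite ?nnegrE ?ge_min ?lexx//; lra.
have xg : x ^+ A <= (lam `^ gam) ^+ A.
  by apply: lerXn2r; rewrite ?nnegrE ?ge_min ?lexx ?orbT//; lra.
have A0 : 0 <= A%:R :> R by [].
have K20 : 0 <= K2 by [].
pose Q := (lamN ^ A)%N.
have QE : Q%:R = lam ^+ A by rewrite /Q natrX.
have Q0 : (0 < Q)%N by rewrite expn_gt0 muln_gt0 P0.
have QR : 0 < Q%:R :> R by rewrite ltr0n.
have Q1 : 1 <= Q%:R :> R by rewrite ler1n.
have AA : 1 <= A%:R + 1 :> R by lra.
have Qg : (lam `^ gam) ^+ A = Q%:R `^ gam.
  by rewrite -powR_mulrn ?powR_ge0// powRAC powR_mulrn ?QE//; lra.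
rewrite Qg in xg; rewrite -QE in xl.
have K1Q : K1 <= Q%:R `^ gam by apply: le_trans xg; apply: le_trans AK; rewrite /K; nra.
have K2Q : K2 * (A%:R + 1) <= Q%:R by apply: le_trans xl; apply: le_trans AK; rewrite /K; nra.
have c1Q : 40 * c1 <= Q%:R by apply: le_trans xl; apply: le_trans AK; rewrite /K; nra.
have n0 : (0 < n)%N by apply: leq_ltn_trans mn.
have QnE : (Q ^ n = Q * Q ^ n.-1)%N by rewrite -expnS prednK.
have BP (B : nat) : B%:R <= C * (12 * lam * Q%:R) `^ beta ->
    (16 * N * (B * (n * 2 ^ n) * (Q * 4 ^ n.-1 * Q ^ n)) <= Q ^ n * Q ^ n)%N.
  move=> BC; pose c := (16 * N * (n * 2 ^ n) * 4 ^ n.-1)%N.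
  have -> : (16 * N * (B * (n * 2 ^ n) * (Q * 4 ^ n.-1 * Q ^ n)) =
      Q * (c * B) * Q ^ n)%N by rewrite /c; ring.
  rewrite leq_mul2r; apply/orP; right.
  rewrite QnE leq_mul2l; apply/orP; right.
  rewrite -(ler_nat R) natrM natrX -powR_mulrn//.
  have -> : n.-1%:R = gam + beta by rewrite /gam subrK.
  rewrite powRD; last by rewrite (gt_eqF QR) implybT.
  apply: (@le_trans _ _ (K1 * Q%:R `^ beta)); last by rewrite ler_wpM2r ?powR_ge0.
  rewrite /K1 -/c -mulrA ler_wpM2l// -mulrA -powRM ?mulr_ge0//; lra.
have QP : (16 * n * (2 * A.+1).+3 * N1 * Q ^ n.-1 <= Q ^ n)%N.
  rewrite QnE leq_mul2r; apply/orP; right.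
  rewrite -(ler_nat R); apply: le_trans K2Q.
  by rewrite /K2 natr1 -natrM ler_nat; exact: leq_near_count.
pose eta : R := Q%:R^-1.
pose e := (2 * A.+1).+2.
(* Tubes of one level are thus thin even against [eta] times the scale [e] levels deeper, the far
   end of the window of compared corners. *)
pose b := eta / (100 * c1 * lam ^+ e).
have eta0 : 0 < eta by rewrite invr_gt0.
have eta1 : eta <= 1 by rewrite invf_le1.
have le0 : 0 < lam ^+ e by rewrite exprn_gt0.
have le1 : 1 <= lam ^+ e by rewrite exprn_ege1.
have d0 : 0 < 100 * c1 by rewrite mulr_gt0.
have b_gt0 : 0 < b := divr_gt0 eta0 (mulr_gt0 d0 le0).
have [T TP] := exists_nat_ge (5 * lam / b).
have T0 : (0 < T)%N.
  by rewrite -(ltr_nat R); apply: lt_le_trans TP; rewrite divr_gt0// mulr_gt0.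
pose M : R := (2 ^+ T) ^+ n.+2.
pose Kc : R := M ^+ N * (2 * (lam * lam) / b + 1).
have M1 : 1 <= M by rewrite exprn_ege1// exprn_ege1// ler1n.
have MN1 : 1 <= M ^+ N by rewrite exprn_ege1.
exists (M ^+ N * Kc); split.
  rewrite mulr_ege1// /Kc mulr_ege1//.
  have l0 := ltW lam0.
  rewrite lerDr; apply: divr_ge0; last exact: ltW.
  by apply: mulr_ge0 => //; apply: mulr_ge0.
move=> a0 rho eps Ea0 rho0 eps0.
pose h k := rho / lam ^+ k.
have lk0 k : 0 < lam ^+ k by rewrite exprn_gt0.
have h0 k : 0 < h k by rewrite divr_gt0.
have hD k j : h k = lam ^+ j * h (k + j)%N.
  by rewrite /h exprD; field; rewrite !gt_eqF.
have hS k : h k = lam * h k.+1 by rewrite (hD k 1%N) expr1 addn1.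
have e40 : 0 < eps / 4 by rewrite divr_gt0.
have [H HP] := geometric_small lam2 rho0 e40.
pose E0 := E `&` [set a | `|a - a0| <= rho].
have E0E : E0 `<=` E by move=> a [].
have E0a0 : E0 a0 by split => //=; rewrite subrr normr0 ltW.
have ud0 := udisc_sub E0E ud; have cE0 := covers_sub E0E cE.
have h_dec k : h k.+1 <= h k by rewrite (hS k) ler_peMl// ltW.
have h00 : h 0 = rho by rewrite /h expr0 divr1.
have E0h a : E0 a -> `|a - a0| <= h 0 by move=> [_]; rewrite h00.
have [cl [cl0 [cl_in cl_dist cl_idem cl_refine cl_sep]]] := clusters_exist ud0 E0a0 h0 h_dec E0h.
have [X [X_cl X_box X_sep X_avoid]] := placement H cE0 lam1 c11 Q0 h0 hS E0h
  cl_in cl_dist cl_idem cl_refine cl_sep NP N1P BP QP.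
have chl := child_list cE0 lam1 c11 h0 hS cl_dist cl_sep NP.
have [slot [slot_cl slotJ slot_lt slot_inj]] :=
  slots_exist P0 (ltnW mn) cl_in cl_idem cl_refine chl.
have ne1 : (0 != n.-1)%N by move: n3; clear; case: n => [|[|]].
have ne2 : (1 != n.-1)%N by move: n3; clear; case: n => [|[|[|]]].
have mn' : (m <= n.-1)%N by move: mn; clear; case: n.
pose e1 : 'I_n := Ordinal (leq_ltn_trans (leq0n m) mn).
pose e2 : 'I_n := Ordinal (ltnW n3).
have nn : (n.-1 < n)%N by rewrite prednK.
pose top : 'I_n := Ordinal nn.
(* The window parameter is [A.+1], one more than the exponent in [Q]: the surplus factor [lam >= 40]
   is what [rt_hA2] asks for. *)
have D : routing (fun l : 'I_n => (l < m)%N) e1 e2 top lam b eta c1 A.+1 H h E0 cl X slot.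
  split => //.
  - by rewrite /= -leqNgt.
  - move=> k; rewrite (hD k.+1 A) addSnnS.
    by rewrite ler_pM2r// -QE.
  - move=> k; rewrite (hD k A.+1) exprS -QE /eta mulrA ler_pM2r//.
    by rewrite mulrCA mulVf ?mulr1// gt_eqF.
  - move=> k; rewrite (hD k e) /b.
    have -> : 100 * (eta / (100 * c1 * lam ^+ e) * (lam ^+ e * h (k + e)%N)) =
      eta / c1 * h (k + e)%N by field; rewrite !gt_eqF.
    by rewrite ler_pM2r// ler_pdivrMr// ler_peMr// ltW.
  - rewrite /b; have -> : 100 * (eta / (100 * c1 * lam ^+ e)) * c1 = eta / lam ^+ e.
      by field; rewrite !gt_eqF.
    by rewrite ler_pdivrMr// mul1r; exact: le_trans eta1 le1.
  - move=> k a l; rewrite (hS k) lamE.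
    have sl : (slot k.+1 a l)%:R <= P%:R :> R by rewrite ler_nat ltnW.
    have bh : 0 < b * h k.+1 by rewrite mulr_gt0.
    have -> : b * (40 * P%:R * h k.+1) = 40 * (b * h k.+1) * P%:R by ring.
    by rewrite ler_wpM2l// mulr_ge0// ltW.
have Tb : 5 * lam <= T%:R * b by rewrite -ler_pdivrMr.
have heps : 4 * h H <= eps by move: HP; rewrite -/(h H); lra.
have chl' k a : E0 a -> (k < H)%N -> _ := fun Ea _ => chl k a Ea.
have [g [_ _ g3 _ g5]] := routed_catches D T0 Tb chl' heps (leq0n H) E0a0.
exists (X 0 a0), g; split; first exact: g3.
move=> a Ea aa; have [|z [pz _ ze]] := g5 a; last by exists z.
by split; [split|rewrite !cl0].
Qed.

(** * The case n = 2 *)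

Section PlaneBasics.
Variable R : realType.
Implicit Types (x y : 'rV[R]_2).
Let i0 : 'I_2 := ord0.
Let i1 : 'I_2 := ord_max.

Definition pt2 (u v : R) : 'rV[R]_2 := \row_l (if l == i0 then u else v).

Lemma pt2_0 u v : pt2 u v ord0 i0 = u. Proof. by rewrite mxE. Qed.
Lemma pt2_1 u v : pt2 u v ord0 i1 = v. Proof. by rewrite mxE. Qed.

Lemma ord2P (l : 'I_2) : l = i0 \/ l = i1.
Proof. by case: l => -[|[|//]] p; [left|right]; exact: val_inj. Qed.

Lemma near2 x y c : `|x - y| < c ->
  [/\ y ord0 i0 - c < x ord0 i0, x ord0 i0 < y ord0 i0 + c,
      y ord0 i1 - c < x ord0 i1 & x ord0 i1 < y ord0 i1 + c].
Proof.
move=> xy; have := le_lt_trans (coordB_le_norm x y i0) xy.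
have := le_lt_trans (coordB_le_norm x y i1) xy; rewrite !ltr_distl.
by move=> /andP[? ?] /andP[? ?]; split.
Qed.

Lemma norm2_le x y c : y ord0 i0 - c <= x ord0 i0 -> x ord0 i0 <= y ord0 i0 + c ->
  y ord0 i1 - c <= x ord0 i1 -> x ord0 i1 <= y ord0 i1 + c -> `|x - y| <= c.
Proof.
move=> h1 h2 h3 h4; apply/row_norm_leP => [|l]; first by lra.
by rewrite coordB; case: (ord2P l) => ->; rewrite ler_distl; apply/andP.
Qed.

Lemma norm2_le_box x y u v c :
  u <= x ord0 i0 <= u + c -> u <= y ord0 i0 <= u + c ->
  v <= x ord0 i1 <= v + c -> v <= y ord0 i1 <= v + c -> `|x - y| <= c.
Proof.
move=> /andP[? ?] /andP[? ?] /andP[? ?] /andP[? ?].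
by apply: norm2_le; lra.
Qed.

Lemma segm2 x y z : segm x y z ->
  (x ord0 i0 = y ord0 i0 -> x ord0 i1 <= y ord0 i1 ->
     z ord0 i0 = x ord0 i0 /\ x ord0 i1 <= z ord0 i1 <= y ord0 i1) /\
  (x ord0 i1 = y ord0 i1 -> x ord0 i0 <= y ord0 i0 ->
     z ord0 i1 = x ord0 i1 /\ x ord0 i0 <= z ord0 i0 <= y ord0 i0).
Proof.
move=> s; have [a1 [a2 _]] := segm_coord i0 s; have [b1 [b2 _]] := segm_coord i1 s.
by split=> e1 e2; split; auto.
Qed.

End PlaneBasics.

Section Cuts.
Variables (R : realType) (n : nat) (E : set 'rV[R]_n) (C beta : R).

(** Pigeonhole: the [M] candidates are [4 * w] apart, so each point of a covering at scale [w]
    spoils at most one of them, and there are fewer than [M] such points. *)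
Lemma free_cut (S : set 'rV[R]_n) (a : 'rV[R]_n) (l : 'I_n) (h w tau : R) (M : nat) :
  covers C beta E -> S `<=` E -> 0 < w -> w <= h ->
  (forall x, S x -> `|x - a| <= h) -> C * (h / w) `^ beta < M%:R ->
  exists t, [/\ tau <= t, t <= tau + 4 * w * M%:R &
    forall x, S x -> w <= `|x ord0 l - t|].
Proof.
move=> cE SE w0 wh Sa CM; have h0 : 0 < h by exact: lt_le_trans wh.
have [|P [sP PP]] := cE a h (h / w) h0; first by rewrite ler_pdivlMr// mul1r.
have hw : h / (h / w) = w by field; rewrite !gt_eqF.
have PM : (size P < M)%N by rewrite -(ltr_nat R); exact: le_lt_trans CM.
apply: contrapT => nt.
have kill (j : 'I_M) : exists i : 'I_(size P),
    `|tau + 4 * w * j%:R - (P`_i) ord0 l| < 2 * w.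
  apply: contrapT => nk; apply: nt; exists (tau + 4 * w * j%:R).
  have jM : j%:R <= M%:R :> R by rewrite ler_nat ltnW.
  have j0 : 0 <= j%:R :> R by [].
  split=> [||x Sx]; [nra|nra|].
  rewrite leNgt; apply/negP => xt; apply: nk.
  have [p pP] := PP x (SE _ Sx) (Sa x Sx); rewrite hw => xp.
  have ip : (index p P < size P)%N by rewrite index_mem.
  exists (Ordinal ip); rewrite nth_index//.
  have := ler_normD (tau + 4 * w * j%:R - x ord0 l) (x ord0 l - p ord0 l).
  rewrite addrA subrK (distrC _ (x ord0 l)); have := coordB_le_norm x p l; lra.
have /choice[f fP] := kill.
have : injective f.
  move=> i j fij; have := fP i; have := fP j; rewrite fij => h1 h2.
  apply: contrapT => /eqP; rewrite -val_eqE neq_ltn => /orP ij.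
  move: h1 h2; rewrite !ltr_distl => /andP[h1 h2] /andP[h3 h4].
  case: ij => ij.
    have : (i : nat)%:R + 1 <= (j : nat)%:R :> R by rewrite natr1 ler_nat.
    by rewrite -subr_ge0 => /(mulr_ge0 (ltW w0)); lra.
  have : (j : nat)%:R + 1 <= (i : nat)%:R :> R by rewrite natr1 ler_nat.
  by rewrite -subr_ge0 => /(mulr_ge0 (ltW w0)); lra.
by move=> /leq_card; rewrite !card_ord leqNgt PM.
Qed.

(* Successive cuts, between which the points of S are sorted into cells. *)
Lemma cuts_exist (S : set 'rV[R]_n) (a : 'rV[R]_n) (l : 'I_n) (h w s base : R)
    (M B : nat) :
  covers C beta E -> S `<=` E -> 0 < w -> w <= h ->
  (forall x, S x -> `|x - a| <= h) -> C * (h / w) `^ beta < M%:R ->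
  4 * w * M%:R <= s / 2 -> 0 < s ->
  (forall x, S x -> base + w <= x ord0 l /\ x ord0 l <= base + B%:R * s) ->
  exists (t : nat -> R) (c : 'rV[R]_n -> nat), [/\ t 0%N = base,
    forall i, base + i%:R * s <= t i <= base + i%:R * s + s / 2,
    forall i, t i + s / 2 <= t i.+1 <= t i + 3 / 2 * s &
    forall x, S x -> [/\ (c x < B)%N, t (c x) + w <= x ord0 l & x ord0 l <= t (c x).+1 - w]].
Proof.
move=> cE SE w0 wh Sa CM Ms s0 Sb.
have /choice[t' t'P] (i : nat) : exists t, [/\ base + i%:R * s <= t,
    t <= base + i%:R * s + 4 * w * M%:R & forall x, S x -> w <= `|x ord0 l - t|].
  exact: (free_cut _ _ cE SE w0 wh Sa CM).
(* The first cut is [base] itself, which is free since [S] stays [w] above it. *)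
pose t i := if i is 0%N then base else t' i.
have tb i : base + i%:R * s <= t i <= base + i%:R * s + s / 2.
  case: i => [|i]; first by rewrite /= mul0r addr0; apply/andP; lra.
  by have [h1 h2 _] := t'P i.+1; apply/andP; split => //=; lra.
have tS i : t i + s / 2 <= t i.+1 <= t i + 3 / 2 * s.
  case: i => [|i].
    have [h1 h2 _] := t'P 1%N; rewrite /=; move: h1 h2; rewrite mul1r => h1 h2.
    by apply/andP; lra.
  have /andP[h1 h2] := tb i.+1; have /andP[h3 h4] := tb i.+2.
  by move: h3 h4; rewrite -[i.+2%:R]natr1 mulrDl mul1r => h3 h4; apply/andP; lra.
have free x i : S x -> w <= `|x ord0 l - t i|.
  case: i => [|i] Sx; last by have [_ _ h3] := t'P i.+1; exact: h3.
  by have [h1 _] := Sb x Sx; rewrite /= ger0_norm; lra.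
pose c (x : 'rV[R]_n) := find (fun i => x ord0 l <= t i.+1) (iota 0 B).
exists t, c; split => // x Sx; have [x1 x2] := Sb x Sx.
have B0 : (0 < B)%N.
  by case: (B) x2 => // ; rewrite mul0r; lra.
have hasx : has (fun i => x ord0 l <= t i.+1) (iota 0 B).
  apply/hasP; exists B.-1; first by rewrite mem_iota /= add0n ltn_predL.
  by rewrite prednK//; have /andP[h1 _] := tb B; lra.
have cB : (c x < B)%N by move: hasx; rewrite has_find size_iota.
have cn : nth 0%N (iota 0 B) (c x) = c x by rewrite nth_iota// add0n.
split => //.
  have ct : t (c x) <= x ord0 l.
    case E1: (c x) => [|i]; first by rewrite /=; lra.
    have ic : (i < c x)%N by rewrite E1.
    have := before_find 0%N ic; rewrite nth_iota ?(ltn_trans ic cB)// add0n.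
    by move/negbT; rewrite -ltNge => /ltW.
  by have := free x (c x) Sx; rewrite ger0_norm; lra.
have xt : x ord0 l <= t (c x).+1.
  by have := nth_find 0%N hasx; rewrite -/(c x) cn.
by have := free x (c x).+1 Sx; rewrite ler0_norm; lra.
Qed.

End Cuts.

Section Planar.
Variables (R : realType) (E : set 'rV[R]_2) (C beta : R) (lamN M N T : nat).
Implicit Types (x y z al om p : 'rV[R]_2) (S : set 'rV[R]_2).
Local Notation X x := (x ord0 (ord0 : 'I_2)).
Local Notation Y x := (x ord0 (ord_max : 'I_2)).
Let lam : R := lamN%:R.
Let mu : R := (8 * M%:R)^-1.
(** The value 320 makes the drop of [level] from one column to the next equal to 40 tube widths
    [b * h']. *)
Let b : R := mu / (320 * lam).
Let J : pred 'I_2 := fun l => (l < 1)%N.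

Hypotheses (cE : covers C beta E) (lam40 : 40 <= lam) (M0 : (0 < M)%N).
Hypothesis CM : C * (16 * lam * M%:R) `^ beta < M%:R.
Hypothesis CN : forall k : nat, k%:R <= C * (12 * lam) `^ beta -> (4 * k <= N)%N.
Hypothesis Nlam : 20 * N%:R <= lam.
Hypotheses (T0 : (0 < T)%N) (Tb : 2 * lam <= T%:R * b).

(** [al] and [om] are opposite corners of a box in which [S] keeps a margin [mu * h]; the plane
    enters at [p], in the lower left corner of this margin. *)
Definition frame (h : R) al om p S :=
  [/\ S `<=` E,
      forall x l, S x -> al ord0 l + mu * h <= x ord0 l <= om ord0 l - mu * h,
      forall l, om ord0 l <= al ord0 l + 3 / 2 * h,
      X p = X al + mu * h / 4 & Y al + mu * h / 4 <= Y p <= Y al + mu * h / 2].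

(** Not above the height of [p] the room is only a small cube around [p], so that this part lies
    inside the rigidly moved cube. *)
Definition room (h : R) al om p : set 'rV[R]_2 := [set x : 'rV[R]_2 |
  [/\ X al + mu * h / 8 < X x, X x < X om - mu * h / 8, Y p < Y x &
      Y x < Y om - mu * h / 8] \/ `|x - p| < 2 * (b * h)].

Let mu_gt0 : 0 < mu.
Proof. by rewrite invr_gt0 mulr_gt0 ?ltr0n. Qed.

Let mu_le : mu <= 1 / 8.
Proof.
have MR : 1 <= M%:R :> R by rewrite ler1n.
by rewrite /mu div1r lef_pV2 ?posrE ?mulr_gt0//; lra.
Qed.

Let muM : 8 * mu * M%:R = 1.
Proof. by rewrite /mu; field; rewrite pnatr_eq0 -lt0n. Qed.

Let bE : 320 * (lam * b) = mu.
Proof. by rewrite /b; field; have := lam40; move=> ?; rewrite gt_eqF//; lra. Qed.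

Let b_gt0 : 0 < b.
Proof.
have l0 : 0 < 320 * lam by have := lam40; lra.
exact: (divr_gt0 mu_gt0 l0).
Qed.

Let Mp : R := (2 ^+ T) ^+ 2.
Let K : R := Mp ^+ N * (2 * lam / b + 1).

Section Step.
Variables (h h' : R) (al om p : 'rV[R]_2) (S : set 'rV[R]_2).
Variables (tx ty : nat -> R) (cx cy : 'rV[R]_2 -> nat).
Hypotheses (h'0 : 0 < h') (hE : h = lam * h') (fr : frame h al om p S).
Let w := mu * h'.
Let B := b * h'.
Hypothesis tx0 : tx 0%N = X al + 3 / 4 * (mu * h).
Hypothesis ty0 : ty 0%N = Y al + 3 / 4 * (mu * h).
Hypothesis txS : forall i, tx i + h' / 2 <= tx i.+1 <= tx i + 3 / 2 * h'.
Hypothesis tyS : forall i, ty i + h' / 2 <= ty i.+1 <= ty i + 3 / 2 * h'.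
Hypothesis cxP : forall x, S x -> [/\ (cx x < 2 * lamN)%N, tx (cx x) + w <= X x &
  X x <= tx (cx x).+1 - w].
Hypothesis cyP : forall x, S x -> [/\ (cy x < 2 * lamN)%N, ty (cy x) + w <= Y x &
  Y x <= ty (cy x).+1 - w].

Let B_gt0 : 0 < B. Proof. by rewrite mulr_gt0. Qed.
Let wB : w = 320 * (b * h).
Proof. by rewrite /w -bE hE; ring. Qed.
Let bhB : b * h = lam * B.
Proof. by rewrite hE mulrCA. Qed.
Let muh : mu * h = lam * w.
Proof. by rewrite hE mulrCA. Qed.
Let w_gt0 : 0 < w. Proof. by rewrite mulr_gt0. Qed.
Let bh40 : 40 * B <= b * h.
Proof. by rewrite bhB ler_wpM2r// ltW. Qed.
Let muh40 : 40 * w <= mu * h.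
Proof. by rewrite muh ler_wpM2r// ltW. Qed.
Let wh' : w <= h' / 8.
Proof. by have := ler_wpM2r (ltW h'0) mu_le; rewrite /w; lra. Qed.

Let tmono (t : nat -> R) : (forall i, t i + h' / 2 <= t i.+1 <= t i + 3 / 2 * h') ->
  forall i j, (i <= j)%N -> t i <= t j.
Proof.
move=> tS i j /subnK <-; elim: (j - i)%N => [|k ih]; first by rewrite add0n.
by rewrite addSn; have /andP[h1 _] := tS (k + i)%N; have := h'0; lra.
Qed.

(* The heights decrease along each row of cells, so that the horizontal part
   of a route passes below the cells it does not lead to. *)
Definition level (i : nat * nat) : R :=
  ty i.2 + w / 4 * (2 - i.1%:R / (2 * lam)).

Definition door (i : nat * nat) := pt2 (tx i.1 + w / 4) (level i).

Definition full (i : nat * nat) := exists x, S x /\ (cx x, cy x) = i.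

(** Sorted by decreasing level, and slots are handed out from left to right in this order: the
    vertical pieces that a horizontal piece passes on its way to the right end below it. *)
Definition cells := sort (fun i j => level j <= level i)
  [seq i <- [seq (c, r) | c <- iota 0 (2 * lamN), r <- iota 0 (2 * lamN)] | `[< full i >]].

Definition corner (i : nat * nat) := pt2 (tx i.1) (ty i.2).
(** The last cells may stick out of the parent's box; the minimum cuts them back while keeping the
    margin around [S]. *)
Definition far_corner (i : nat * nat) :=
  pt2 (Num.min (tx i.1.+1) (X om - mu * h / 2)) (Num.min (ty i.2.+1) (Y om - mu * h / 2)).

(** As [20 * N <= lam], all slots fit within [b * h] to the right of [p]. *)
Definition slot_start (i : nat * nat) := pt2 (X p + 20 * B * (index i cells)%:R) (Y p).

Definition comb (i : nat * nat) := [:: pt2 (X (slot_start i)) (level i); door i].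

Lemma cells_uniq : uniq cells.
Proof.
rewrite sort_uniq filter_uniq// allpairs_uniq ?iota_uniq//.
by move=> [u v] [u' v'].
Qed.

Lemma cellsP i : i \in cells <-> full i.
Proof.
rewrite mem_sort mem_filter; split => [/andP[/asboolP]//|fi].
apply/andP; split; first exact/asboolP.
case: fi => x [Sx <-]; have [h1 _ _] := cxP Sx; have [h2 _ _] := cyP Sx.
by apply/allpairsP; exists (cx x, cy x); rewrite !mem_iota.
Qed.

Lemma cell_bounds i : i \in cells -> [/\ i.1%:R < 2 * lam,
  [/\ X al + 3 / 4 * (mu * h) <= tx i.1, tx i.1 + w + mu * h <= X om &
      tx i.1 + 2 * w <= tx i.1.+1] &
  [/\ Y al + 3 / 4 * (mu * h) <= ty i.2, ty i.2 + w + mu * h <= Y om &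
      ty i.2 + 2 * w <= ty i.2.+1]].
Proof.
move=> /cellsP[x [Sx <-]] /=; have [c1 c2 c3] := cxP Sx; have [d1 d2 d3] := cyP Sx.
have [_ Sb _ _ _] := fr.
have /andP[_ x1] := Sb x (ord0 : 'I_2) Sx; have /andP[_ y1] := Sb x (ord_max : 'I_2) Sx.
have := tmono txS (leq0n (cx x)); have := tmono tyS (leq0n (cy x)).
rewrite tx0 ty0 => m1 m2.
have c1R : (cx x)%:R < 2 * lam :> R by rewrite /lam -natrM ltr_nat.
by split; [|split|split]; lra.
Qed.

Lemma level_bounds i : i \in cells -> ty i.2 + w / 4 <= level i <= ty i.2 + w / 2.
Proof.
move=> /cell_bounds[c _ _]; rewrite /level; have l0 : 0 < 2 * lam by have := lam40; lra.
have r0 : 0 <= i.1%:R / (2 * lam) by rewrite divr_ge0// ltW.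
have r1 : i.1%:R / (2 * lam) <= 1 by rewrite ler_pdivrMr// mul1r ltW.
have := w_gt0; set r := _ / _ in r0 r1 * => w0.
by have := mulr_ge0 (ltW w0) r0; have := ler_wpM2l (ltW w0) r1; rewrite !mulr1;
  move=> *; apply/andP; split; lra.
Qed.

Lemma level_row i j : i.2 = j.2 -> (i.1 < j.1)%N -> level j + 40 * B <= level i.
Proof.
move=> e lt; rewrite /level e.
have l0 : 0 < lam by have := lam40; lra.
have wl : w = 320 * lam * B by rewrite /w /B -bE; ring.
have -> : w / 4 * (2 - j.1%:R / (2 * lam)) = w / 2 - 40 * B * j.1%:R.
  by rewrite wl; field; rewrite gt_eqF.
have -> : w / 4 * (2 - i.1%:R / (2 * lam)) = w / 2 - 40 * B * i.1%:R.
  by rewrite wl; field; rewrite gt_eqF.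
have : i.1%:R + 1 <= j.1%:R :> R by rewrite natr1 ler_nat.
by rewrite -subr_ge0 => /(mulr_ge0 (ltW B_gt0)); lra.
Qed.

Lemma level_rows i j : i \in cells -> j \in cells -> (i.2 < j.2)%N ->
  level i + h' / 4 <= level j.
Proof.
move=> ic jc lt; have /andP[_ a1] := level_bounds ic; have /andP[a2 _] := level_bounds jc.
have := tmono tyS lt; have /andP[a3 _] := tyS i.2; have := wh'; have := w_gt0; lra.
Qed.

Lemma level_sep i j : i \in cells -> j \in cells -> i != j ->
  level j + 40 * B <= level i \/ level i + 40 * B <= level j.
Proof.
move=> ic jc ne; have := wh'; have := wB; have := bh40; have := B_gt0 => b0 bh wb ww.
have [lt|lt|e] := ltngtP i.2 j.2.
- by right; have := level_rows ic jc lt; lra.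
- by left; have := level_rows jc ic lt; lra.
- have [lt|lt|e1] := ltngtP i.1 j.1.
  + by left; exact: level_row.
  + by right; exact: level_row.
  + by move: ne; rewrite (surjective_pairing i) (surjective_pairing j) e e1 eqxx.
Qed.

Lemma rank_sep i j : i \in cells -> j \in cells -> level j + 40 * B <= level i ->
  (index i cells < index j cells)%N.
Proof.
move=> ic jc ij; rewrite ltnNge; apply/negP => ji.
have srt : sorted (fun i j => level j <= level i) cells.
  by apply: sort_sorted => u v; exact: le_total.
have tr : transitive (fun i j => level j <= level i).
  by move=> u v z /= h1 h2; exact: le_trans h2 h1.
have rf : reflexive (fun i j => level j <= level i) by move=> u /=; exact: lexx.
have := sorted_leq_nth tr rf (0, 0)%N srt; move=> /(_ (index j cells) (index i cells)).
rewrite !inE !index_mem => /(_ jc ic ji); rewrite !nth_index//.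
by have := B_gt0; lra.
Qed.

Lemma start_bounds i : i \in cells -> (size cells <= N)%N ->
  X p <= X (slot_start i) <= X p + b * h /\ Y (slot_start i) = Y p.
Proof.
move=> ic sN; rewrite pt2_0 pt2_1; split => //; have := B_gt0 => b0.
have r0 : 0 <= (index i cells)%:R :> R by [].
have rN : (index i cells)%:R <= N%:R :> R.
  by rewrite ler_nat; apply: leq_trans sN; rewrite ltnW// index_mem.
have h1 : 20 * (index i cells)%:R <= lam by have := Nlam; lra.
have := ler_wpM2l (ltW b0) h1; have := mulr_ge0 (ltW b0) r0.
rewrite bhB [lam * B]mulrC => *; apply/andP; split; lra.
Qed.

Lemma door_after_start i : i \in cells -> (size cells <= N)%N ->
  [/\ X (slot_start i) + w <= X (door i), Y p + w <= level i &
     X p = X al + mu * h / 4].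
Proof.
move=> ic sN; have [_ [x1 _ _] [y1 _ _]] := cell_bounds ic.
have /andP[l1 _] := level_bounds ic; have [/andP[_ s1] _] := start_bounds ic sN.
have [_ _ _ px /andP[_ py]] := fr; rewrite [X (door i)]pt2_0 px.
by have := muh40; have := wB; have := w_gt0; rewrite px in s1; split => //; lra.
Qed.

Lemma comb_cases i z : i \in cells -> (size cells <= N)%N ->
  trail (slot_start i) (comb i) z ->
  (X z = X (slot_start i) /\ Y p <= Y z <= level i) \/
  (Y z = level i /\ X (slot_start i) <= X z <= X (door i)).
Proof.
move=> ic sN; have [d1 d2 _] := door_after_start ic sN.
have [_ ys] := start_bounds ic sN; have := w_gt0 => w0.
rewrite /comb; set q := pt2 _ (level i).
have q0 : X q = X (slot_start i) by rewrite pt2_0.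
have q1 : Y q = level i by rewrite pt2_1.
have dy : Y (door i) = level i by rewrite pt2_1.
case=> [/segm2[+ _]|[/segm2[_ +]|->]].
- rewrite q0 q1 ys => /(_ erefl) [|e1 e2]; first by lra.
  by left.
- rewrite q0 q1 dy => /(_ erefl) [|e1 e2]; first by lra.
  by right.
- right; rewrite dy; split => //; apply/andP; split; lra.
Qed.

Lemma room_in_cell i x : i \in cells ->
  room h' (corner i) (far_corner i) (door i) x ->
  [/\ tx i.1 + w / 8 < X x, X x < tx i.1.+1 - w / 8 & X x < X om - mu * h / 2] /\
  [/\ level i - 2 * B < Y x, Y x < ty i.2.+1 - w / 8 & Y x < Y om - mu * h / 2].
Proof.
move=> ic; have [_ [x1 x2 x3] [y1 y2 y3]] := cell_bounds ic.
have /andP[l1 l2] := level_bounds ic; have := muh40; have := wB; have := w_gt0.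
have := bh40; have := B_gt0 => b0 bh w0 wb mh.
rewrite /room /= -/w -/B !pt2_0 !pt2_1.
case=> [[h1 h2 h3 h4]|/near2]; last by rewrite !pt2_0 !pt2_1 => -[h1 h2 h3 h4]; split; split; lra.
move: h2 h4; set a := Num.min _ _; set c := Num.min _ _ => h2 h4.
have a1 : a <= tx i.1.+1 by rewrite ge_min lexx.
have a2 : a <= X om - mu * h / 2 by rewrite ge_min lexx orbT.
have c1 : c <= ty i.2.+1 by rewrite ge_min lexx.
have c2 : c <= Y om - mu * h / 2 by rewrite ge_min lexx orbT.
by split; split; lra.
Qed.

(** Between two distinct strips of the same parity lies a whole strip, of width at least
    [h' / 2]. *)
Lemma same_cell (t : nat -> R) (u v : nat) (c d : R) :
  (forall i, t i + h' / 2 <= t i.+1 <= t i + 3 / 2 * h') ->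
  odd u = odd v -> t u + w <= c -> c <= t u.+1 - w -> t v + w <= d -> d <= t v.+1 - w ->
  `|c - d| <= h' / 4 -> u = v.
Proof.
move=> tS.
have far u' v' : odd u' = odd v' -> (u' < v')%N -> t u'.+1 + h' / 2 <= t v'.
  move=> oo lt; have /andP[h1 _] := tS u'.+1; apply: le_trans h1 _; apply: tmono => //.
  rewrite ltn_neqAle lt andbT; apply/eqP => e.
  by move: oo; rewrite -e /=; case: odd.
move=> o cu cu' dv dv'; rewrite ler_distl => /andP[cd dc]; have := h'0; have := w_gt0.
have [lt|lt|//] := ltngtP u v => w0 hh.
  by exfalso; have := far _ _ o lt; lra.
by exfalso; have := far _ _ (esym o) lt; lra.
Qed.

(** By [same_cell], a cell is determined by a covering point within [h' / 8] of it and the two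
    parities of its indices, whence the factor 4. *)
Lemma cells_size : (size cells <= N)%N.
Proof.
have [SE Sb wd _ _] := fr; have h0 : 0 < h by rewrite hE mulr_gt0//; have := lam40; lra.
have mh0 : 0 < mu * h by rewrite mulr_gt0.
have lam4 := lam40.
have [||P [sP PP]] := @cE al (3 / 2 * h) (12 * lam); [lra|lra|].
have rE : 3 / 2 * h / (12 * lam) = h' / 8.
  by rewrite hE; field; rewrite gt_eqF//; lra.
rewrite rE in PP; apply: leq_trans (CN sP).
have /choice[f fP] i : exists k, i \in cells -> (k < size P)%N /\
    exists x, [/\ S x, (cx x, cy x) = i & `|x - P`_k| <= h' / 8].
  have [/cellsP[x [Sx xi]]|_] := boolP (i \in cells); last by exists 0%N.
  have xa : `|x - al| <= 3 / 2 * h.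
    have /andP[x1 x2] := Sb x (ord0 : 'I_2) Sx; have /andP[y1 y2] := Sb x (ord_max : 'I_2) Sx.
    by have := wd (ord0 : 'I_2); have := wd (ord_max : 'I_2) => *; apply: norm2_le; lra.
  have [q qP xq] := PP x (SE _ Sx) xa; exists (index q P) => _.
  by rewrite index_mem; split => //; exists x; rewrite nth_index.
pose phi i := ((f i, odd i.1), odd i.2).
pose codes := [seq (u, v) | u <- [seq (u, v) | u <- iota 0 (size P), v <- [:: true; false]],
  v <- [:: true; false]].
have -> : (4 * size P = size codes)%N by rewrite !size_allpairs size_iota /= -mulnA mulnC.
rewrite -(size_map phi cells); apply: uniq_leq_size; last first.
  move=> u /mapP[i /fP[fi _] ->]; rewrite /codes; apply/allpairsP; exists (f i, odd i.1, odd i.2).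
  split; [|by case: (odd i.2)|by []].
  apply/allpairsP; exists (f i, odd i.1); split => //=; first by rewrite mem_iota.
  by case: (odd i.1).
rewrite map_inj_in_uniq ?cells_uniq// => i j ic jc [fij o1 o2].
have [_ [x [Sx xi xq]]] := fP i ic; have [_ [y [Sy yj yq]]] := fP j jc.
have xy : `|x - y| <= h' / 4.
  have := dist_triangle (P`_(f i)) x y; rewrite {2}fij (distrC (P`_(f j)) y); lra.
have x0 := coordB_le_norm x y (ord0 : 'I_2); have y0 := coordB_le_norm x y (ord_max : 'I_2).
have [_ a1 a2] := cxP Sx; have [_ a3 a4] := cyP Sx.
have [_ b1 b2] := cxP Sy; have [_ b3 b4] := cyP Sy.
have e1 : i.1 = j.1.
  rewrite -xi -yj /=; apply: (@same_cell tx _ _ (X x) (X y)) => //; last exact: le_trans x0 xy.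
  by move: o1; rewrite -xi -yj.
have e2 : i.2 = j.2.
  rewrite -xi -yj /=; apply: (@same_cell ty _ _ (Y x) (Y y)) => //; last exact: le_trans y0 xy.
  by move: o2; rewrite -xi -yj.
by rewrite (surjective_pairing i) (surjective_pairing j) e1 e2.
Qed.

Let h_gt0 : 0 < h.
Proof. by rewrite hE mulr_gt0//; have := lam40; lra. Qed.

Let muh8 : mu * h <= h / 8.
Proof. by have := ler_wpM2r (ltW h_gt0) mu_le; rewrite mulrAC mul1r. Qed.

Lemma comb_in_box i : i \in cells -> [/\
  X al <= X (slot_start i) <= X al + 2 * h, X al <= tx i.1 + w / 4 <= X al + 2 * h,
  Y al <= Y p <= Y al + 2 * h & Y al <= level i <= Y al + 2 * h].
Proof.
move=> ic; have [/andP[s1 s2] _] := start_bounds ic cells_size.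
have [_ [x1 x2 _] [y1 y2 _]] := cell_bounds ic; have /andP[l1 l2] := level_bounds ic.
have [_ _ wd px /andP[py1 py2]] := fr.
have ox := wd (ord0 : 'I_2); have oy := wd (ord_max : 'I_2).
move: s1 s2 x1 x2 y1 y2 l1 l2 px py1 py2 ox oy muh40 w_gt0 muh8 h_gt0 wB bh40 B_gt0.
by move=> *; split; apply/andP; split; lra.
Qed.

Lemma comb_push i : i \in cells -> exists g, pushes (ord_max : 'I_2) (2 * B) Mp
  (trail (slot_start i) (comb i)) (slot_start i) (door i) g.
Proof.
move=> ic; have [d1 d2 _] := door_after_start ic cells_size.
have [_ s3] := start_bounds ic cells_size.
have [/andP[a1 a2] /andP[a3 a4] /andP[a5 a6] /andP[a7 a8]] := comb_in_box ic.
have tb : 2 * h <= T%:R * (2 * B / 2).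
  have -> : 2 * B / 2 = B by field.
  by have := ler_wpM2r (ltW h'0) Tb; rewrite hE /B; lra.
have B2 : 0 < 2 * B by rewrite mulr_gt0.
have := @trail_push _ _ (ord_max : 'I_2) (2 * B) B2 T (slot_start i) (comb i) T0.
case; last by move=> g gP; exists g.
have q0 : X (pt2 (X (slot_start i)) (level i)) = X (slot_start i) by exact: pt2_0.
have q1 : Y (pt2 (X (slot_start i)) (level i)) = level i by exact: pt2_1.
have e0 : X (door i) = tx i.1 + w / 4 by exact: pt2_0.
have e1 : Y (door i) = level i by exact: pt2_1.
rewrite /comb [path _ _ _]/= andbT; apply/andP; split; apply/andP; split.
- by apply: le_trans tb; apply: (@norm2_le_box _ _ _ (X al) (Y al)); rewrite ?q0 ?q1 ?s3 //;
    apply/andP.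
- by rewrite q1 s3; apply: le_trans d2; rewrite lerDl ltW.
- by apply: le_trans tb; apply: (@norm2_le_box _ _ _ (X al) (Y al)); rewrite ?q0 ?q1 ?e0 ?e1 //;
    apply/andP.
- by rewrite q1 e1.
Qed.

Lemma slots_sep i j : i \in cells -> j \in cells -> level j + 40 * B <= level i ->
  X (slot_start i) + 20 * B <= X (slot_start j).
Proof.
move=> ic jc ij; rewrite [X (slot_start i)]pt2_0 [X (slot_start j)]pt2_0.
have : (index i cells)%:R + 1 <= (index j cells)%:R :> R.
  by rewrite natr1 ler_nat; exact: rank_sep ij.
rewrite -subr_ge0 => /(mulr_ge0 (ltW B_gt0)).
by move: (index i cells)%:R (index j cells)%:R => u v; lra.
Qed.

Lemma comb_disjoint i j x z z' : i \in cells -> j \in cells ->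
  trail (slot_start i) (comb i) z -> `|x - z| < 2 * (2 * B) ->
  trail (slot_start j) (comb j) z' -> `|x - z'| < 2 * (2 * B) -> i = j.
Proof.
move=> ic jc zi xz zj xz'; apply: contrapT => /eqP ij.
have zz : `|z - z'| < 8 * B.
  apply: (le_lt_trans (dist_triangle x z z')); rewrite (distrC z x).
  by move: xz xz'; lra.
have [n1 n2 n3 n4] := near2 zz; move: n1 n2 n3 n4 B_gt0 => {zz}.
have [u1 u2] := (@slots_sep i j ic jc, @slots_sep j i jc ic).
case: (comb_cases ic cells_size zi) => -[a1 /andP[a2 a3]];
  case: (comb_cases jc cells_size zj) => -[b1 /andP[b2 b3]];
  case: (level_sep ic jc ij) => hl; [move: (u1 hl)|move: (u2 hl)|move: (u1 hl)|
    |move: hl|move: (u2 hl)|move: hl|move: hl];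
  move: a1 a2 a3 b1 b2 b3; try move: hl; lra.
Qed.

(** In the row of [j], rooms to the left are above the horizontal piece because levels drop to the
    right, and rooms to the right are beyond the door where it ends. Other rows are kept away by the
    margins of the cuts, and the vertical piece is left of all rooms. *)
Lemma room_off_comb i j x z : i \in cells -> j \in cells ->
  room h' (corner i) (far_corner i) (door i) x ->
  trail (slot_start j) (comb j) z -> `|x - z| < 2 * (2 * B) -> i = j.
Proof.
move=> ic jc /(room_in_cell ic)[[q1 q2 q3] [q4 q5 q6]] zj xz.
apply: contrapT => /eqP ij; have [n1 n2 n3 n4] := near2 xz.
have [_ [x1 _ _] _] := cell_bounds ic; have /andP[l1 l2] := level_bounds ic.
have /andP[l1' l2'] := level_bounds jc.
have [/andP[_ s2] _] := start_bounds jc cells_size.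
have [_ _ _ px _] := fr.
case: (comb_cases jc cells_size zj) => -[a1 /andP[a2 a3]].
  rewrite px in s2; move: x1 q1 a1 s2 n2 w_gt0 wB bh40 muh40 B_gt0.
  lra.
have e : X (door j) = tx j.1 + w / 4 by exact: pt2_0.
have [lt|lt|er] := ltngtP i.2 j.2.
- have := tmono tyS lt; move: q5 l1' a1 n3 n4 wB bh40 B_gt0 w_gt0.
  lra.
- have := tmono tyS lt; have /andP[t1 _] := tyS j.2.
  move: t1 q4 l1 l2' a1 n3 n4 wB bh40 wh' B_gt0 w_gt0.
  lra.
- have [lt|lt|e1] := ltngtP i.1 j.1.
  + have := level_row er lt; move: q4 a1 n3 n4 B_gt0; lra.
  + have := tmono txS lt; have /andP[t1 _] := txS j.1; rewrite e in a3.
    by move: t1 q1 a3 n1 n2 wB bh40 wh' w_gt0 B_gt0; lra.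
  + by move: ij; rewrite (surjective_pairing i) (surjective_pairing j) er e1 eqxx.
Qed.

Lemma comb_in_room i x z : i \in cells -> trail (slot_start i) (comb i) z ->
  `|x - z| < 2 * (2 * B) -> room h al om p x.
Proof.
move=> ic zi xz; have [n1 n2 n3 n4] := near2 xz.
have [_ [x1 x2 _] [y1 y2 _]] := cell_bounds ic; have /andP[l1 l2] := level_bounds ic.
have [/andP[s1 s2] _] := start_bounds ic cells_size.
have [_ d2 _] := door_after_start ic cells_size.
have [_ _ _ px /andP[py1 py2]] := fr; rewrite px in s1 s2.
have e : X (door i) = tx i.1 + w / 4 by exact: pt2_0.
case: (comb_cases ic cells_size zi) => -[a1 /andP[a2 a3]].
  have [xp|xp] := leP (Y x) (Y p).
    right; apply: (@le_lt_trans _ _ (3 / 2 * (b * h))); last first.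
      by have := mulr_gt0 b_gt0 h_gt0; lra.
    move: px xp s1 s2 a1 a2 n1 n2 n3 n4 muh40 wB bh40 B_gt0 w_gt0.
    by move=> *; apply: norm2_le; lra.
  left; move: xp s1 s2 a1 a3 n1 n2 n4 x1 x2 y2 l2 muh40 wB bh40 B_gt0 w_gt0.
  by move=> *; split; lra.
rewrite e in a3.
left; move: d2 s1 a1 a2 a3 n1 n2 n3 n4 x2 y2 l2 muh40 wB bh40 B_gt0 w_gt0.
by move=> *; split; lra.
Qed.

Lemma room_deep i x z : i \in cells ->
  room h' (corner i) (far_corner i) (door i) x -> ~ room h al om p z -> B <= `|x - z|.
Proof.
move=> ic /(room_in_cell ic)[[q1 q2 q3] [q4 q5 q6]] nz; rewrite leNgt; apply/negP => xz.
rewrite distrC in xz; have [n1 n2 n3 n4] := near2 xz; apply: nz; left.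
have [_ [x1 _ _] _] := cell_bounds ic; have /andP[l1 _] := level_bounds ic.
have [_ d2 _] := door_after_start ic cells_size.
move: q1 q3 q4 q6 n1 n2 n3 n4 x1 d2 muh40 wB bh40 B_gt0 w_gt0.
by move=> *; split; lra.
Qed.

Lemma rooms_apart i j x y : i \in cells -> j \in cells -> i != j ->
  room h' (corner i) (far_corner i) (door i) x ->
  room h' (corner j) (far_corner j) (door j) y -> B <= `|x - y|.
Proof.
move=> ic jc ij /(room_in_cell ic)[[q1 q2 q3] [q4 q5 q6]].
move=> /(room_in_cell jc)[[r1 r2 r3] [r4 r5 r6]]; rewrite leNgt; apply/negP => xy.
have [n1 n2 n3 n4] := near2 xy.
have /andP[l1 _] := level_bounds ic; have /andP[l1' _] := level_bounds jc.
have [lt|lt|e1] := ltngtP i.1 j.1.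
- by have := tmono txS lt; move: q2 r1 n1 n2 wB bh40 B_gt0; lra.
- by have := tmono txS lt; move: q1 r2 n1 n2 wB bh40 B_gt0; lra.
- have [lt|lt|e] := ltngtP i.2 j.2.
  + by have := tmono tyS lt; move: q5 r4 l1' n3 n4 wB bh40 B_gt0; lra.
  + by have := tmono tyS lt; move: q4 r5 l1 n3 n4 wB bh40 B_gt0; lra.
  + by move: ij; rewrite (surjective_pairing i) (surjective_pairing j) e e1 eqxx.
Qed.

Lemma room_diam x y : room h al om p x -> room h al om p y -> `|x - y| <= 2 * h.
Proof.
have [_ _ wd px /andP[py1 py2]] := fr.
have ox := wd (ord0 : 'I_2); have oy := wd (ord_max : 'I_2).
have rb x' : room h al om p x' ->
    X al <= X x' <= X al + 2 * h /\ Y al <= Y x' <= Y al + 2 * h.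
  have := (muh40, wB, bh40); move: muh8 h_gt0 B_gt0 w_gt0 => ? ? ? ? [[? ?] ?].
  by move=> [[]|/near2[]] *; split; apply/andP; split; lra.
by move=> /rb[h1 h2] /rb[h3 h4]; exact: norm2_le_box h1 h3 h2 h4.
Qed.

Lemma cell_frame i : i \in cells ->
  frame h' (corner i) (far_corner i) (door i) [set x | S x /\ (cx x, cy x) = i].
Proof.
move=> ic; have /andP[l1 l2] := level_bounds ic; have [SE Sb _ _ _] := fr.
split.
- by move=> x [Sx _]; exact: SE.
- move=> x l [Sx xi]; have /andP[_ sx2] := Sb x l Sx.
  have [_ a1 a2] := cxP Sx; have [_ a3 a4] := cyP Sx.
  move: a1 a2 a3 a4; rewrite -xi -/w /=.
  case: (ord2P l) sx2 => -> + a1 a2 a3 a4; rewrite ?pt2_0 ?pt2_1 /= => sx2.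
    by rewrite a1 lerBrDr le_min -lerBrDr a2; move: sx2 muh40 w_gt0; lra.
  by rewrite a3 lerBrDr le_min -lerBrDr a4; move: sx2 muh40 w_gt0; lra.
- move=> l; case: (ord2P l) => ->; rewrite ?pt2_0 ?pt2_1.
    by rewrite ge_min; apply/orP; left; have /andP[_ t2] := txS i.1.
  by rewrite ge_min; apply/orP; left; have /andP[_ t2] := tyS i.2.
- by rewrite !pt2_0.
- by rewrite !pt2_1 -/w; apply/andP; split.
Qed.

Variable eps : R.
Hypothesis IH : forall al om p S, frame h' al om p S ->
  catches J (Mp ^+ N * K) K eps (room h' al om p) p S.

(** Slots are [20 * B] and levels [40 * B] apart, against tubes of radius [4 * B]. Rooms keep a
    distance [B] and a room has diameter at most [2 * h], whence [K]. *)
Lemma room_step : catches J (Mp ^+ N * K) K eps (room h al om p) p S.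
Proof.
have sN := cells_size; have B0 := B_gt0; have hp := h_gt0.
have Mp1 : 1 <= Mp by rewrite exprn_ege1// exprn_ege1// ler1n.
have /choice[f fP] i : exists g, i \in cells -> pushes (ord_max : 'I_2) (2 * B) Mp
    (trail (slot_start i) (comb i)) (slot_start i) (door i) g.
  by have [/comb_push[g gP]|_] := boolP (i \in cells); [exists g|exists id].
have KE : K = Mp ^+ N * (2 * h / B + 1).
  rewrite /K /B hE; congr (_ * (_ + _)); field.
  by rewrite !gt_eqF.
rewrite KE.
apply: (@star_catches _ 2 J (ord_max : 'I_2) (2 * B) B (2 * h) Mp N _ cells
  (room h al om p) _ _ (fun i => room h' (corner i) (far_corner i) (door i))
  (fun i => [set x | S x /\ (cx x, cy x) = i])
  (fun i => trail (slot_start i) (comb i)) door slot_start f) => //.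
- lra.
- lra.
- exact: cells_uniq.
- by move=> i _; exact: trail_start.
- move=> i ic l; have [_ e] := start_bounds ic sN.
  by case: (ord2P l) => -> // _; rewrite e.
- move=> i x ic /(room_in_cell ic)[_ [q1 _ _]]; have [_ d2 _] := door_after_start ic sN.
  by move: q1 d2 B0 wB bh40; lra.
- move=> i x ic; rewrite [Y (door i)]pt2_1 => -[[_ _ + _]|xq] xl; last by rewrite ltW.
  by rewrite [Y (door i)]pt2_1 => /(le_lt_trans xl); rewrite ltxx.
- by move=> i j x ic jc [z zi xz] [z' zj xz']; exact: comb_disjoint zi xz zj xz'.
- by move=> i j x ic jc Wx [z zj xz]; exact: room_off_comb Wx zj xz.
- by move=> i x ic [z zi xz]; exact: comb_in_room zi xz.
- by move=> i x z ic; exact: room_deep.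
- exact: rooms_apart.
- exact: room_diam.
- by move=> x Sx; exists (cx x, cy x) => //; apply/cellsP; exists x.
- by move=> i ic; rewrite -KE; apply: IH; exact: cell_frame.
Qed.

End Step.
Lemma room_catches eps r h al om p S : 0 < h -> 2 * h <= eps * lam ^+ r ->
  frame h al om p S -> catches J (Mp ^+ N * K) K eps (room h al om p) p S.
Proof.
have l40 := lam40; have l0 : 0 < lam by lra.
have bp := b_gt0; have mp := mu_gt0; have m8 := mu_le; have MM := muM.
have Mp1 : 1 <= Mp ^+ N by rewrite exprn_ege1// exprn_ege1// exprn_ege1// ler1n.
elim: r h al om p S => [|r IH] h al om p S h0 he fr.
  have [SE Sb wd px /andP[py1 py2]] := fr.
  have K1 : 1 <= K.
    by rewrite mulr_ege1// lerDr ltW// divr_gt0// mulr_gt0.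
  have mh := mulr_gt0 mp h0; have mhh := ler_wpM2r (ltW h0) m8.
  have bh := mulr_gt0 bp h0.
  apply: catches_leaf => //; first exact: mulr_ege1.
    by right; rewrite subrr normr0; lra.
  move=> a Sa; have /andP[x1 x2] := Sb a (ord0 : 'I_2) Sa.
  have /andP[y1 y2] := Sb a (ord_max : 'I_2) Sa.
  have ox := wd (ord0 : 'I_2); have oy := wd (ord_max : 'I_2).
  by apply: norm2_le; lra.
pose h' := h / lam; have h'0 : 0 < h' by rewrite divr_gt0.
have hE : h = lam * h' by rewrite /h' mulrCA mulfV ?mulr1// gt_eqF.
have [SE Sb wd _ _] := fr.
have mh := mulr_gt0 mp h0; have mhh := ler_wpM2r (ltW h0) m8.
have w0 := mulr_gt0 mp h'0; have wh := ler_wpM2r (ltW h'0) m8.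
have wl : mu * h = lam * (mu * h') by rewrite hE mulrCA.
have w40 : 40 * (mu * h') <= mu * h by rewrite wl ler_wpM2r// ltW.
have h40 : 40 * h' <= h by rewrite hE ler_wpM2r// ltW.
(* The cuts start at three quarters of the margin of the frame: beyond [p], which is at most
   halfway, and still more than [mu * h'] short of [S]. *)
have cut (l : 'I_2) : exists (t : nat -> R) (c : 'rV[R]_2 -> nat),
    [/\ t 0%N = al ord0 l + 3 / 4 * (mu * h),
    forall i, t i + h' / 2 <= t i.+1 <= t i + 3 / 2 * h' &
    forall x, S x -> [/\ (c x < 2 * lamN)%N, t (c x) + mu * h' <= x ord0 l &
      x ord0 l <= t (c x).+1 - mu * h']].
  have := @cuts_exist _ _ _ _ _ S al l (2 * h) (mu * h') h'
    (al ord0 l + 3 / 4 * (mu * h)) M (2 * lamN) cE SE w0.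
  case.
  - by lra.
  - move=> x Sx; have /andP[x1 x2] := Sb x (ord0 : 'I_2) Sx.
    have /andP[y1 y2] := Sb x (ord_max : 'I_2) Sx.
    have ox := wd (ord0 : 'I_2); have oy := wd (ord_max : 'I_2).
    by apply: norm2_le; lra.
  - have -> : 2 * h / (mu * h') = 16 * lam * M%:R; last exact: CM.
    by rewrite hE /mu; field; rewrite pnatr_eq0 -lt0n M0 gt_eqF.
  - by have := congr1 ( *%R h') MM; lra.
  - exact: h'0.
  - move=> x Sx; have /andP[x1 x2] := Sb x l Sx; have ox := wd l.
    rewrite natrM -[2%:R * _ * _]mulrA -hE; split; lra.
  - by move=> t [c [t1 _ t3 t4]]; exists t, c.
have [tx [cx [tx0 txS cxP]]] := cut ord0.
have [ty [cy [ty0 tyS cyP]]] := cut ord_max.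
apply: (room_step h'0 hE fr tx0 ty0 txS tyS cxP cyP) => al' om' p' S' fr'.
apply: IH fr' => //; move: he; rewrite hE exprS.
by rewrite mulrCA (mulrCA eps) ler_pM2l.
Qed.

End Planar.

Lemma catchable_planar (R : realType) (E : set 'rV[R]_2) (C beta : R) :
  0 <= C -> 0 < beta -> beta < 1 -> covers C beta E -> catchable (fun l : 'I_2 => (l < 1)%N) E.
Proof.
move=> C0 b0' b1 cE.
have b1' : beta < 1%:R :> R by [].
have K1 : 0 <= C * 12 `^ beta by rewrite mulr_ge0// powR_ge0.
(* The factor 80 pays for [20 * N] with [N] four times a covering number; the summand 40 forces
   [lam >= 40]. *)
have [|lamN lam0 lamP] := @powR_le_exp R (80 * (C * 12 `^ beta) + 40) beta 1 _ b1'.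
  by lra.
pose lam : R := lamN%:R; rewrite -/lam expr1 in lamP.
have lam1 : 1 <= lam by rewrite ler1n.
have K2 : 0 <= C * (12 * lam) `^ beta by rewrite mulr_ge0// powR_ge0.
have lamE : 80 * (C * (12 * lam) `^ beta) + 40 * lam `^ beta <= lam.
  by apply: le_trans lamP; rewrite powRM//; lra.
have lam40 : 40 <= lam.
  have : 1 <= lam `^ beta by rewrite -(powRr0 lam); exact: (ler_powR lam1 (ltW b0')).
  lra.
have [N NP Nlam] : exists2 N : nat, forall k : nat,
    k%:R <= C * (12 * lam) `^ beta -> (4 * k <= N)%N & 20 * N%:R <= lam.
  exists (4 * Num.truncn (C * (12 * lam) `^ beta))%N => [k kC|].
    by rewrite leq_mul2l /= truncn_ge_nat.
  have /andP[tr _] := truncn_itv K2.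
  by have := powR_ge0 lam beta; rewrite natrM; lra.
have K3 : 0 <= C * (16 * lam) `^ beta + 1 by rewrite addr_ge0// mulr_ge0// powR_ge0.
have [M M0 MP] := powR_le_exp K3 b1'.
have CM : C * (16 * lam * M%:R) `^ beta < M%:R.
  have l0 : 0 <= 16 * lam by lra.
  rewrite powRM//.
  have Mb : 0 < M%:R `^ beta :> R by rewrite powR_gt0 ?ltr0n.
  by rewrite expr1 in MP; apply: lt_le_trans MP; lra.
pose mu : R := (8 * M%:R)^-1; pose b := mu / (320 * lam).
have MR : 1 <= M%:R :> R by rewrite ler1n.
have mu0 : 0 < mu by rewrite invr_gt0; lra.
have mu8 : mu <= 1 / 8 by rewrite /mu div1r lef_pV2 ?posrE; lra.
have bl0 : 0 < 320 * lam by lra.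
have b0 : 0 < b by exact: (divr_gt0 mu0 bl0).
have [T TP] := exists_nat_ge (2 * lam / b).
have T0 : (0 < T)%N.
  by rewrite -(ltr_nat R); apply: lt_le_trans TP; rewrite divr_gt0//; lra.
have Tb : 2 * lam <= T%:R * b by rewrite -ler_pdivrMr.
pose Mp : R := (2 ^+ T) ^+ 2; pose K := Mp ^+ N * (2 * lam / b + 1).
have Mp1 : 1 <= Mp ^+ N by rewrite exprn_ege1// exprn_ege1// exprn_ege1// ler1n.
exists (Mp ^+ N * K); split.
  have K0 : 0 <= 2 * lam / b by apply: divr_ge0; [lra|exact: ltW].
  have K1' : 1 <= 2 * lam / b + 1 by rewrite lerDr.
  have sqr (x y : R) : 1 <= x -> 1 <= y -> 1 <= x * (x * y).
    by move=> x1 y1; rewrite mulr_ege1// mulr_ege1.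
  exact: sqr Mp1 K1'.
move=> a0 rho eps Ea0 rho0 eps0.
have lam2 : 2 <= lam by lra.
have rho8 : 0 < 2 * (4 * rho) by lra.
have [r rP] := geometric_small lam2 rho8 eps0.
have lr0 : 0 < lam ^+ r by rewrite exprn_gt0//; lra.
rewrite ler_pdivrMr// in rP.
(* A box of half side [2 * rho] leaves a margin [rho] around the part of [E] to be caught, more than
   [mu * h]. *)
pose h := 4 * rho; have hE : h = 4 * rho by []; have h0 : 0 < h by lra.
have mh0 := mulr_gt0 mu0 h0; have mh8 := ler_wpM2r (ltW h0) mu8.
pose al := a0 - const_mx (2 * rho); pose om := a0 + const_mx (2 * rho).
pose p := al + const_mx (mu * h / 4).
pose S := E `&` [set a | `|a - a0| <= rho].
have fr : frame E M h al om p S.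
  rewrite /frame -/mu; split.
  - by move=> x [].
  - move=> x l [_ /= xa]; have := le_trans (coordB_le_norm x a0 l) xa.
    by rewrite ler_distl !mxE => /andP[x1 x2]; apply/andP; split; lra.
  - by move=> l; rewrite !mxE; lra.
  - by rewrite !mxE.
  - by rewrite !mxE; apply/andP; split; lra.
have [g [_ _ g3 _ g5]] := room_catches cE lam40 M0 CM NP Nlam T0 Tb h0 rP fr.
exists p, g; split; first exact: g3.
by move=> a Ea aa; have [//|x [px _ xe]] := g5 a; exists x.
Qed.

(** * Euclidean distances *)

Lemma norm_le_enorm (R : realType) (n : nat) (x : 'rV[R]_n) : `|x| <= enorm x.
Proof.
apply/(row_norm_leP _ (sqrtr_ge0 _)) => l; rewrite -sqrtr_sqr ler_sqrt.
  by rewrite (bigD1 l) //= lerDl sumr_ge0// => i _; exact: sqr_ge0.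
by rewrite sumr_ge0// => i _; exact: sqr_ge0.
Qed.

Lemma enorm_le_norm (R : realType) (n : nat) (x : 'rV[R]_n) : enorm x <= n%:R * `|x|.
Proof.
have nx : 0 <= n%:R * `|x| by rewrite mulr_ge0.
rewrite -[leRHS](ger0_norm nx) -sqrtr_sqr ler_sqrt ?sqr_ge0// exprMn.
apply: (@le_trans _ _ (\sum_(i < n) `|x| ^+ 2)).
  by apply: ler_sum => i _; rewrite -[leLHS]ger0_norm ?sqr_ge0// normrX lerXn2r
    ?nnegrE// coord_le_norm.
rewrite sumr_const card_ord -[leLHS]mulr_natl ler_wpM2r ?sqr_ge0//.
by rewrite -natrX ler_nat; case: (n) => // k; rewrite expnS expn1 leq_pmull.
Qed.

Section FromEuclidean.
Variables (R : realType) (n : nat) (E : set (euclidean R n)).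
Implicit Types x y : euclidean R n.

Let mdistE x y : mdist x y = enorm ((x : 'rV[R]_n) - y).
Proof. by []. Qed.

Let norm_le_mdist x y : `|(x : 'rV[R]_n) - y| <= mdist x y.
Proof. by rewrite mdistE norm_le_enorm. Qed.

Let mdist_le_norm x y : mdist x y <= n%:R * `|(x : 'rV[R]_n) - y|.
Proof. by rewrite mdistE enorm_le_norm. Qed.

Let mdist_le_diam (A : set (euclidean R n)) x y : A x -> A y ->
  ((mdist x y)%:E <= diam A)%E.
Proof. by move=> Ax Ay; apply: ereal_sup_ubound; right; exists x => //; exists y. Qed.

Let gap_le_mdist (A B : set (euclidean R n)) x y : A x -> B y ->
  (gap A B <= (mdist x y)%:E)%E.
Proof.
move=> Ax By; apply: (@le_trans _ _ (ereal_inf [set (mdist x y)%:E | y in B])).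
  by apply: ereal_inf_lbound; exists x.
by apply: ereal_inf_lbound; exists y.
Qed.

Lemma udisc_of_c_uniformly_disconnected (c : R) : 1 <= c ->
  c_uniformly_disconnected c E -> udisc (c * n%:R) (E : set 'rV[R]_n).
Proof.
move=> c1 ud x r Ex r0; have c0 : 0 < c by lra.
(* Scales above the diameter are not covered by the hypothesis; there [E] itself serves, with
   nothing left to separate it from. *)
have [rE|Er] := leP r%:E (diam E); last first.
  exists E; split => // y Ey; apply: le_trans (norm_le_mdist x y) _.
  by rewrite -lee_fin; apply: ltW; apply: le_lt_trans Er; exact: mdist_le_diam.
have [X [XE Xx Xr Xg]] := ud x r Ex r0 rE; exists X; split => //.
  move=> y Xy; apply: le_trans (norm_le_mdist x y) _.
  by rewrite -lee_fin; apply: le_trans Xr; exact: mdist_le_diam.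
move=> y z Xy Ez nz; have := le_trans Xg (@gap_le_mdist _ _ y z Xy (conj Ez nz)).
rewrite lee_fin ler_pdivrMr// => h; apply: (le_trans h).
by have := mdist_le_norm y z; rewrite -(ler_pM2r c0); lra.
Qed.

(** A sup-norm ball of radius [r] has Euclidean diameter at most 2nr, so the ratio 1/(2nQ), which is
    below 1, produces pieces of diameter at most r/Q. *)
Lemma covers_of_homogeneous (C beta : R) : (0 < n)%N -> 0 <= C -> 0 < beta ->
  C_homogeneous C beta E -> covers (C * (2 * n%:R) `^ beta) beta (E : set 'rV[R]_n).
Proof.
move=> n0 C0 b0 hE a r Q r0 Q1.
have nR : 1 <= n%:R :> R by rewrite ler1n.
have nQ : 1 <= n%:R * Q by rewrite mulr_ege1.
have dE : (2 * n%:R * Q)^-1 = (2 * n%:R * Q) `^ (-1) by rewrite powR_inv1//; lra.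
pose A : set (euclidean R n) := E `&` [set e | `|(e : 'rV[R]_n) - a| <= r].
have dA : (diam A <= (2 * n%:R * r)%:E)%E.
  apply: ge_ereal_sup => _ [->|[x [_ /= xa]] [y [_ /= ya]] <-]; rewrite lee_fin.
    by rewrite !mulr_ge0//; lra.
  apply: (le_trans (mdist_le_norm x y)).
  have := dist_triangle a (x : 'rV[R]_n) y; rewrite (distrC a) => xy.
  have h : `|(x : 'rV[R]_n) - y| <= 2 * r by lra.
  by have := ler_wpM2l (ler0n R n) h; lra.
have [||F [AF FB sF]] := hE A (2 * n%:R * Q)^-1 (@subIsetl _ _ _).
- by apply: le_lt_trans dA _; exact: ltry.
- by apply/andP; split; [rewrite invr_gt0|rewrite invf_lt1]; lra.
(* One point is taken from each piece; an empty piece contributes the irrelevant default [a]. *)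
exists [seq xget (a : euclidean R n) B | B <- finmap.enum_fset F]; split.
  rewrite size_map; apply: (le_trans sF); rewrite dE -powRrM mulN1r opprK powRM//; try lra.
move=> e Ee ea; have [B BF Be] := AF e (conj Ee ea).
exists (xget (a : euclidean R n) B); first by apply/mapP; exists B.
have pB : B (xget (a : euclidean R n) B) by apply: xgetPex; exists e.
have [_ dB] := FB B BF; apply: (le_trans (norm_le_mdist _ _)).
rewrite -lee_fin; apply: (le_trans (mdist_le_diam Be pB)); apply: (le_trans dB).
apply: (@le_trans _ _ ((2 * n%:R * Q)^-1%:E * (2 * n%:R * r)%:E)%E).
  by rewrite lee_wpmul2l// lee_fin invr_ge0; lra.
rewrite -EFinM lee_fin.
suff -> : (2 * n%:R * Q)^-1 * (2 * n%:R * r) = r / Q by [].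
by field; rewrite !gt_eqF//; lra.
Qed.

End FromEuclidean.

(** * The limit surface *)

Section Ultralimit.
Import numFieldNormedType.Exports.

Lemma ultralimit (R : realType) (n : nat) (G : set_system nat) (u : nat -> 'rV[R]_n) (B : R) :
  UltraFilter G -> (forall j, `|u j| <= B) ->
  exists l, forall e, 0 < e -> G [set j | `|l - u j| <= e].
Proof.
move=> UG uB; have FG := @ultra_proper _ G UG.
have cpt : compact [set v : 'rV[R]_n | forall i, `[- B, B]%classic (v ord0 i)].
  by apply: (@rV_compact R n (fun=> `[- B, B]%classic)) => i; exact: segment_compact.
have uG : (u @ G) [set v : 'rV[R]_n | forall i, `[- B, B]%classic (v ord0 i)].
  apply: (@filterS _ G _ setT) (@filterT _ G _) => j _ i /=; rewrite in_itv /= -ler_norml.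
  exact: le_trans (coord_le_norm (u j) i) (uB j).
have [l [_ /= lG]] := cpt _ _ uG.
exists l => e e0.
have [//|nG] := in_ultra_setVsetC [set j | `|l - u j| <= e] UG.
have [v [/= nv lv]] := lG [set v | ~ `|l - v| <= e] _ nG (nbhsx_ballx l e e0).
by case: nv; apply: ltW; move: lv; rewrite -ball_normE.
Qed.

End Ultralimit.

Section Limit.
Variables (R : realType) (m n : nat) (L : R) (E : set 'rV[R]_n) (a0 : 'rV[R]_n).
Variable F : nat -> 'rV[R]_m -> 'rV[R]_n.
Hypothesis L1 : 1 <= L.
Hypothesis FL : forall j x y, `|x - y| <= L * `|F j x - F j y| /\ `|F j x - F j y| <= L * `|x - y|.
Hypothesis F0 : forall j, `|F j 0 - a0| <= 1.
Hypothesis FE : forall j a, E a -> `|a - a0| <= j%:R -> exists x, `|F j x - a| <= j.+1%:R^-1.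

(** Along an ultrafilter all pointwise limits exist at once. The lower Lipschitz bound keeps the
    approximate preimages of a point of [E] bounded, so they converge too, and the upper one carries
    their limit to that point. *)
Lemma limit_surface : exists f : 'rV[R]_m -> 'rV[R]_n,
  (forall x y, `|x - y| <= L * `|f x - f y| /\ `|f x - f y| <= L * `|x - y|) /\
  E `<=` range f.
Proof.
have [G [UG Goo]] := @ultraFilterLemma nat (\oo%classic) _.
have PG := @ultra_proper _ G UG.
have L0 : 0 < L by have := L1; lra.
have /choice[f fP] x : exists l, forall e, 0 < e -> G [set j | `|l - F j x| <= e].
  apply: (@ultralimit _ _ _ _ (L * `|x| + 1 + `|a0|)) => j.
  have [_] := FL j x 0; rewrite subr0 => h.
  have := dist_triangle (F j 0) (F j x) a0; have := F0 j.
  have := ler_normD (F j x - a0) a0; rewrite subrK; lra.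
have near3 e x y : 0 < e -> exists j, `|f x - F j x| <= e /\ `|f y - F j y| <= e.
  move=> e0; have [j [h1 h2]] := filter_ex (filterI (fP x e e0) (fP y e e0)).
  by exists j.
exists f; split.
  move=> x y; split; apply/ler_addgt0Pr => e e0.
    have e1 : 0 < e / (2 * L) by rewrite divr_gt0// mulr_gt0.
    have [j [xj yj]] := near3 _ x y e1; have [h _] := FL j x y.
    apply: (le_trans h).
    have := dist_triangle (f x) (F j x) (F j y); have := dist_triangle (f y) (f x) (F j y).
    rewrite (distrC (F j x) (f x)) => t1 t2.
    have t : `|F j x - F j y| <= `|f x - f y| + e / L.
      have -> : e / L = 2 * (e / (2 * L)) by field; rewrite gt_eqF.
      lra.
    have := ler_wpM2l (ltW L0) t; rewrite mulrDr (mulrC L (e / L)) divfK ?gt_eqF//.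
  have e1 : 0 < e / 2 by rewrite divr_gt0.
  have [j [xj yj]] := near3 _ x y e1; have [_ h] := FL j x y.
  have := dist_triangle (F j x) (f x) (f y); have := dist_triangle (F j y) (F j x) (f y).
  rewrite (distrC (F j y) (f y)); lra.
move=> a Ea.
have /choice[xs xsP] j : exists x, `|a - a0| <= j%:R -> `|F j x - a| <= j.+1%:R^-1.
  have [aj|_] := boolP (`|a - a0| <= j%:R); last by exists 0.
  by have [x xP] := FE Ea aj; exists x.
have j1 j : j.+1%:R^-1 <= 1 :> R by rewrite invf_le1// ler1n.
(* The value 0 for small [j] only serves to bound the sequence at every index; the ultrafilter
   ignores these indices. *)
pose ys j := if `|a - a0| <= j%:R then xs j else 0.
have [j|x xP] := @ultralimit _ _ G ys (L * (`|a - a0| + 2)) UG.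
  rewrite /ys; case: ifPn => [/xsP h|_]; last first.
    by rewrite normr0 mulr_ge0 ?addr_ge0// ltW.
  have [+ _] := FL j (xs j) 0; rewrite subr0 => /le_trans; apply.
  rewrite ler_pM2l//; have := dist_triangle a (F j (xs j)) (F j 0).
  have := dist_triangle a0 a (F j 0); rewrite (distrC a0 (F j 0)).
  by have := F0 j; have := le_trans h (j1 j); lra.
exists x => //; apply/eqP; rewrite -subr_eq0 -normr_le0; apply/ler_addgt0Pr => e e0.
have e1 : 0 < e / (L + 2) by rewrite divr_gt0//; lra.
have [J JP] := exists_nat_ge (`|a - a0| + (e / (L + 2))^-1).
have GJ : G [set j | (J <= j)%N] by apply: Goo; exact: nbhs_infty_ge.
have [j [[h1 h2] h3]] := filter_ex (filterI (filterI (fP x _ e1) (xP _ e1)) GJ).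
have jJ : J%:R <= j%:R :> R by rewrite ler_nat.
have ie : 0 < (e / (L + 2))^-1 by rewrite invr_gt0.
have aj : `|a - a0| <= j%:R by lra.
move: h1 h2; rewrite /= /ys aj => h1 h2.
have h4 := xsP j aj; have [_ h5] := FL j x (xs j).
have h6 : j.+1%:R^-1 <= e / (L + 2).
  rewrite -[leRHS]invrK lef_pV2 ?posrE//; rewrite -natr1; have := normr_ge0 (a - a0); lra.
have h7 := ler_wpM2l (ltW L0) h2.
have -> : 0 + e = e / (L + 2) * (L + 2) by rewrite add0r divfK// gt_eqF//; lra.
have h8 := le_trans h4 h6; have h9 := le_trans h5 h7.
have := dist_triangle (F j x) (f x) a; have := dist_triangle (F j (xs j)) (F j x) a.
by move: h1 h8 h9; clear; move: (e / (L + 2)) => d; lra.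
Qed.

End Limit.

(** * Parametrizing the caught surfaces by [m] coordinates *)

Section Extend.
Variables (R : realType) (m n : nat) (E : set 'rV[R]_n).
Hypothesis mn : (m <= n)%N.
Let J : pred 'I_n := fun l => (l < m)%N.

Definition widen_row (x : 'rV[R]_m) : 'rV[R]_n :=
  \row_l (if insub (val l) is Some i then x ord0 i else 0).

Lemma widen_rowE x (i : 'I_m) : widen_row x ord0 (widen_ord mn i) = x ord0 i.
Proof. by rewrite mxE /= insubT ?ltn_ord // => h; congr (x _ _); exact: val_inj. Qed.

Lemma widen_row0 x l : ~~ J l -> widen_row x ord0 l = 0.
Proof. by move=> h; rewrite mxE insubN. Qed.

Lemma widen_row_norm x y : `|widen_row x - widen_row y| = `|x - y|.
Proof.
apply/eqP; rewrite eq_le; apply/andP; split.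
  apply/(row_norm_leP _ (normr_ge0 _)) => l; rewrite coordB !mxE.
  case: insubP => [i _ _|_]; first exact: coordB_le_norm.
  by rewrite subrr normr0.
apply/(row_norm_leP _ (normr_ge0 _)) => i; rewrite coordB -!widen_rowE.
exact: coordB_le_norm.
Qed.

Lemma widen_row_plane (p y : 'rV[R]_n) : plane J p y -> exists x, y = p + widen_row x.
Proof.
move=> py; exists (\row_i (y ord0 (widen_ord mn i) - p ord0 (widen_ord mn i))).
apply/rowP => l; rewrite mxE; have [lm|lm] := boolP (J l); last first.
  by rewrite widen_row0// addr0 py.
have -> : l = widen_ord mn (Ordinal lm) by exact: val_inj.
by rewrite widen_rowE mxE addrC subrK.
Qed.

Lemma plane_widen_row (p q : 'rV[R]_n) x : plane J p q -> plane J p (q + widen_row x).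
Proof. by move=> pq l lJ; rewrite mxE widen_row0// addr0 pq. Qed.

Lemma catchable_surface : E !=set0 -> catchable J E ->
  exists2 L : R, 1 <= L & exists f : 'rV[R]_m -> 'rV[R]_n,
  (forall x y, `|x - y| <= L * `|f x - f y| /\ `|f x - f y| <= L * `|x - y|) /\
  E `<=` range f.
Proof.
move=> [a0 Ea0] [L [L1 cL]]; exists L => //.
have /choice[F FP] (j : nat) : exists F : 'rV[R]_m -> 'rV[R]_n,
    [/\ forall x y, `|x - y| <= L * `|F x - F y| /\ `|F x - F y| <= L * `|x - y|,
      `|F 0 - a0| <= 1 &
      forall a, E a -> `|a - a0| <= j%:R -> exists x, `|F x - a| <= j.+1%:R^-1].
  (* The radius is [j.+1] since [catchable] asks for a positive one also at [j = 0]. *)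
  have r0 : 0 < j.+1%:R :> R by [].
  have e0 : 0 < j.+1%:R^-1 :> R by rewrite invr_gt0.
  have [p [g [gL gE]]] := cL a0 _ _ Ea0 r0 e0.
  (* The parametrization is centred at a point whose image is near [a0]; otherwise the images of 0
     could escape to infinity with [j]. *)
  have [|q [pq qa]] := gE a0 Ea0; first by rewrite subrr normr0.
  have w0 : widen_row 0 = 0 by apply/rowP => l; rewrite !mxE; case: insubP => // i; rewrite mxE.
  exists (fun x => g (q + widen_row x)); split.
  - move=> x y; have := gL _ _ (plane_widen_row x pq) (plane_widen_row y pq).
    by rewrite /= opprD addrACA subrr add0r widen_row_norm.
  - by rewrite w0 addr0; apply: (le_trans qa); rewrite invf_le1// ler1n.
  - move=> a Ea aj; have [|y [py ya]] := gE a Ea.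
      by apply: (le_trans aj); rewrite ler_nat.
    have qy : plane J q y by move=> l lJ; rewrite py// pq.
    by have [x xE] := widen_row_plane qy; exists x; rewrite -xE.
have F1 j := let: And3 h _ _ := FP j in h.
have F2 j := let: And3 _ h _ := FP j in h.
have F3 j := let: And3 _ _ h := FP j in h.
exact: limit_surface L1 F1 F2 F3.
Qed.

End Extend.

Lemma bilipschitz_of_norm (R : realType) (m n : nat) (L : R) (f : euclidean R m -> euclidean R n) :
  (0 < n)%N -> (m <= n)%N -> 1 <= L ->
  (forall x y : 'rV[R]_m, `|x - y| <= L * `|(f x : 'rV[R]_n) - f y| /\
    `|(f x : 'rV[R]_n) - f y| <= L * `|x - y|) ->
  bilipschitz_embedding f.
Proof.
move=> n0 mn L1 fL; have nR : 1 <= n%:R :> R by rewrite ler1n.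
have mnR : m%:R <= n%:R :> R by rewrite ler_nat.
have nL : 1 <= n%:R * L by rewrite mulr_ege1.
exists (n%:R * L); split => // x y; have [h1 h2] := fL x y.
have nL0 : 0 <= n%:R * L by rewrite (le_trans ler01).
have hx : mdist x y <= m%:R * `|(x : 'rV[R]_m) - y| := enorm_le_norm _.
have hx' : `|(x : 'rV[R]_m) - y| <= mdist x y := norm_le_enorm _.
have hf : mdist (f x) (f y) <= n%:R * `|(f x : 'rV[R]_n) - f y| := enorm_le_norm _.
have hf' : `|(f x : 'rV[R]_n) - f y| <= mdist (f x) (f y) := norm_le_enorm _.
apply/andP; split.
  rewrite ler_pdivrMl; last exact: lt_le_trans ltr01 nL.
  apply: (le_trans hx); apply: (le_trans (ler_wpM2r (normr_ge0 _) mnR)).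
  rewrite -mulrA ler_wpM2l//; apply: (le_trans h1).
  by rewrite ler_wpM2l// (le_trans ler01).
apply: (le_trans hf); rewrite -mulrA ler_wpM2l//; apply: (le_trans h2).
by rewrite ler_wpM2l// (le_trans ler01).
Qed.

Theorem theorem3p4 (R : realType) (m n : nat) (hm : (1 <= m)%N)
    (hmn : (m <= n - 1)%N) (E : set (euclidean R n))
    (hE : uniformly_disconnected E) (hdim : (assouad_dim E < m%:R%:E)%E) :
  exists f : euclidean R m -> euclidean R n,
    bilipschitz_embedding f /\ E `<=` range f.
Proof.
have n1 : (1 < n)%N by rewrite -subn_gt0 (leq_trans hm).
have n0 : (0 < n)%N by exact: ltnW.
have mn : (m < n)%N by rewrite (leq_ltn_trans hmn)// subn1 prednK.
have [_ [beta [b0 [C [C1 hC]]] <-]] := ereal_inf_lt hdim; rewrite lte_fin => bm.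
have [c [c1 /(udisc_of_c_uniformly_disconnected c1) ud]] := hE.
have C0 : 0 <= C by rewrite (le_trans ler01)// ltW.
have cE := covers_of_homogeneous n0 C0 b0 hC.
have {C0} C0 : 0 <= C * (2 * n%:R) `^ beta by rewrite mulr_ge0// powR_ge0.
have c1n : 1 <= c * n%:R by rewrite mulr_ege1// ler1n.
(* Centring the approximations needs a point of [E]; for empty [E] a coordinate plane will do. *)
have [E0|/set0P Ene] := eqVneq (E : set 'rV[R]_n) set0.
  exists (@widen_row R m n); split; last by rewrite E0; exact: sub0set.
  apply: (@bilipschitz_of_norm _ _ _ 1) => // [|x y]; first exact: ltnW.
  by rewrite (widen_row_norm (ltnW mn)) mul1r.
suff cat : catchable (fun l : 'I_n => (l < m)%N) (E : set 'rV[R]_n).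
  have [L L1 [f [fL Ef]]] := catchable_surface (ltnW mn) Ene cat.
  by exists f; split => //; apply: bilipschitz_of_norm fL => //; exact: ltnW.
have [n3|n2] := ltnP 2 n; first exact: catchable_high ud cE.
have nE : n = 2%N by apply/eqP; rewrite eqn_leq n2.
have mE : m = 1%N by apply/eqP; rewrite eqn_leq hm andbT -ltnS -nE.
move: E cE C0 {hE hdim hC ud Ene c1n hmn mn n1 n0 n2} bm; rewrite nE mE => E cE C0 bm.
exact: catchable_planar C0 b0 bm cE.
Qed.
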